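(* There is a universal constant $c>0$ such that the following holds for every $n\ge 1$. Let $\mu$ be the standard Gaussian measure on $\mathbb{R}$ and endow $\mathbb{R}^n$ with $\mu^{\otimes n}$. For any transitive Borel-measurable set $A\subset\mathbb{R}^n$, with $t=\mu^{\otimes n}(A)$, $$\liminf_{r\downarrow 0}\frac{\mu^{\otimes n}(A+[-r,r]^n)-\mu^{\otimes n}(A)}{r}\ge c\,t(1-t)\sqrt{\log n}.$$
   Context: A set $A\subseteq\mathbb{R}^n$ is transitive if its characteristic function is invariant under the action (by permuting the $n$ coordinates) of some subgroup of the symmetric group $S_n$ that acts transitively on $\{1,\dots,n\}$. $A+[-r,r]^n$ is the Minkowski sum. *)

(* Defs.v *)
From HB Require Import structures.
From mathcomp Require Import all_boot all_order all_algebra all_fingroup.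
From mathcomp Require Import all_classical all_reals all_analysis.

Set Implicit Arguments.
Unset Strict Implicit.
Unset Printing Implicit Defensive.

Import Order.TTheory GRing.Theory Num.Theory.
Import numFieldNormedType.Exports.

Local Open Scope classical_set_scope.
Local Open Scope ring_scope.

(* R^n is n.-tuple R. The library's sigma-algebra on n.-tuple R is generated by
   the coordinate maps; it is the Borel sigma-algebra of R^n because R is second
   countable. *)

Section power_prob.
Context {d : measure_display} {T : measurableType d} {R : realType}.

Definition cons_pair n (x : T * n.-tuple T) : n.+1.-tuple T :=
  [tuple of x.1 :: x.2].

Lemma measurable_cons_pair n :
  measurable_fun [set: T * n.-tuple T] (@cons_pair n).
Proof. exact: measurable_cons. Qed.

HB.instance Definition _ n :=
  isMeasurableFun.Build _ _ _ _ (@cons_pair n) (@measurable_cons_pair n).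

(* The n-fold product of P with itself: the Dirac mass on the one-point space
   T^0, then the image of P \x P^n under the bijection T * T^n -> T^(n+1). *)
Fixpoint power_prob (P : probability T R) (n : nat) :
    probability (n.-tuple T) R :=
  match n with
  | 0 => \d_([tuple] : 0.-tuple T)
  | m.+1 => distribution (P \x power_prob P m)%E (@cons_pair m)
  end.

(* The characteristic property of the product measure. *)
Lemma power_prob_box (P : probability T R) n (B : 'I_n -> set T) :
  (forall i, measurable (B i)) ->
  power_prob P n [set x | forall i, B i (tnth x i)] = (\prod_(i < n) P (B i))%E.
Proof.
elim: n B => [|n IHn] B mB.
  by rewrite big_ord0 /= diracE mem_set// => -[].
have mbox : measurable
    [set x : n.-tuple T | forall i, B (lift ord0 i) (tnth x i)].
  rewrite [X in measurable X](_ : _ = \big[setI/setT]_(i < n)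
      ((@tnth n T ^~ i) @^-1` B (lift ord0 i))); last first.
    by rewrite -bigcap_seq; apply/seteqP; split=> [x h i _|x h i] /=;
      [exact: h|apply: h; rewrite /= mem_index_enum].
  apply: bigsetI_measurable => i _.
  by rewrite -[X in measurable X]setTI; exact: measurable_tnth.
rewrite big_ord_recl -IHn// -product_measure1E//=.
rewrite /distribution /pushforward; congr ((_ \x _)%E _).
apply/seteqP; split=> [[x y] /= h|[x y] /= [hx hy] i].
  split=> [|i]; first by have := h ord0; rewrite tnth0.
  by have := h (lift ord0 i); rewrite tnthS.
by case: (unliftP ord0 i) => [j ->|->]; rewrite ?tnthS ?tnth0.
Qed.

End power_prob.

Section gauss.
Context {R : realType}.
Implicit Types n : nat.

Definition std_gauss : probability (measurableTypeR R) R := normal_prob 0 1.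

Definition gauss n : probability (n.-tuple (measurableTypeR R)) R :=
  power_prob std_gauss n.

(* Minkowski sums of a Borel set with a cube are analytic, hence measurable for
   the completion of gauss n, but they need not be Borel. The completion is the
   restriction of the outer measure mu_ext (gauss n) to its Caratheodory
   measurable sets, and mu_ext (gauss n) agrees with gauss n on Borel sets
   (measurable_mu_extE). *)
Definition gauss_completed n : set (n.-tuple R) -> \bar R := mu_ext (gauss n).

Definition minkowski_sum n (A B : set (n.-tuple R)) : set (n.-tuple R) :=
  [set [tuple tnth a i + tnth b i | i < n] | a in A & b in B].

Definition cube n (r : R) : set (n.-tuple R) :=
  [set x | forall i, - r <= tnth x i <= r].

Definition permute_coord n (s : 'S_n) (x : n.-tuple R) : n.-tuple R :=
  [tuple tnth x (s i) | i < n].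

Definition transitive_set n (A : set (n.-tuple R)) : Prop :=
  exists2 G : {group 'S_n}, [transitive G, on [set: 'I_n]%SET | 'P] &
    forall s, s \in G -> forall x, \1_A (permute_coord s x) = \1_A x :> R.

End gauss.

Arguments cube {R} n r.

(* Main.v *)
(** Let [A] have variance [v = t (1 - t)] and suppose that the cubes
    [A + [-r, r]^n] gain at most [d r] for arbitrarily small [r]. Smoothing the
    indicator of [A] with Gaussian noise and moving every coordinate by [r] in
    the direction of the sign of the gradient shows that the [L^1] norms of the
    partial derivatives of the smoothing add up to at most [d], suitably
    normalised; by transitivity they are all equal, hence at most [d / n].
    Consequently rotating the pair [(x, z)] by an angle [al i] in coordinate [i]
    changes the indicator by at most [2 (d / n) sum |al i|] in [L^1].

    Rotating one coordinate by [pi / 2] resamples it, so every influence is at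
    most [d pi / n]. Efron-Stein and hypercontractivity at one fixed correlation
    [r] then bound the centered noise correlation [b (r ^ 2)] by
    [n (d pi / n) ^ (3 / 2)], which is at most [v n ^ (- 1 / 4)] if
    [d <= c v sqrt (log n)]. Since [b (sg) ^ 2 <= v b (sg ^ 2)], this gives
    [b (sg) <= 8 v / 9] for some [sg] with [1 - sg] of order [1 / log n].
    Rotating all coordinates by [th = acos sg], of order [1 / sqrt (log n)],
    yields [v - b (sg) <= d th], so [d] is at least of order
    [v sqrt (log n)]. *)

(* An indicator has no gradient, so every derivative is taken on the Gaussian side: shifting the
   argument of a smoothing amounts to shifting the noise, and the Cameron-Martin density of that
   shift can be expanded. The constants of these expansions grow exponentially in [n], which is
   harmless: they only multiply second-order terms in a step that tends to 0 for fixed [n]. After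
   smoothing by an angle [phi], the normalised partial derivatives are at most [s * d / n] with
   [s = sin phi], while a rotation costs [c / s] times as much; [s] cancels, so [phi] can tend to 0.
   The gain over trivial bounds comes from the exponent [3 / 2 > 1], hence from an inequality from
   [L^2] to [L^4]. One correlation is enough, since log-convexity carries the estimate to
   correlations near 1: a root of order [2 ^ k ~ log n] turns a negative power of [n] into a
   constant below 1. That correlation can be chosen so that the noise dominates, which makes the
   one-dimensional inequality elementary. *)
From HB Require Import structures.
Require Import Defs.
From mathcomp Require Import all_boot all_order all_algebra all_fingroup.
From mathcomp Require Import all_classical all_reals all_analysis.
From mathcomp Require Import measurable_realfun ring lra.

Import Order.TTheory GRing.Theory Num.Theory.
Import numFieldNormedType.Exports.

Set Implicit Arguments.
Unset Strict Implicit.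
Unset Printing Implicit Defensive.

Local Open Scope classical_set_scope.
Local Open Scope ring_scope.

(** * Expectations of bounded functions *)

Section bounded_functions.
Context d (T : measurableType d) (R : realType).
Implicit Types F G : T -> R.

(** This class is integrable for every probability and stable under all the operations below, so
    most integrability conditions reduce to it. The lock keeps the conjunction from being opened by
    tactics. *)
Definition bmf F :=
  locked (measurable_fun setT F /\ exists M, forall x, `|F x| <= M).

Lemma bmfI F M : measurable_fun setT F -> (forall x, `|F x| <= M) -> bmf F.
Proof. by move=> mF hM; rewrite /bmf -lock; split=> //; exists M. Qed.

Lemma bmf_meas F : bmf F -> measurable_fun setT F.
Proof. by rewrite /bmf -lock => -[]. Qed.

Lemma bmf_bound F : bmf F -> exists M, forall x, `|F x| <= M.
Proof. by rewrite /bmf -lock => -[]. Qed.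

Lemma bmf_cst r : bmf (fun=> r).
Proof. exact: (@bmfI _ `|r|). Qed.

Lemma bmfD F G : bmf F -> bmf G -> bmf (fun x => F x + G x).
Proof.
move=> bF bG; have [M hM] := bmf_bound bF; have [N hN] := bmf_bound bG.
apply: (@bmfI _ (M + N)); first by apply: measurable_funD; exact: bmf_meas.
by move=> x; apply: (le_trans (ler_normD _ _)); exact: lerD.
Qed.

Lemma bmfM F G : bmf F -> bmf G -> bmf (fun x => F x * G x).
Proof.
move=> bF bG; have [M hM] := bmf_bound bF; have [N hN] := bmf_bound bG.
apply: (@bmfI _ (M * N)); first by apply: measurable_funM; exact: bmf_meas.
by move=> x; rewrite normrM ler_pM.
Qed.

Lemma bmfN F : bmf F -> bmf (fun x => - F x).
Proof.
move=> bF; have [M hM] := bmf_bound bF; apply: (@bmfI _ M).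
  by apply: measurableT_comp => //; exact: bmf_meas.
by move=> x; rewrite normrN.
Qed.

Lemma bmfB F G : bmf F -> bmf G -> bmf (fun x => F x - G x).
Proof. by move=> hF hG; apply: bmfD => //; exact: bmfN. Qed.

Lemma bmf_norm F : bmf F -> bmf (fun x => `|F x|).
Proof.
move=> bF; have [M hM] := bmf_bound bF; apply: (@bmfI _ M).
  by apply: measurableT_comp => //; exact: bmf_meas.
by move=> x; rewrite normr_id.
Qed.

Lemma bmfX F k : bmf F -> bmf (fun x => F x ^+ k).
Proof.
move=> hF; elim: k => [|k IH]; first exact: bmf_cst.
by under eq_fun do rewrite exprS; exact: bmfM.
Qed.

Lemma bmf_indic (A : set T) : measurable A -> bmf (\1_A : T -> R).
Proof.
move=> mA; apply: (@bmfI _ 1); first exact: measurable_indic.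
by move=> x; rewrite indicE ger0_norm// lern1 leq_b1.
Qed.

Lemma bmf_integrable (P : probability T R) F : bmf F ->
  P.-integrable setT (EFin \o F).
Proof.
move=> bF; have mF := bmf_meas bF; have [M hM] := bmf_bound bF.
apply: (@le_integrable _ _ _ P _ measurableT _ (EFin \o cst M)).
- exact/measurable_EFinP.
- by move=> x _; rewrite /= lee_fin (le_trans (hM x))// ler_norm.
- exact: finite_measure_integrable_cst.
Qed.
End bounded_functions.

Lemma bmf_comp d1 d2 (T1 : measurableType d1) (T2 : measurableType d2)
    (R : realType) (F : T2 -> R) (phi : T1 -> T2) :
  bmf F -> measurable_fun setT phi -> bmf (fun x => F (phi x)).
Proof.
move=> bF mphi; have mF := bmf_meas bF; have [M hM] := bmf_bound bF.
by apply: (@bmfI _ _ _ _ M); [exact: measurableT_comp|].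
Qed.

Notation Ex P F := (Rintegral P setT F).
Notation intg P F := (P.-integrable setT (EFin \o F)).

Section expectation.
Context d (T : measurableType d) (R : realType) (P : probability T R).
Implicit Types F G : T -> R.

Lemma Ex_cst r : Ex P (fun=> r) = r.
Proof.
rewrite Rintegral_cst// [X in fine X](_ : _ = 1%E) ?mulr1//.
exact: probability_setT.
Qed.

Lemma ExD F G : intg P F -> intg P G ->
  Ex P (fun x => F x + G x) = Ex P F + Ex P G.
Proof. by move=> iF iG; rewrite RintegralD. Qed.

Lemma ExB F G : intg P F -> intg P G ->
  Ex P (fun x => F x - G x) = Ex P F - Ex P G.
Proof. by move=> iF iG; rewrite RintegralB. Qed.

Lemma ExZ r F : intg P F -> Ex P (fun x => r * F x) = r * Ex P F.
Proof. by move=> iF; rewrite RintegralZl. Qed.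

Lemma le_Ex F G : intg P F -> intg P G -> (forall x, F x <= G x) ->
  Ex P F <= Ex P G.
Proof. by move=> iF iG FG; apply: le_Rintegral. Qed.

Lemma eq_Ex F G : F =1 G -> Ex P F = Ex P G.
Proof. by move=> FG; apply: eq_Rintegral => x _. Qed.

Lemma Ex_ge0 F : (forall x, 0 <= F x) -> 0 <= Ex P F.
Proof. by move=> F0; apply: Rintegral_ge0. Qed.

Lemma Ex_norm F : intg P F -> `|Ex P F| <= Ex P (fun x => `|F x|).
Proof. by move=> iF; apply: le_normr_Rintegral. Qed.

Lemma intgD F G : intg P F -> intg P G -> intg P (fun x => F x + G x).
Proof. by move=> iF iG; have := integrableD measurableT iF iG. Qed.

Lemma intgZ r F : intg P F -> intg P (fun x => r * F x).
Proof. by move=> iF; have := integrableZl measurableT r iF. Qed.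

Lemma intg_sum (I : Type) (s : seq I) (F : I -> T -> R) :
  (forall i, intg P (F i)) -> intg P (fun x => \sum_(i <- s) F i x).
Proof.
move=> iF; elim: s => [|i s IH].
  by under [X in EFin \o X]eq_fun do rewrite big_nil; exact/bmf_integrable/bmf_cst.
by under [X in EFin \o X]eq_fun do rewrite big_cons; exact: intgD.
Qed.

Lemma Ex_sum (I : Type) (s : seq I) (F : I -> T -> R) :
  (forall i, intg P (F i)) ->
  Ex P (fun x => \sum_(i <- s) F i x) = \sum_(i <- s) Ex P (F i).
Proof.
move=> iF; elim: s => [|i s IH].
  by rewrite big_nil; under eq_Ex do rewrite big_nil; rewrite Ex_cst.
rewrite big_cons -IH -ExD//; last exact: intg_sum.
by under eq_Ex do rewrite big_cons.
Qed.

Lemma intg_dom F G : measurable_fun setT F -> intg P G ->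
  (forall x, `|F x| <= G x) -> intg P F.
Proof.
move=> mF iG FG; apply: (@le_integrable _ _ _ P _ measurableT _ (EFin \o G)) => //.
  exact/measurable_EFinP.
by move=> x _; rewrite /= lee_fin (le_trans (FG x))// ler_norm.
Qed.

Lemma Ex_le_cst F r : bmf F -> (forall x, F x <= r) -> Ex P F <= r.
Proof.
by move=> iF h; rewrite -[leRHS]Ex_cst; apply: le_Ex => //; apply: bmf_integrable => //;
  exact: bmf_cst.
Qed.

(* Cauchy-Schwarz in pointwise form: integrate AM-GM,
   [2 |u| <= l p + q / l], and optimise over [l]. *)
Lemma Ex_cauchy_schwarz (u p q : T -> R) :
  intg P u -> intg P p -> intg P q ->
  (forall x, 0 <= p x) -> (forall x, 0 <= q x) ->
  (forall x, u x ^+ 2 <= p x * q x) ->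
  Ex P u ^+ 2 <= Ex P p * Ex P q.
Proof.
move=> iu ip iq p0 q0 upq.
have Ep0 := Ex_ge0 p0; have Eq0 := Ex_ge0 q0.
have key l : 0 < l -> 2 * `|Ex P u| <= l * Ex P p + l^-1 * Ex P q.
  move=> l0; have ln0 : l != 0 by rewrite gt_eqF.
  rewrite -!ExZ// -ExD; [|exact: intgZ|exact: intgZ].
  have iau : intg P (fun x => `|u x|).
    by have := integrable_abse iu; congr integrable; apply/funext.
  apply: (@le_trans _ _ (2 * Ex P (fun x => `|u x|))).
    by rewrite ler_wpM2l// Ex_norm.
  rewrite -ExZ//; apply: le_Ex => //; [exact: intgZ| |].
    by apply: intgD; exact: intgZ.
  move=> x; rewrite -(@ler_pXn2r _ 2)// ?nnegrE ?mulr_ge0//; last first.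
    by rewrite addr_ge0// mulr_ge0// ?invr_ge0// ltW.
  rewrite exprMn real_normK ?num_real//.
  apply: (@le_trans _ _ (2 ^+ 2 * (p x * q x))); first by rewrite ler_wpM2l.
  rewrite -subr_ge0; have -> : (l * p x + l^-1 * q x) ^+ 2 - 2 ^+ 2 * (p x * q x)
     = (l * p x - l^-1 * q x) ^+ 2 by field.
  exact: sqr_ge0.
set a := Ex P p in key Ep0 *; set b := Ex P q in key Eq0 *.
rewrite -[leLHS]real_normK ?num_real//; set e := `|_| in key *.
have e0 : 0 <= e by exact: normr_ge0.
have [a0|a0] := eqVneq a 0.
  have [->|en0] := eqVneq e 0; first by rewrite expr2 mul0r mulr_ge0.
  have ep : 0 < e by rewrite lt_neqAle eq_sym en0.
  have := key ((b + 1) / e) (divr_gt0 (ltr_wpDl Eq0 ltr01) ep).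
  rewrite a0 mulr0 add0r invf_div => h; exfalso.
  have : e * b / (b + 1) < e.
    by rewrite ltr_pdivrMr ?ltr_wpDl// ltr_pM2l// ltrDl.
  by rewrite mulrAC in h; lra.
have ap : 0 < a by rewrite lt_neqAle eq_sym a0.
have [en0|en0] := eqVneq e 0; first by rewrite en0 expr2 mul0r mulr_ge0.
have ep : 0 < e by rewrite lt_neqAle eq_sym en0.
have := key (e / a) (divr_gt0 ep ap).
rewrite divfK// invf_div => h.
have {}h : e <= a / e * b by lra.
by rewrite expr2 -ler_pdivlMr// mulrAC.
Qed.

Lemma Ex_sqr F : bmf F -> Ex P F ^+ 2 <= Ex P (fun x => F x ^+ 2).
Proof.
move=> bF; rewrite -[leRHS]mulr1 -[X in _ <= _ * X]Ex_cst.
apply: Ex_cauchy_schwarz => [||| | |x]; rewrite ?mulr1//.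
- exact: bmf_integrable.
- exact/bmf_integrable/bmfX.
- exact/bmf_integrable/bmf_cst.
- by move=> x; exact: sqr_ge0.
Qed.

Lemma Ex_cauchy_schwarzM F G : bmf F -> bmf G ->
  Ex P (fun x => F x * G x) ^+ 2 <=
  Ex P (fun x => F x ^+ 2) * Ex P (fun x => G x ^+ 2).
Proof.
move=> bF bG; apply: Ex_cauchy_schwarz => [||| x|x|x]; rewrite ?sqr_ge0//.
- exact/bmf_integrable/bmfM.
- exact/bmf_integrable/bmfX.
- exact/bmf_integrable/bmfX.
by rewrite exprMn.
Qed.

End expectation.

(** * Measure-preserving maps and change of variables *)

Section measure_preserving.
Context d1 d2 (T1 : measurableType d1) (T2 : measurableType d2) (R : realType).

Definition mpres (P : probability T1 R) (Q : probability T2 R) (phi : T1 -> T2) :=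
  measurable_fun setT phi /\
  forall B, measurable B -> P (phi @^-1` B) = Q B.

Variables (P : probability T1 R) (Q : probability T2 R) (phi : T1 -> T2).

Lemma mpres_ge0 (F : T2 -> \bar R) : mpres P Q phi ->
  measurable_fun setT F -> (forall x, 0 <= F x)%E ->
  (\int[P]_x F (phi x) = \int[Q]_x F x)%E.
Proof.
move=> [mphi h] mF F0.
have := @ge0_integral_pushforward _ _ _ _ R phi mphi P setT F measurableT mF
  (fun y _ => F0 y).
rewrite preimage_setT /comp => <-.
by apply: eq_measure_integral => A mA _; exact: h mA.
Qed.

Lemma mpresP_ge0 : measurable_fun setT phi ->
  (forall F : T2 -> \bar R, measurable_fun setT F -> (forall x, 0 <= F x)%E ->
  (\int[P]_x F (phi x) = \int[Q]_x F x)%E) -> mpres P Q phi.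
Proof.
move=> mphi h; split=> // B mB.
have mpB : measurable (phi @^-1` B) by rewrite -[X in measurable X]setTI; exact: mphi.
have mB1 : measurable_fun setT (EFin \o (\1_B : T2 -> R)).
  exact/measurable_EFinP/measurable_indic.
have /= := h _ mB1 (fun x => ltac:(by rewrite lee_fin)).
by rewrite (integral_indic _ measurableT mpB) (integral_indic _ measurableT mB) !setIT.
Qed.

Lemma mpres_Ex (F : T2 -> R) : mpres P Q phi -> measurable_fun setT F ->
  Ex P (fun x => F (phi x)) = Ex Q F.
Proof.
move=> h mF; congr fine; rewrite [LHS]integralE [RHS]integralE.
rewrite -/((EFin \o F) \o phi) funepos_comp funeneg_comp.
have mF' : measurable_fun setT (EFin \o F) by exact/measurable_EFinP.
rewrite -(mpres_ge0 h (measurable_funepos mF')); last by move=> x; exact: funepos_ge0.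
rewrite -(mpres_ge0 h (measurable_funeneg mF')); last by move=> x; exact: funeneg_ge0.
by [].
Qed.

Lemma mpres_intg (F : T2 -> R) : mpres P Q phi -> intg Q F ->
  intg P (fun x => F (phi x)).
Proof.
move=> h iF; have [mphi _] := h.
have mF : measurable_fun setT F by exact/measurable_EFinP/(measurable_int Q).
apply/integrableP; split.
  by apply/measurable_EFinP; exact: measurableT_comp.
move/integrableP : iF => [_]; rewrite -(mpres_ge0 h)//.
by apply: measurableT_comp => //; exact/measurable_EFinP.
Qed.

End measure_preserving.

(** * Fubini for bounded functions *)

Section product.
Context d1 d2 (T1 : measurableType d1) (T2 : measurableType d2) (R : realType).
Variables (P : probability T1 R) (Q : probability T2 R).
Implicit Type F : T1 * T2 -> R.

Lemma bmf_pair1 F x : bmf F -> bmf (fun y => F (x, y)).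
Proof. by move=> bF; apply: bmf_comp. Qed.

Lemma bmf_pair2 F y : bmf F -> bmf (fun x => F (x, y)).
Proof. by move=> bF; apply: bmf_comp. Qed.

Lemma intg_Ex1 F x : bmf F ->
  ((Ex Q (fun y => F (x, y)))%:E = \int[Q]_y (F (x, y))%:E)%E.
Proof.
move=> bF; rewrite fineK//; apply: integrable_fin_num => //.
exact/bmf_integrable/bmf_pair1.
Qed.

Lemma intg_Ex2 F y : bmf F ->
  ((Ex P (fun x => F (x, y)))%:E = \int[P]_x (F (x, y))%:E)%E.
Proof.
move=> bF; rewrite fineK//; apply: integrable_fin_num => //.
exact/bmf_integrable/bmf_pair2.
Qed.

Lemma bmf_Ex1 F : bmf F -> bmf (fun x => Ex Q (fun y => F (x, y))).
Proof.
move=> bF; have [M hM] := bmf_bound bF; apply: (@bmfI _ _ _ _ M).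
  apply/measurable_EFinP.
  have -> : EFin \o (fun x => Ex Q (fun y => F (x, y))) =
    fubini_F Q (EFin \o F) by apply/funext => x; rewrite /= intg_Ex1.
  exact: measurable_fubini_F (bmf_integrable (P \x Q)%E bF).
move=> x; apply: (le_trans (Ex_norm _)).
  exact/bmf_integrable/bmf_pair1.
by apply: Ex_le_cst => //; exact/bmf_norm/bmf_pair1.
Qed.

Lemma bmf_Ex2 F : bmf F -> bmf (fun y => Ex P (fun x => F (x, y))).
Proof.
move=> bF; have [M hM] := bmf_bound bF; apply: (@bmfI _ _ _ _ M).
  apply/measurable_EFinP.
  have -> : EFin \o (fun y => Ex P (fun x => F (x, y))) =
    fubini_G P (EFin \o F) by apply/funext => x; rewrite /= intg_Ex2.
  exact: measurable_fubini_G (bmf_integrable (P \x Q)%E bF).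
move=> x; apply: (le_trans (Ex_norm _)).
  exact/bmf_integrable/bmf_pair2.
by apply: Ex_le_cst => //; exact/bmf_norm/bmf_pair2.
Qed.

Lemma Ex_prod1 F : bmf F ->
  Ex (P \x Q)%E F = Ex P (fun x => Ex Q (fun y => F (x, y))).
Proof.
move=> bF; congr fine.
rewrite -(integral12_prod_meas1 (bmf_integrable (P \x Q)%E bF)).
by apply: eq_integral => x _; rewrite intg_Ex1.
Qed.

Lemma Ex_prod2 F : bmf F ->
  Ex (P \x Q)%E F = Ex Q (fun y => Ex P (fun x => F (x, y))).
Proof.
move=> bF; congr fine.
rewrite -(integral21_prod_meas1 (bmf_integrable (P \x Q)%E bF)).
by apply: eq_integral => x _; rewrite intg_Ex2.
Qed.

Lemma Ex_swap F : bmf F -> Ex P (fun x => Ex Q (fun y => F (x, y))) =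
  Ex Q (fun y => Ex P (fun x => F (x, y))).
Proof. by move=> bF; rewrite -Ex_prod1// Ex_prod2. Qed.

End product.

(** * Gaussian measures *)

Section gaussian_line.
Context {R : realType}.
Local Notation lam := (@lebesgue_measure R).
Local Notation T := (measurableTypeR R).
Local Notation mu := (@std_gauss R).
Implicit Types F : T -> \bar R.

Lemma lebesgue_measureD (a : R) (A : set R) : measurable A ->
  lam (+%R a @^-1` A) = lam A.
Proof.
move=> mA.
have mf : measurable_fun setT (+%R a : T -> T) by exact: measurable_funD.
apply/esym; apply: (lebesgue_measure_unique (mu := pushforward lam (+%R a : T -> T))) => //=.
move=> _ [[x y]] _ <-; rewrite /pushforward.
have -> : +%R a @^-1` [set` `]x, y]] = [set` `](x - a), (y - a)]].
  by apply/seteqP; split=> z /=; rewrite !in_itv/= => /andP[h1 h2]; apply/andP; split; lra.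
rewrite !lebesgue_measure_itv/= !lte_fin ltrD2r; case: ifP => // _.
by rewrite -!EFinD; congr EFin; ring.
Qed.

Lemma ge0_integral_shift (a : R) F : measurable_fun setT F ->
  (forall x, 0 <= F x)%E ->
  (\int[lam]_x F (a + x)%R = \int[lam]_x F x)%E.
Proof.
move=> mF F0.
have mf : measurable_fun setT (+%R a : T -> T) by exact: measurable_funD.
have := @ge0_integral_pushforward _ _ _ _ R (+%R a : T -> T) mf lam setT F measurableT mF
  (fun y _ => F0 y).
rewrite preimage_setT /comp => <-.
by apply: eq_measure_integral => A mA _; exact: lebesgue_measureD.
Qed.

Definition gdens (x : R) : R := normal_pdf 0 1 x.

Lemma gdensE x : gdens x = normal_peak 1 * expR (- (x ^+ 2 / 2)).
Proof.
rewrite /gdens normal_pdfE ?oner_neq0//= /normal_fun subr0 expr1n.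
by rewrite mulNr.
Qed.

Lemma gdens_gt0 x : 0 < gdens x.
Proof. by rewrite gdensE mulr_gt0 ?expR_gt0// normal_peak_gt0 ?oner_neq0. Qed.

Lemma measurable_gdens : measurable_fun setT (gdens : T -> R).
Proof. exact: measurable_normal_pdf. Qed.

(** The explicit density and the Radon-Nikodym derivative have the same integral over every
    measurable set, so they agree almost everywhere. *)
Lemma std_gauss_integral F : measurable_fun setT F -> (forall x, 0 <= F x)%E ->
  (\int[mu]_x F x = \int[lam]_x (F x * (gdens x)%:E))%E.
Proof.
move=> mF F0.
have dom := normal_prob_dominates (0 : R) 1.
rewrite -(Radon_Nikodym_SigmaFinite.change_of_variables dom)//.
apply: ae_eq_integral => //.
- apply: emeasurable_funM => //.
  exact: (measurable_int _ (Radon_Nikodym_SigmaFinite.f_integrable dom)).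
- by apply: emeasurable_funM => //; apply/measurable_EFinP; exact: measurable_gdens.
- apply: ae_eqe_mul2l.
  apply: integral_ae_eq => //.
  + exact: Radon_Nikodym_SigmaFinite.f_integrable.
  + by apply/measurable_EFinP; exact: measurable_gdens.
  + by move=> E _ mE; rewrite -Radon_Nikodym_SigmaFinite.f_integral.
Qed.

(** Cameron-Martin density: the law of [x + w] relative to the law of [x], for [x] standard
    Gaussian. *)
Definition cm_dens (w x : R) : R := expR (w * x - w ^+ 2 / 2).

Lemma measurable_cm_dens w : measurable_fun setT (cm_dens w : T -> R).
Proof.
by apply: measurableT_comp => //; apply: measurable_funB.
Qed.

Lemma std_gauss_shift w F : measurable_fun setT F -> (forall x, 0 <= F x)%E ->
  (\int[mu]_x F (x + w)%R = \int[mu]_x (F x * (cm_dens w x)%:E))%E.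
Proof.
move=> mF F0.
have ms : measurable_fun setT (fun x : T => x + w : T) by exact: measurable_funD.
have mcd := measurable_cm_dens w; have mg := measurable_gdens.
rewrite (std_gauss_integral (F := fun x => F (x + w)%R)) => [||x]; [|exact: (measurableT_comp mF)|exact: F0].
rewrite (std_gauss_integral (F := fun x => F x * (cm_dens w x)%:E)%E) => [||x]; first last.
- by rewrite mule_ge0// lee_fin expR_ge0.
- by apply: emeasurable_funM => //; exact/measurable_EFinP.
rewrite -[RHS](ge0_integral_shift w); first last.
- by move=> x; rewrite !mule_ge0// lee_fin ?expR_ge0// ltW// gdens_gt0.
- by apply: emeasurable_funM; [apply: emeasurable_funM => //|]; exact/measurable_EFinP.
apply: eq_integral => x _; rewrite addrC -muleA -EFinM; congr (_ * _%:E)%E.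
rewrite !gdensE /cm_dens mulrCA -expRD; by congr (_ * expR _); field.
Qed.

(** Multiplied by the Gaussian density, the integrand is [s] times the normal density of standard
    deviation [s], where [s ^ 2 = (1 - b)^-1]. The exact value [s] is relaxed to [s ^ 2], which
    avoids square roots later. *)
Lemma std_gauss_exp_sqr (b : R) : 0 <= b < 1 ->
  (\int[mu]_x (expR (b * x ^+ 2 / 2))%:E <= (1 - b)^-1%:E)%E.
Proof.
move=> /andP[b0 b1]; set s := Num.sqrt (1 - b)^-1.
have q0 : 0 < 1 - b by rewrite subr_gt0.
have s0 : 0 < s by rewrite sqrtr_gt0 invr_gt0.
have s2 : s ^+ 2 = (1 - b)^-1 by rewrite sqr_sqrtr// invr_ge0 ltW.
have me : measurable_fun setT (fun x : T => expR (b * x ^+ 2 / 2)).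
  by apply: measurableT_comp => //; apply: measurable_funM => //; apply: measurable_funM.
rewrite std_gauss_integral; [|exact/measurable_EFinP|by move=> x; rewrite lee_fin expR_ge0].
have -> : (\int[lam]_x ((expR (b * x ^+ 2 / 2))%:E * (gdens x)%:E) =
  \int[lam]_x (s%:E * (normal_pdf 0 s x)%:E))%E.
  apply: eq_integral => x _; rewrite -!EFinM; congr EFin.
  rewrite gdensE normal_pdfE ?gt_eqF//= /normal_fun subr0 mulrCA -expRD [RHS]mulrA.
  have -> : normal_peak 1 = s * normal_peak s.
    rewrite /normal_peak expr1n mul1r -mulrnAr sqrtrM ?sqr_ge0// sqrtr_sqr.
    by rewrite ger0_norm ?ltW// invfM mulrA divff ?mul1r// gt_eqF.
  congr (_ * expR _).
  by rewrite s2; field; rewrite gt_eqF.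
rewrite ge0_integralZl//.
- rewrite integral_normal_pdf mule1 lee_fin -s2 expr2.
  suff s1 : 1 <= s by nra.
  by rewrite -sqrtr1 ler_wsqrtr// invf_ge1//; lra.
- by apply/measurable_EFinP; exact: measurable_normal_pdf.
- by move=> x _; rewrite lee_fin normal_pdf_ge0.
- by rewrite lee_fin ltW.
Qed.

End gaussian_line.

(** * Orthogonal invariance of the planar Gaussian measure *)

Section gaussian_plane.
Context {R : realType}.
Local Notation lam := (@lebesgue_measure R).
Local Notation T := (measurableTypeR R).
Local Notation mu := (@std_gauss R).
Implicit Types F : T * T -> \bar R.

Let I F := (\int[lam]_x \int[lam]_z F (x, z))%E.

Let shear1 a F : measurable_fun setT F -> (forall p, 0 <= F p)%E ->
  I (fun p => F (p.1 + a * p.2, p.2)) = I F.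
Proof.
move=> mF F0.
have mS : measurable_fun setT (fun p : T * T => (p.1 + a * p.2, p.2) : T * T).
  apply: measurable_fun_pair => //.
  by apply: measurable_funD => //; apply: measurable_funM.
transitivity (\int[lam]_z \int[lam]_x F (((x : R) + a * (z : R))%R, z))%E.
  apply: (@fubini_tonelli _ _ _ _ _ lam lam (fun p : T * T => F (p.1 + a * p.2, p.2))) => [|x].
    exact: (measurableT_comp mF mS).
  exact: F0.
rewrite /I [RHS](@fubini_tonelli _ _ _ _ _ lam lam F mF F0); apply: eq_integral => z _ /=.
rewrite -[RHS](ge0_integral_shift (a * z)); first last.
- by move=> x; exact: F0.
- exact: (measurableT_comp mF).
by apply: eq_integral => x _; rewrite addrC.
Qed.

Let shear2 b F : measurable_fun setT F -> (forall p, 0 <= F p)%E ->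
  I (fun p => F (p.1, p.2 + b * p.1)) = I F.
Proof.
move=> mF F0; apply: eq_integral => x _ /=.
rewrite -[RHS](ge0_integral_shift (b * x)); first last.
- by move=> z; exact: F0.
- exact: (measurableT_comp mF).
by apply: eq_integral => z _; rewrite addrC.
Qed.

Let integral_opp (f : T -> \bar R) : measurable_fun setT f ->
  (forall x, 0 <= f x)%E -> (\int[lam]_x f (- x)%R = \int[lam]_x f x)%E.
Proof.
move=> mf f0.
have mo : measurable_fun setT (-%R : T -> T) by [].

have := @ge0_integral_pushforward _ _ _ _ R (-%R : T -> T) mo lam setT f measurableT mf
  (fun y _ => f0 y).
rewrite preimage_setT /comp => <-.
by apply: eq_measure_integral => A mA _; exact: lebesgue_measureN.
Qed.

Let flip2 F : measurable_fun setT F -> (forall p, 0 <= F p)%E ->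
  I (fun p => F (p.1, - p.2)) = I F.
Proof.
move=> mF F0; apply: eq_integral => x _ /=.
by rewrite (integral_opp (f := fun z => F (x, z)))//; exact: (measurableT_comp mF).
Qed.

Let flip1 F : measurable_fun setT F -> (forall p, 0 <= F p)%E ->
  I (fun p => F (- p.1, p.2)) = I F.
Proof.
move=> mF F0.
have mN : measurable_fun setT (fun p : T * T => (- p.1, p.2) : T * T).
  by apply: measurable_fun_pair => //; exact: measurableT_comp.
transitivity (\int[lam]_z \int[lam]_x F ((- (x : R))%R, z))%E.
  apply: (@fubini_tonelli _ _ _ _ _ lam lam (fun p : T * T => F (- p.1, p.2))) => [|x].
    exact: (measurableT_comp mF mN).
  exact: F0.
rewrite /I [RHS](@fubini_tonelli _ _ _ _ _ lam lam F mF F0); apply: eq_integral => z _ /=.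
by rewrite (integral_opp (f := fun x => F (x, z)))//; exact: (measurableT_comp mF).
Qed.

(** A reflection is preferred to a rotation because it is its own inverse: this is what makes noise
    operators symmetric. *)
Definition refl_pair (c s : R) (p : T * T) : T * T :=
  (c * p.1 + s * p.2, s * p.1 - c * p.2).

Lemma measurable_refl_pair c s : measurable_fun setT (refl_pair c s).
Proof.
apply: measurable_fun_pair.
  by apply: measurable_funD; apply: measurable_funM.
by apply: measurable_funB; apply: measurable_funM.
Qed.

(* A rotation of angle other than [0] and [pi] is a product of three shears. *)
Let lebesgue_refl c s F : c ^+ 2 + s ^+ 2 = 1 ->
  measurable_fun setT F -> (forall p, 0 <= F p)%E ->
  I (fun p => F (refl_pair c s p)) = I F.
Proof.
move=> cs mF F0.
have [s0|s0] := eqVneq s 0.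
  have c1 : (c == 1) || (c == -1).
    by rewrite -sqrf_eq1 -cs s0 expr0n addr0.
  case/orP: c1 => /eqP c1.
    transitivity (I (fun p => F (p.1, - p.2))); last exact: flip2.
    congr I; apply/funext => p; rewrite /refl_pair s0 c1.
    by rewrite !mul0r addr0 sub0r !mul1r.
  transitivity (I (fun p => F (- p.1, p.2))); last exact: flip1.
  congr I; apply/funext => p; rewrite /refl_pair s0 c1.
  by rewrite !mul0r addr0 sub0r !mulN1r opprK.
have mflip : measurable_fun setT (fun p : T * T => (p.1, - p.2) : T * T).
  by apply: measurable_fun_pair => //; exact: measurableT_comp.
(* For [c = cos th] and [s = sin th] this is [tan (th / 2)]: the shears with coefficients [a],
   [- s], [a] compose to a rotation, and the final sign change makes it the reflection. *)
pose a := (1 - c) / s.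
have mS1 : measurable_fun setT (fun p : T * T => (p.1 + a * p.2, p.2) : T * T).
  apply: measurable_fun_pair => //.
  by apply: measurable_funD => //; apply: measurable_funM.
have mS2 : measurable_fun setT (fun p : T * T => (p.1, p.2 + - s * p.1) : T * T).
  apply: measurable_fun_pair => //.
  by apply: measurable_funD => //; apply: measurable_funM.
pose F1 (p : T * T) := F (p.1, - p.2).
have mF1 : measurable_fun setT F1 by exact: (measurableT_comp mF mflip).
pose F2 (p : T * T) := F1 (p.1 + a * p.2, p.2).
have mF2 : measurable_fun setT F2 by exact: (measurableT_comp mF1 mS1).
pose F3 (p : T * T) := F2 (p.1, p.2 + - s * p.1).
have mF3 : measurable_fun setT F3 by exact: (measurableT_comp mF2 mS2).
rewrite -[RHS](flip2 mF F0) -/F1 -[RHS](shear1 a mF1); last by move=> p; exact: F0.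
rewrite -/F2 -[RHS](shear2 (- s) mF2); last by move=> p; exact: F0.
rewrite -/F3 -[RHS](shear1 a mF3); last by move=> p; exact: F0.
congr I; apply/funext => p; rewrite /F3 /F2 /F1 /refl_pair /a /=.
have cs' : c ^+ 2 = 1 - s ^+ 2 by rewrite -cs addrK.
congr (F (_, _)); field: cs' => //.
Qed.

(** The joint density depends only on [p.1 ^ 2 + p.2 ^ 2], which the reflection preserves, so the
    invariance of Lebesgue measure carries over. *)
Lemma std_gauss_refl c s : c ^+ 2 + s ^+ 2 = 1 ->
  mpres (mu \x mu)%E (mu \x mu)%E (refl_pair c s).
Proof.
move=> cs; apply: mpresP_ge0; first exact: measurable_refl_pair.
move=> F mF F0.
have mr := measurable_refl_pair c s.
have mg1 : measurable_fun setT (fun p : T * T => (gdens p.1)%:E).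
  by apply/measurable_EFinP; exact: (measurableT_comp measurable_gdens).
have mg2 : measurable_fun setT (fun p : T * T => (gdens p.2)%:E).
  by apply/measurable_EFinP; exact: (measurableT_comp measurable_gdens).
have key (G : T * T -> \bar R) : measurable_fun setT G -> (forall p, 0 <= G p)%E ->
    (\int[(mu \x mu)%E]_p G p = I (fun p => G p * (gdens p.1)%:E * (gdens p.2)%:E))%E.
  move=> mG G0; rewrite fubini_tonelli1// std_gauss_integral; first last.
  - by move=> x; apply: integral_ge0.
  - exact: measurable_fun_fubini_tonelli_F.
  apply: eq_integral => x _; rewrite /fubini_F std_gauss_integral//; last first.
    exact: (measurableT_comp mG).
  transitivity (\int[lam]_z (G (x, z) * (gdens z)%:E * (gdens x)%:E))%E; last first.
    by apply: eq_integral => z _; rewrite muleAC.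
  rewrite ge0_integralZr//.
  - apply: emeasurable_funM; first exact: (measurableT_comp mG).
    by apply/measurable_EFinP; exact: measurable_gdens.
  - by move=> z _; rewrite mule_ge0// lee_fin ltW// gdens_gt0.
  - by rewrite lee_fin ltW// gdens_gt0.
rewrite (key _ mF F0) (key _ (measurableT_comp mF mr) (fun p => F0 _)).
pose G (p : T * T) := (F p * (gdens p.1)%:E * (gdens p.2)%:E)%E.
rewrite -[RHS](lebesgue_refl (F := G) cs); first last.
- by move=> p; rewrite !mule_ge0// lee_fin ltW// gdens_gt0.
- by apply: emeasurable_funM => //; apply: emeasurable_funM.
congr I; apply/funext => p; rewrite /G -!muleA; congr (_ * _)%E.
rewrite -!EFinM; congr EFin; rewrite !gdensE.
rewrite -!mulrA ![expR _ * (_ * _)]mulrCA -!expRD; congr (_ * (_ * expR _)).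
rewrite /refl_pair /=.
have E : (c * p.1 + s * p.2) ^+ 2 + (s * p.1 - c * p.2) ^+ 2 = p.1 ^+ 2 + p.2 ^+ 2.
  by rewrite -[RHS]mul1r -cs; ring.
by transitivity (- ((p.1 ^+ 2 + p.2 ^+ 2) / 2)); [field|rewrite -E; field].
Qed.

End gaussian_plane.

(** * Tonelli and operations on measure-preserving maps *)

Section tonelli.
Context d1 d2 (T1 : measurableType d1) (T2 : measurableType d2) (R : realType).
Variables (P : probability T1 R) (Q : probability T2 R) (F : T1 * T2 -> \bar R).
Hypotheses (mF : measurable_fun setT F) (F0 : forall p, (0 <= F p)%E).

Lemma tonelli_prod :
  (\int[(P \x Q)%E]_p F p = \int[P]_x \int[Q]_y F (x, y))%E.
Proof. exact: fubini_tonelli1. Qed.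

Lemma tonelli_swap : (\int[P]_x \int[Q]_y F (x, y) =
  \int[Q]_y \int[P]_x F (x, y))%E.
Proof. exact: fubini_tonelli. Qed.

Lemma measurable_tonelli : measurable_fun setT (fun x => \int[Q]_y F (x, y))%E.
Proof. exact: measurable_fun_fubini_tonelli_F. Qed.

End tonelli.

Section mpres_calculus.
Context {R : realType}.

Lemma mpres_comp d1 d2 d3 (T1 : measurableType d1) (T2 : measurableType d2)
    (T3 : measurableType d3) (P1 : probability T1 R) (P2 : probability T2 R)
    (P3 : probability T3 R) (f : T1 -> T2) (g : T2 -> T3) :
  mpres P1 P2 f -> mpres P2 P3 g -> mpres P1 P3 (g \o f).
Proof.
move=> [mf hf] [mg hg]; split; first exact: measurableT_comp.
move=> B mB; rewrite -hg// -hf//.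
by rewrite -[X in measurable X]setTI; exact: mg.
Qed.

(* Invariance passes to the image under a measure preserving semiconjugacy. *)
Lemma mpres_conj d1 d2 (T1 : measurableType d1) (T2 : measurableType d2)
    (P1 : probability T1 R) (P2 : probability T2 R)
    (h : T1 -> T2) (f : T1 -> T1) (g : T2 -> T2) :
  mpres P1 P2 h -> mpres P1 P1 f -> measurable_fun setT g ->
  (forall x, g (h x) = h (f x)) -> mpres P2 P2 g.
Proof.
move=> [mh eh] [mf ef] mg gh; split=> // B mB.
have mgB : measurable (g @^-1` B) by rewrite -[X in measurable X]setTI; exact: mg.
have mhB : measurable (h @^-1` B) by rewrite -[X in measurable X]setTI; exact: mh.
rewrite -eh// -[RHS]eh// -[RHS]ef//; congr (P1 _).
by apply/seteqP; split=> x /=; rewrite gh.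
Qed.

Lemma mpres_prod d1 d2 d3 d4 (T1 : measurableType d1) (T2 : measurableType d2)
    (T3 : measurableType d3) (T4 : measurableType d4)
    (P1 : probability T1 R) (P2 : probability T2 R)
    (P3 : probability T3 R) (P4 : probability T4 R)
    (f : T1 -> T2) (g : T3 -> T4) :
  mpres P1 P2 f -> mpres P3 P4 g ->
  mpres (P1 \x P3)%E (P2 \x P4)%E (fun p => (f p.1, g p.2)).
Proof.
move=> [mf ef] [mg eg].
have mfg : measurable_fun setT (fun p : T1 * T3 => (f p.1, g p.2)).
  by apply: measurable_fun_pair; apply: measurableT_comp.
split=> // B mB.
apply: esym; apply: (product_measure_unique (m' := pushforward (P1 \x P3)%E
  (fun p : T1 * T3 => (f p.1, g p.2)))) => //= A C mA mC.
rewrite -ef// -eg// -product_measure1E//.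
  by rewrite -[X in measurable X]setTI; exact: mf.
by rewrite -[X in measurable X]setTI; exact: mg.
Qed.

(** Regroups two samples of a head and a tail as a pair of heads and a pair of tails, as needed for
    induction on the dimension. *)
Lemma mpres_interchange d1 d2 d3 d4 (T1 : measurableType d1)
    (T2 : measurableType d2) (T3 : measurableType d3) (T4 : measurableType d4)
    (P1 : probability T1 R) (P2 : probability T2 R)
    (P3 : probability T3 R) (P4 : probability T4 R) :
  mpres ((P1 \x P2) \x (P3 \x P4))%E ((P1 \x P3) \x (P2 \x P4))%E
    (fun p => ((p.1.1, p.2.1), (p.1.2, p.2.2))).
Proof.
have mi : measurable_fun setT (fun p : (T1 * T2) * (T3 * T4) =>
    ((p.1.1, p.2.1), (p.1.2, p.2.2))).
  apply: measurable_fun_pair; apply: measurable_fun_pair;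
    by apply: measurableT_comp.
apply: mpresP_ge0 => // F mF F0.
have mFi := measurableT_comp mF mi.
rewrite (tonelli_prod _ _ mFi (fun=> F0 _)).
have m1 := measurable_tonelli (P3 \x P4)%E mFi (fun=> F0 _).
rewrite (tonelli_prod _ _ m1); last by move=> p; apply: integral_ge0 => q _; exact: F0.
rewrite [RHS](tonelli_prod _ _ mF F0).
have m2 := measurable_tonelli (P2 \x P4)%E mF F0.
rewrite [RHS](tonelli_prod _ _ m2); last by move=> p; apply: integral_ge0 => q _; exact: F0.
apply: eq_integral => x _.
transitivity (\int[P2]_y \int[P3]_z \int[P4]_w F ((x, z), (y, w)))%E.
  apply: eq_integral => y _.
  rewrite (@tonelli_prod _ _ _ _ _ P3 P4 (fun q => F ((x, q.1), (y, q.2)))); [by []| |by move=> p; exact: F0].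
  apply: (measurableT_comp mF); apply: measurable_fun_pair;
    by apply: measurable_fun_pair.
have mH : measurable_fun setT (fun p : (T2 * T3) * T4 => F ((x, p.1.2), (p.1.1, p.2))).
  apply: (measurableT_comp mF).
  apply: measurable_fun_pair; apply: measurable_fun_pair => //;
    by apply: measurableT_comp.
have m3 := measurable_tonelli P4 mH (fun=> F0 _).
rewrite (tonelli_swap _ _ m3); last by move=> p; apply: integral_ge0 => q _; exact: F0.
apply: eq_integral => z _.
rewrite (@tonelli_prod _ _ _ _ _ P2 P4 (fun q => F ((x, z), q))); [by []| |by move=> p; exact: F0].
by apply: (measurableT_comp mF); apply: measurable_fun_pair.
Qed.

End mpres_calculus.

(** * The Gaussian measure on tuples and its symmetries *)

Section tuples.
Context {R : realType}.
Local Notation T := (measurableTypeR R).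
Local Notation mu := (@std_gauss R).
Local Notation V n := (n.-tuple (measurableTypeR R)).

Lemma measurable_mktuple d (U : measurableType d) n (f : 'I_n -> U -> T) :
  (forall i, measurable_fun setT (f i)) ->
  measurable_fun setT (fun u => [tuple f i u | i < n] : V n).
Proof.
move=> mf; apply/measurable_fun_tnthP => i.
rewrite (_ : _ \o _ = f i)//; apply/funext => u /=.
by rewrite tnth_mktuple.
Qed.

Lemma measurable_tnth_comp d (U : measurableType d) n (f : U -> V n) i :
  measurable_fun setT f -> measurable_fun setT (fun u => tnth (f u) i : T).
Proof. by move=> mf; exact: (measurableT_comp (measurable_tnth i) mf). Qed.

Lemma mpres_cons n : mpres (mu \x gauss n)%E (gauss n.+1) (@cons_pair _ T n).
Proof. by split=> //; exact: measurable_cons_pair. Qed.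

Definition mix n (c s : 'I_n -> R) (x z : V n) : V n :=
  [tuple c i * tnth x i + s i * tnth z i | i < n].

Lemma tnth_mix n c s (x z : V n) i :
  tnth (mix c s x z) i = c i * tnth x i + s i * tnth z i.
Proof. by rewrite tnth_mktuple. Qed.

Lemma mix_cons n (c s : 'I_n.+1 -> R) (x z : T * V n) :
  mix c s (cons_pair x) (cons_pair z) =
  cons_pair (c ord0 * x.1 + s ord0 * z.1,
    mix (fun i => c (lift ord0 i)) (fun i => s (lift ord0 i)) x.2 z.2).
Proof.
apply: eq_from_tnth => i; rewrite tnth_mix.
by case: (unliftP ord0 i) => [j ->|->]; rewrite ?tnth0// !tnthS tnth_mix.
Qed.

Lemma measurable_mix d (U : measurableType d) n c s (f g : U -> V n) :
  measurable_fun setT f -> measurable_fun setT g ->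
  measurable_fun setT (fun u => mix c s (f u) (g u)).
Proof.
move=> mf mg; apply: measurable_mktuple => i.
by apply: measurable_funD; apply: measurable_funM => //; exact: measurable_tnth_comp.
Qed.

Definition reflect n (c s : 'I_n -> R) (p : V n * V n) : V n * V n :=
  (mix c s p.1 p.2, mix s (fun i => - c i) p.1 p.2).

Lemma measurable_reflect n c s : measurable_fun setT (@reflect n c s).
Proof. by apply: measurable_fun_pair; exact: measurable_mix. Qed.

(** The angle may vary with the coordinate: a single nonzero angle gives an influence, equal angles
    give the noise correlation. *)
Lemma gauss_reflect n (c s : 'I_n -> R) : (forall i, c i ^+ 2 + s i ^+ 2 = 1) ->
  mpres (gauss n \x gauss n)%E (gauss n \x gauss n)%E (reflect c s).
Proof.
elim: n c s => [|n IH] c s cs.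
  split; first exact: measurable_reflect.
  move=> B _; congr ((gauss 0 \x gauss 0)%E _).
  apply/seteqP; split=> -[x z] /=; rewrite (_ : reflect c s (x, z) = (x, z))//;
    by congr (_, _); rewrite [LHS]tuple0 [RHS]tuple0.
have hc := mpres_prod (mpres_cons n) (mpres_cons n).
have hi := mpres_interchange mu mu (gauss n) (gauss n).
apply: (mpres_conj (mpres_comp hi hc)
  (mpres_prod (std_gauss_refl (cs ord0)) (IH _ _ (fun i => cs (lift ord0 i))))).
  exact: measurable_reflect.
move=> p; rewrite /reflect /= !mix_cons /=.
by congr (_, cons_pair (_, _)); rewrite mulNr.
Qed.

Lemma gauss_box n (B : 'I_n -> set T) : (forall i, measurable (B i)) ->
  gauss n [set x | forall i, B i (tnth x i)] = (\prod_(i < n) mu (B i))%E.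
Proof. exact: power_prob_box. Qed.

(** Boxes are stable under intersection and generate the sigma-algebra, so a finite measure is
    determined by its values on them. *)
Lemma gauss_box_unique n (m : {measure set (V n) -> \bar R}) :
  (forall B : 'I_n -> set T, (forall i, measurable (B i)) ->
    m [set x | forall i, B i (tnth x i)] = (\prod_(i < n) mu (B i))%E) ->
  forall A, measurable A -> m A = gauss n A.
Proof.
move=> mbox A mA.
pose G : set (set (V n)) := [set X | exists2 B : 'I_n -> set T,
  (forall i, measurable (B i)) & X = [set x | forall i, B i (tnth x i)]].
have GT : G setT.
  by exists (fun=> setT) => //; apply/seteqP; split.
have mG : G `<=` measurable.
  move=> _ [B mB ->].
  rewrite [X in measurable X](_ : _ = \big[setI/setT]_(i < n)
      ((@tnth n T ^~ i) @^-1` B i)); last first.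
    by rewrite -bigcap_seq; apply/seteqP; split=> [x h i _|x h i] /=;
      [exact: h|apply: h; rewrite /= mem_index_enum].
  apply: bigsetI_measurable => i _.
  by rewrite -[X in measurable X]setTI; exact: measurable_tnth.
apply: (measure_unique G (fun=> setT)) => //.
- apply/seteqP; split; last first.
  exact: (smallest_sub (sigma_algebra_measurable _) mG).
  apply: smallest_sub; first exact: smallest_sigma_algebra.
  rewrite -bigcup_seq => X [i _ [C mC <-]].
  apply: sub_sigma_algebra.
  exists (fun j => if j == i then C else setT); first by move=> j; case: ifP.
  rewrite setTI; apply/seteqP; split=> x /=; first by move=> Cx j; case: eqP => // ->.
  by move=> /(_ i); rewrite eqxx.
- move=> _ _ [B mB ->] [C mC ->]; exists (fun i => B i `&` C i).
    by move=> i; exact: measurableI.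
  apply/seteqP; split=> x /=; first by move=> [hB hC] i; split.
  by move=> h; split=> i; have [] := h i.
- by apply/seteqP; split=> // x _; exists 0%N.
- by move=> _ [B mB ->]; rewrite mbox//; exact/esym/gauss_box.
- move=> _; have -> : m setT = gauss n setT.
    have [B mB ->] := GT.
    by rewrite mbox//; exact/esym/gauss_box.
  by rewrite probability_setT ltry.
Qed.

Lemma gauss_permute n (s : 'S_n) :
  mpres (gauss n) (gauss n) (permute_coord s : V n -> V n).
Proof.
have mp : measurable_fun setT (permute_coord s : V n -> V n).
  by apply: measurable_mktuple => i; exact: measurable_tnth.
split=> // A mA.
apply: (gauss_box_unique (m := pushforward (gauss n) (permute_coord s : V n -> V n))) => //.
move=> B mB; rewrite /pushforward /=.
transitivity (gauss n [set x : V n | forall i, B ((s^-1)%g i) (tnth x i)]).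
  congr (gauss n _); apply/seteqP; split=> x /= h i.
    by have := h ((s^-1)%g i); rewrite tnth_mktuple permKV.
  by rewrite tnth_mktuple -{1}(permK s i); exact: h.
apply: (etrans (gauss_box (B := fun i => B ((s^-1)%g i)) _)) => //.
rewrite [RHS](reindex_inj (@perm_inj _ (s^-1)%g)) /=.
by apply: eq_bigr.
Qed.

End tuples.

(** * Shifts of the Gaussian measure and a dominating function *)

Section gauss_density.
Context {R : realType}.
Local Notation T := (measurableTypeR R).
Local Notation mu := (@std_gauss R).
Local Notation V n := (n.-tuple (measurableTypeR R)).

Let ge0_intZr d (U : measurableType d) (P : probability U R) (f : U -> \bar R) (k : R) :
  measurable_fun setT f -> (forall x, 0 <= f x)%E -> 0 <= k ->
  (\int[P]_x (f x * k%:E) = \int[P]_x f x * k%:E)%E.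
Proof. by move=> mf f0 k0; rewrite ge0_integralZr. Qed.

Definition shiftv n (w : 'I_n -> R) (x : V n) : V n :=
  [tuple tnth x i + w i | i < n].

Lemma measurable_shiftv n w : measurable_fun setT (@shiftv n w).
Proof.
apply: measurable_mktuple => i; apply: measurable_funD => //.
exact: measurable_tnth.
Qed.

Definition cmv n (w : 'I_n -> R) (x : V n) : R :=
  expR (\sum_(i < n) (w i * tnth x i - w i ^+ 2 / 2)).

Lemma measurable_cmv n w : measurable_fun setT (@cmv n w).
Proof.
apply: measurableT_comp => //; apply: measurable_sum => i.
apply: measurable_funB => //; apply: measurable_funM => //.
exact: measurable_tnth.
Qed.

Lemma cmv_cons n (w : 'I_n.+1 -> R) (x : R) (y : V n) :
  cmv w (cons_pair (x, y)) = cmv (fun i => w (lift ord0 i)) y * cm_dens (w ord0) x.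
Proof.
rewrite [LHS]/cmv big_ord_recl.
rewrite expRD.
rewrite [LHS]mulrC.
by congr (expR _ * _); apply: eq_bigr => i _; rewrite tnthS.
Qed.

Lemma gauss_cons_integral n (F : V n.+1 -> \bar R) :
  measurable_fun setT F -> (forall x, 0 <= F x)%E ->
  (\int[gauss n.+1]_x F x =
   \int[mu]_x \int[gauss n]_y F (cons_pair (x, y)))%E.
Proof.
move=> mF F0; rewrite -(mpres_ge0 (mpres_cons n) mF F0).
rewrite (@tonelli_prod _ _ _ _ _ mu (gauss n) (fun p => F (cons_pair p)))//.
by apply: (measurableT_comp mF); exact: measurable_cons_pair.
Qed.

Lemma gauss_shift n (w : 'I_n -> R) (F : V n -> \bar R) :
  measurable_fun setT F -> (forall x, 0 <= F x)%E ->
  (\int[gauss n]_x F (shiftv w x) =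
   \int[gauss n]_x (F x * (cmv w x)%:E))%E.
Proof.
elim: n w F => [|n IH] w F mF F0.
  apply: eq_integral => x _; rewrite /cmv big_ord0 expR0 mule1.
  by congr F; rewrite [LHS]tuple0 [RHS]tuple0.
have mS := measurable_shiftv w.
have mcm := measurable_cmv w.
have mFc : measurable_fun setT (fun p : T * V n => F (cons_pair p)).
  by apply: (measurableT_comp mF); exact: measurable_cons_pair.
have mFS := measurableT_comp mF mS.
have mFw : measurable_fun setT (fun x => F x * (cmv w x)%:E)%E.
  by apply: emeasurable_funM => //; exact/measurable_EFinP.
have Fw0 x : (0 <= F x * (cmv w x)%:E)%E by rewrite mule_ge0// lee_fin expR_ge0.
rewrite (gauss_cons_integral mFS (fun=> F0 _)) (gauss_cons_integral mFw Fw0).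
pose w' (i : 'I_n) := w (lift ord0 i).
have mcm' := measurable_cmv w'.
transitivity (\int[mu]_x \int[gauss n]_y
  (F (cons_pair (((x : R) + w ord0)%R, y)) * (cmv w' y)%:E))%E.
  apply: eq_integral => x _; rewrite -IH; first last.
  - by move=> y; exact: F0.
  - by apply: (measurableT_comp mFc); exact: measurable_fun_pair.
  apply: eq_integral => y _; congr F; apply: eq_from_tnth => i.
  rewrite tnth_mktuple; case: (unliftP ord0 i) => [j ->|->]; rewrite ?tnth0// !tnthS.
  by rewrite tnth_mktuple.
have mG : measurable_fun setT (fun p : T * V n => F (cons_pair p) * (cmv w' p.2)%:E)%E.
  apply: emeasurable_funM => //; apply/measurable_EFinP.
  exact: (measurableT_comp mcm').
have G0 (p : T * V n) : (0 <= F (cons_pair p) * (cmv w' p.2)%:E)%E.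
  by rewrite mule_ge0// lee_fin expR_ge0.
have mG1 := measurable_tonelli (gauss n) mG G0.
have G1 x : (0 <= \int[gauss n]_y (F (cons_pair (x, y)) * (cmv w' y)%:E))%E.
  by apply: integral_ge0 => y _; exact: (G0 (x, y)).
apply: (etrans (std_gauss_shift (w ord0) mG1 G1)).
apply: eq_integral => x _; apply: (etrans (esym (ge0_intZr _ _ _ _))).
- by apply: (measurableT_comp mG); exact: measurable_fun_pair.
- by move=> y; exact: (G0 (x, y)).
- exact: expR_ge0.
apply: eq_integral => y _; rewrite -muleA; congr (_ * _)%E.
by rewrite cmv_cons EFinM.
Qed.

(** One integrable majorant for all error terms: it dominates the coordinates, their squares and the
    remainder of the Cameron-Martin density. Its exponent is half the Gaussian one, so each
    coordinate contributes at most 2 to its expectation. *)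
Definition edom n (x : V n) : R := expR (\sum_(i < n) (tnth x i ^+ 2 / 4)).

Lemma measurable_edom n : measurable_fun setT (@edom n).
Proof.
apply: measurableT_comp => //; apply: measurable_sum => i.
apply: measurable_funM => //; apply: measurable_funX.
exact: measurable_tnth.
Qed.

Lemma gauss_edom n : (\int[gauss n]_x (edom x)%:E <= (2 ^+ n)%:E)%E.
Proof.
elim: n => [|n IH].
  rewrite (eq_integral (cst 1%E)); last by move=> x _; rewrite /edom big_ord0 expR0.
  by rewrite integral_cst// mul1e expr0; exact: probability_le1.
rewrite gauss_cons_integral; first last.
- by move=> x; rewrite lee_fin expR_ge0.
- apply/measurable_EFinP; exact: measurable_edom.
have mE : measurable_fun setT (fun p : T * V n => (edom (cons_pair p))%:E).
  apply/measurable_EFinP.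
  exact: (measurableT_comp (@measurable_edom n.+1) (@measurable_cons_pair _ T n)).
have m1 : measurable_fun setT (fun x : T => (expR (2^-1 * x ^+ 2 / 2))%:E).
  apply/measurable_EFinP; apply: measurableT_comp => //; apply: measurable_funM => //.
  exact: measurable_funM.
apply: (@le_trans _ _ (\int[mu]_x ((expR (2^-1 * (x : R) ^+ 2 / 2))%:E * (2 ^+ n)%:E))%E).
  apply: ge0_le_integral => //.
  - by move=> x _; apply: integral_ge0 => y _; rewrite lee_fin expR_ge0.
  - by apply: (measurable_tonelli (gauss n) mE) => x; rewrite lee_fin expR_ge0.
  - by apply: emeasurable_funM.
  move=> x _; apply: (@le_trans _ _ ((expR (2^-1 * (x : R) ^+ 2 / 2))%:E *
     \int[gauss n]_y (edom y)%:E)%E); last first.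
    by rewrite lee_pmul2l// lte_fin expR_gt0.
  rewrite muleC -ge0_intZr => [||y|]; first last.
  - exact: expR_ge0.
  - by rewrite lee_fin expR_ge0.
  - apply/measurable_EFinP; exact: measurable_edom.
  apply: ge0_le_integral => //.
  - by move=> y _; rewrite lee_fin expR_ge0.
  - by apply: (measurableT_comp mE); exact: measurable_fun_pair.
  - by apply: emeasurable_funM => //; apply/measurable_EFinP; exact: measurable_edom.
  move=> y _; rewrite -EFinM lee_fin /edom -expRD big_ord_recl tnth0 ler_expR addrC.
  apply: lerD; last by rewrite /= le_eqVlt; apply/orP; left; apply/eqP; field.
  by apply: ler_sum => i _; rewrite tnthS.
rewrite ge0_intZr ?exprn_ge0//.
rewrite exprS EFinM lee_wpmul2r ?lee_fin ?exprn_ge0//.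
have b01 : 0 <= (2^-1 : R) < 1 by apply/andP; split; lra.
have := @std_gauss_exp_sqr R 2^-1 (b01).
by have -> : (1 - 2^-1 : R)^-1 = 2 by field.
Qed.

End gauss_density.

(** * Noise operators and rotations *)

Opaque Rintegral.

Lemma eq_ler (R : numDomainType) (x y : R) : x = y -> x <= y.
Proof. by move=> ->. Qed.

Lemma sum_telescope (R : pzRingType) (q : nat -> R) n :
  q 0%N - q n = \sum_(k < n) (q k - q k.+1).
Proof.
elim: n => [|n IH]; first by rewrite big_ord0 subrr.
by rewrite big_ord_recr /= -IH addrA subrK.
Qed.

Section noise.
Context {R : realType} {n : nat}.
Local Notation V := (n.-tuple (measurableTypeR R)).
Local Notation G := (@gauss R n).
Implicit Types (F H : V -> R) (c d : 'I_n -> R).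

Lemma bmf_mix_l F c s x : bmf F -> bmf (fun z => F (mix c s x z)).
Proof. by move=> bF; apply: (bmf_comp bF); exact: measurable_mix. Qed.

Lemma bmf_mix F c s : bmf F -> bmf (fun p : V * V => F (mix c s p.1 p.2)).
Proof. by move=> bF; apply: (bmf_comp bF); exact: measurable_mix. Qed.

Lemma bmf_fst F : bmf F -> bmf (fun p : V * V => F p.1).
Proof. by move=> bF; exact: (bmf_comp bF). Qed.

Lemma Ex_reflect c s (H : V * V -> R) : (forall i, c i ^+ 2 + s i ^+ 2 = 1) ->
  bmf H ->
  Ex G (fun x => Ex G (fun z => H (reflect c s (x, z)))) =
  Ex G (fun x => Ex G (fun z => H (x, z))).
Proof.
move=> cs bH; rewrite -Ex_prod1// -(@Ex_prod1 _ _ _ _ _ _ _ (fun p => H (reflect c s p))).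
  by apply: (mpres_Ex (gauss_reflect cs)); exact: bmf_meas.
by apply: (bmf_comp bH); exact: measurable_reflect.
Qed.

Definition compl c i := Num.sqrt (1 - c i ^+ 2).

(** Mehler's formula with a separate correlation for each coordinate. Correlation 1 keeps a
    coordinate and 0 resamples it, so conditional expectations and Ornstein-Uhlenbeck operators lie
    in one commuting family. *)
Definition noise c F x := Ex G (fun z => F (mix c (compl c) x z)).

Definition corr c := forall i, 0 <= c i <= 1.

Lemma complP c : corr c -> forall i, c i ^+ 2 + compl c i ^+ 2 = 1.
Proof.
move=> hc i; have /andP[c0 c1] := hc i.
by rewrite sqr_sqrtr ?subrKC// subr_ge0 expr_le1.
Qed.

Lemma bmf_noise c F : bmf F -> bmf (noise c F).
Proof.
by move=> bF; apply: (@bmf_Ex1 _ _ _ _ _ G G (fun p => F (mix c (compl c) p.1 p.2)));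
  exact: bmf_mix.
Qed.

Lemma noise_cst c r : noise c (fun=> r) = fun=> r.
Proof. by apply/funext => x; exact: Ex_cst. Qed.

Lemma noiseB c F H : bmf F -> bmf H ->
  noise c (fun x => F x - H x) = fun x => noise c F x - noise c H x.
Proof.
move=> bF bH; apply/funext => x; rewrite /noise ExB//;
  exact/bmf_integrable/bmf_mix_l.
Qed.

Lemma noise_zero F x : noise (fun=> 0) F x = Ex G F.
Proof.
apply: eq_Ex => z; congr F; apply: eq_from_tnth => i.
by rewrite tnth_mix /compl expr0n subr0 sqrtr1 mul0r mul1r add0r.
Qed.

Lemma Ex_noise c F : corr c -> bmf F -> Ex G (noise c F) = Ex G F.
Proof.
move=> hc bF; rewrite /noise.
rewrite (@Ex_reflect c (compl c) (fun p => F p.1) (complP hc) (bmf_fst bF)).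
by apply: eq_Ex => x; exact: (Ex_cst G (F x)).
Qed.

Lemma Ex_noise_joint c F H : bmf F -> bmf H ->
  Ex G (fun x => F x * noise c H x) =
  Ex G (fun x => Ex G (fun z => F x * H (mix c (compl c) x z))).
Proof.
move=> bF bH; apply: eq_Ex => x; rewrite /noise ExZ//.
exact/bmf_integrable/bmf_mix_l.
Qed.

Lemma mix_reflectK c s x z : (forall i, c i ^+ 2 + s i ^+ 2 = 1) ->
  mix c s (mix c s x z) (mix s (fun i => - c i) x z) = x.
Proof.
move=> cs; apply: eq_from_tnth => i; rewrite !tnth_mix.
by rewrite -[RHS]mul1r -(cs i); ring.
Qed.

(** The measure-preserving involution [reflect] exchanges [x] and [mix c (compl c) x z] as first
    components. *)
Lemma noise_sym c F H : corr c -> bmf F -> bmf H ->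
  Ex G (fun x => F x * noise c H x) = Ex G (fun x => noise c F x * H x).
Proof.
move=> hc bF bH; rewrite Ex_noise_joint//.
have cs := complP hc.
rewrite -(@Ex_reflect c (compl c) (fun p => F p.1 * H (mix c (compl c) p.1 p.2)) cs).
  apply: eq_Ex => x; rewrite mulrC -ExZ; last exact/bmf_integrable/bmf_mix_l.
  by apply: eq_Ex => z; rewrite mix_reflectK// mulrC.
by apply: bmfM; [exact: bmf_fst|exact: bmf_mix].
Qed.

Lemma corrM c d : corr c -> corr d -> corr (fun i => c i * d i).
Proof.
move=> hc hd i; have /andP[? ?] := hc i; have /andP[? ?] := hd i.
by rewrite mulr_ge0//= mulr_ile1.
Qed.

(** The two independent noises [d i * compl c i * z1] and [compl d i * z2] add up to a single
    Gaussian of size [m i]. *)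
Lemma noise_comp c d F : corr c -> corr d -> bmf F ->
  noise c (noise d F) = noise (fun i => c i * d i) F.
Proof.
move=> hc hd bF; apply/funext => x; rewrite /noise.
pose cd i := c i * d i; pose m := compl cd; rewrite -/cd -/m.
have m2 i : m i ^+ 2 = 1 - cd i ^+ 2.
  by rewrite -(complP (corrM hc hd) i) addrAC subrr add0r.
have c2 i : compl c i ^+ 2 = 1 - c i ^+ 2 by rewrite -(complP hc i) addrAC subrr add0r.
have d2 i : compl d i ^+ 2 = 1 - d i ^+ 2 by rewrite -(complP hd i) addrAC subrr add0r.
(* [(a i, b i)] is the unit vector along the two noise amplitudes; when both vanish any unit vector
   will do. *)
pose a i := if m i == 0 then 1 else d i * compl c i / m i.
pose b i := if m i == 0 then 0 else compl d i / m i.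
have ab i : a i ^+ 2 + b i ^+ 2 = 1.
  rewrite /a /b; case: eqP => [|/eqP m0]; first by rewrite expr1n expr0n addr0.
  rewrite !expr_div_n !exprMn -mulrDl c2 d2 m2 /cd.
  have : 1 - (c i * d i) ^+ 2 != 0 by rewrite -/(cd i) -m2 expf_eq0.
  by move=> h; rewrite [X in X / _](_ : _ = 1 - (c i * d i) ^+ 2) ?divff//; ring.
have amb i : m i * a i = d i * compl c i /\ m i * b i = compl d i.
  rewrite /a /b; case: eqP => [m0|/eqP m0]; last by split; rewrite mulrC divfK.
  have := m2 i; rewrite m0 expr0n /= /cd => h.
  have /andP[c0 c1] := hc i; have /andP[d0 d1] := hd i.
  have cc1 : c i ^+ 2 <= 1 by rewrite expr_le1.
  have dd1 : d i ^+ 2 <= 1 by rewrite expr_le1.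
  have e : c i ^+ 2 * d i ^+ 2 = 1 by rewrite -exprMn; lra.
  have cE : c i ^+ 2 = 1 by have := sqr_ge0 (c i); have := sqr_ge0 (d i); nra.
  have dE : d i ^+ 2 = 1 by have := sqr_ge0 (c i); have := sqr_ge0 (d i); nra.
  by rewrite /compl cE dE subrr sqrtr0; split; ring.
transitivity (Ex G (fun z1 => Ex G (fun=> F (mix cd m x z1)))); last first.
  by apply: eq_Ex => z1; rewrite (Ex_cst G).
rewrite -(@Ex_reflect a b (fun p : V * V => F (mix cd m x p.1)) ab); last first.
  by apply: (bmf_comp bF); exact: measurable_mix.
apply: eq_Ex => z1; apply: eq_Ex => z2; congr F.
apply: eq_from_tnth => i; rewrite !tnth_mix.
have [h1 h2] := amb i.
by rewrite !mulrDr !mulrA h1 h2 /cd; ring.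
Qed.

Lemma noise_contract c F : corr c -> bmf F ->
  Ex G (fun x => noise c F x ^+ 2) <= Ex G (fun x => F x ^+ 2).
Proof.
move=> hc bF; rewrite -[leRHS](Ex_noise hc (bmfX 2 bF)).
apply: le_Ex; [exact/bmf_integrable/bmfX/bmf_noise| |].
  exact/bmf_integrable/bmf_noise/bmfX.
by move=> x; apply: Ex_sqr; exact: bmf_mix_l.
Qed.

Lemma Ex_noise_sqr c F : corr c -> bmf F ->
  Ex G (fun x => F x * noise (fun i => c i * c i) F x) =
  Ex G (fun x => noise c F x ^+ 2).
Proof.
move=> hc bF; rewrite -(noise_comp hc hc bF).
exact: (noise_sym hc bF (bmf_noise c bF)).
Qed.

Opaque noise.

Definition erase (k : 'I_n) : 'I_n -> R := fun i => (i != k)%:R.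

Lemma corr_erase k : corr (erase k).
Proof. by move=> i; rewrite /erase ler0n lern1 leq_b1. Qed.

(* Efron-Stein inequality after noise: the coordinates are erased one at a
   time, and the successive differences are quadratic forms of [F - E_k F]. *)
Lemma noise_efron_stein (r : R) F : 0 <= r <= 1 -> bmf F ->
  Ex G (fun x => F x * noise (fun=> r ^+ 2) F x) - Ex G F ^+ 2 <=
  \sum_(k < n) Ex G (fun x =>
     noise (fun=> r) (fun y => F y - noise (erase k) F y) x ^+ 2).
Proof.
move=> r01 bF.
(* Stage [k] has erased the coordinates below [k], so [q] runs from the noise correlation at stage 0
   to the squared mean at stage [n]. *)
pose eps (k : nat) (i : 'I_n) : R := (k <= i)%:R.
have ceps k : corr (eps k) by move=> i; rewrite /eps ler0n lern1 leq_b1.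
have cr : corr (fun=> r) by [].
pose tau k i := eps k i * r.
have ctau k : corr (tau k) by exact: corrM.
pose sig k i := tau k i * tau k i.
have csig k : corr (sig k) by exact: corrM.
pose q k := Ex G (fun x => F x * noise (sig k) F x).
have q0 : q 0%N = Ex G (fun x => F x * noise (fun=> r ^+ 2) F x).
  rewrite /q (_ : sig 0%N = fun=> r ^+ 2)//.
  by apply/funext => i; rewrite /sig /tau /eps leq0n mul1r expr2.
have qn : q n = Ex G F ^+ 2.
  rewrite /q (_ : sig n = fun=> 0); last first.
    by apply/funext => i; rewrite /sig /tau /eps leqNgt ltn_ord mul0r mul0r.
  rewrite expr2; transitivity (Ex G (fun x => Ex G F * F x)).
    by apply: eq_Ex => x; rewrite noise_zero mulrC.
  by apply: ExZ; exact: bmf_integrable.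
rewrite -{}q0 -{}qn.
have -> : q 0%N - q n = \sum_(k < n) (q k - q k.+1).
  exact: sum_telescope.
apply: ler_sum => k _; pose D y := F y - noise (erase k) F y; rewrite -/D.
have bD : bmf D by apply: bmfB => //; exact: bmf_noise.
have cek := corr_erase k.
have sigS : (fun i => sig k i * erase k i) = sig k.+1.
  apply/funext => i; rewrite /sig /tau /eps /erase -(inj_eq val_inj) /=.
  by case: (ltngtP k i) => h; rewrite ?mulr1 ?mulr0 ?mul0r// mulr0 mul0r.
have -> : q k - q k.+1 = Ex G (fun x => F x * noise (sig k) D x).
  rewrite /q -ExB//; try by apply/bmf_integrable/bmfM => //; exact: bmf_noise.
  apply: eq_Ex => x; rewrite -mulrBr /D (noiseB _ bF (bmf_noise _ bF)).
  by rewrite (noise_comp (csig k) cek bF) sigS.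
have i1 : bmf (fun x => F x * noise (sig k) D x).
  by apply: bmfM => //; exact: bmf_noise.
have i2 : bmf (fun x => noise (erase k) F x * noise (sig k) D x).
  by apply: bmfM; exact: bmf_noise.
have e0 : noise (erase k) D = fun=> 0.
  rewrite /D (noiseB _ bF (bmf_noise _ bF)).
  rewrite (noise_comp cek cek bF); apply/funext => x.
  rewrite (_ : (fun i => erase k i * erase k i) = erase k) ?subrr//.
  by apply/funext => i; rewrite /erase; case: (i != k); rewrite ?mulr1 ?mulr0.
(* [erase k] annihilates [D], is symmetric and commutes with [noise (sig k)], so replacing [F] by
   [D] on the left changes nothing. *)
have X : Ex G (fun x => D x * noise (sig k) D x) = Ex G (fun x => F x * noise (sig k) D x).
  transitivity (Ex G (fun x => F x * noise (sig k) D x - noise (erase k) F x * noise (sig k) D x)).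
    apply: eq_Ex => x. rewrite -mulrBl. by [].
  rewrite (ExB (bmf_integrable _ i1) (bmf_integrable _ i2)).
  rewrite -(noise_sym cek bF (bmf_noise _ bD)).
  rewrite (noise_comp cek (csig k) bD).
  rewrite (_ : (fun i => _) = fun i => sig k i * erase k i); last first.
    by apply/funext => i; rewrite mulrC.
  rewrite -(noise_comp (csig k) cek bD) e0 noise_cst.
  transitivity (Ex G (fun x => F x * noise (sig k) D x) - Ex G (fun=> 0)).
    by congr (_ - _); apply: eq_Ex => x; exact: mulr0.
  by rewrite Ex_cst subr0.
refine (@eq_ind _ _ (fun u => u <= _) _ _ X).
clear X e0.
(* Undoing the erasures of earlier coordinates can only increase the [L^2] norm. *)
have h := noise_contract (ceps k) (bmf_noise (fun=> r) bD).
rewrite (noise_comp (ceps k) cr bD) in h.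
exact: le_trans (eq_ler (Ex_noise_sqr (ctau k) bD)) h.
Qed.

Transparent noise.
End noise.

(** * The [L^1] cost of coordinatewise rotations *)

Section rotation_distance.
Context {R : realType} {n : nat}.
Local Notation V := (n.-tuple (measurableTypeR R)).
Local Notation G := (@gauss R n).
Implicit Types (F H : V -> R) (al be : 'I_n -> R).

Definition rotdist F al := Ex G (fun x => Ex G (fun z =>
  `|F x - F (mix (fun i => cos (al i)) (fun i => sin (al i)) x z)|)).

Lemma bmf_dist F c s : bmf F -> bmf (fun p : V * V => `|F p.1 - F (mix c s p.1 p.2)|).
Proof. by move=> bF; apply/bmf_norm/bmfB; [exact: bmf_fst|exact: bmf_mix]. Qed.

Lemma bmf_dist_r F c s x : bmf F -> bmf (fun z => `|F x - F (mix c s x z)|).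
Proof.
by move=> bF; exact: (bmf_pair1 (F := fun p : V * V => `|F p.1 - F (mix c s p.1 p.2)|) x
  (bmf_dist c s bF)).
Qed.

Lemma bmf_Ex_dist F c s : bmf F -> bmf (fun x => Ex G (fun z => `|F x - F (mix c s x z)|)).
Proof.
by move=> bF; exact: (bmf_Ex1 (F := fun p : V * V => `|F p.1 - F (mix c s p.1 p.2)|) G G
  (bmf_dist c s bF)).
Qed.

Lemma rotdist_ge0 F al : 0 <= rotdist F al.
Proof. by apply: Ex_ge0 => x; apply: Ex_ge0 => z. Qed.

(** Triangle inequality through the point rotated by [al]; by invariance the second leg costs as
    much as a rotation by [be] from the start. *)
Lemma rotdistD F al be : bmf F ->
  rotdist F (fun i => al i + be i) <= rotdist F al + rotdist F be.
Proof.
move=> bF; pose c i := cos (al i); pose s i := sin (al i).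
have cs i : c i ^+ 2 + s i ^+ 2 = 1 by rewrite cos2Dsin2.
pose cb i := cos (be i); pose sb i := sin (be i).
have -> : rotdist F be = Ex G (fun x => Ex G (fun z =>
    `|F (mix c s x z) - F (mix (fun i => cos (al i + be i)) (fun i => sin (al i + be i)) x z)|)).
  (* The sign of [z] is flipped first because the invariance at hand is for reflections: with this
     sign, composing with [reflect c s] gives the angle [al + be]. *)
  pose H (p : V * V) := `|F p.1 - F (mix cb (fun i => - sb i) p.1 p.2)|.
  have bH : bmf H by exact: bmf_dist.
  transitivity (Ex G (fun x => Ex G (fun z => H (x, z)))).
    transitivity (Ex G (fun x => Ex G (fun z => H (reflect (fun=> 1) (fun=> 0) (x, z))))).
      apply: eq_Ex => x; apply: eq_Ex => z; rewrite /H /=.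
      congr `|F _ - F _|; apply: eq_from_tnth => i; rewrite !tnth_mix.
        by rewrite mul1r mul0r addr0.
      by rewrite /cb /sb; ring.
    by apply: Ex_reflect => // i; rewrite expr1n expr0n addr0.
  apply: (etrans (esym (Ex_reflect cs bH))).
  apply: eq_Ex => x; apply: eq_Ex => z; rewrite /H /=.
  congr `|_ - F _|; apply: eq_from_tnth => i; rewrite !tnth_mix cosD sinD /cb /sb /c /s.
  ring.
pose c' i := cos (al i + be i); pose s' i := sin (al i + be i).
have b1 x : bmf (fun z => F (mix c s x z)) by exact: bmf_mix_l.
have b2 x : bmf (fun z => F (mix c' s' x z)) by exact: bmf_mix_l.
have b3 : bmf (fun p : V * V => `|F (mix c s p.1 p.2) - F (mix c' s' p.1 p.2)|).
  by apply/bmf_norm/bmfB; exact: bmf_mix.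
have b4 := bmf_Ex1 G G b3.
have b5 x := bmf_pair1 x b3.
rewrite -ExD; [|exact/bmf_integrable/bmf_Ex_dist|exact: bmf_integrable].
apply: le_Ex; [exact/bmf_integrable/bmf_Ex_dist| |].
  by apply/bmf_integrable/bmfD => //; exact: bmf_Ex_dist.
move=> x; rewrite -ExD; [|exact/bmf_integrable/bmf_dist_r|exact: bmf_integrable (b5 x)].
apply: le_Ex; [exact/bmf_integrable/bmf_dist_r| |].
  by apply/bmf_integrable/bmfD => //; [exact: bmf_dist_r|exact: (b5 x)].
by move=> z; apply: ler_distD.
Qed.

(** Reduces to tiny angles: an error of order [4 ^- k] in one small rotation remains negligible
    after multiplication by [2 ^ k]. *)
Lemma rotdist_halves F al k : bmf F ->
  rotdist F al <= 2 ^+ k * rotdist F (fun i => al i / 2 ^+ k).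
Proof.
move=> bF; elim: k => [|k IH].
  rewrite expr0 mul1r (_ : (fun i => _) = al)//; apply/funext => i.
  by rewrite divr1.
apply: (le_trans IH); clear IH; rewrite exprSr -mulrA; apply: ler_wpM2l.
  exact: exprn_ge0.
have e : (fun i => al i / 2 ^+ k) =
   (fun i => al i / (2 ^+ k * 2) + al i / (2 ^+ k * 2)).
  apply/funext => i; have : 2 ^+ k != 0 :> R by rewrite expf_neq0.
  by move=> h; field.
rewrite {}e; apply: (le_trans (rotdistD _ _ bF)).
by rewrite mulr_natl mulr2n.
Qed.

(* Replacing [F] by an approximation costs twice the [L^1] error. *)
Lemma rotdist_approx F H al : bmf F -> bmf H ->
  rotdist F al <= rotdist H al + 2 * Ex G (fun x => `|F x - H x|).
Proof.
move=> bF bH; pose c i := cos (al i); pose s i := sin (al i).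
have cs i : c i ^+ 2 + s i ^+ 2 = 1 by rewrite cos2Dsin2.
pose D x : R := `|F x - H x|; have bD : bmf D by exact/bmf_norm/bmfB.
have e : Ex G (fun x => Ex G (fun z => D (mix c s x z))) = Ex G D.
  apply: (etrans (@Ex_reflect _ _ c s (fun p => D p.1) cs (bmf_fst bD))).
  by apply: eq_Ex => x; exact: (Ex_cst G (D x)).
have -> : 2 * Ex G D = Ex G D + Ex G (fun x => Ex G (fun z => D (mix c s x z))).
  by rewrite {}e mulr_natl mulr2n.
clear e.
have b1 : bmf (fun x => Ex G (fun z => D (mix c s x z))).
  exact: (bmf_Ex1 (F := fun p : V * V => D (mix c s p.1 p.2)) G G (bmf_mix c s bD)).
rewrite -ExD; [|exact: bmf_integrable|exact: bmf_integrable].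
have b2 := bmf_Ex_dist c s bH.
rewrite -ExD; [|exact: bmf_integrable|exact/bmf_integrable/bmfD].
apply: le_Ex; [exact/bmf_integrable/bmf_Ex_dist|by apply/bmf_integrable/bmfD => //; exact: bmfD|].
move=> x; rewrite -[X in _ + (X + _)](Ex_cst G).
have b3 : bmf (fun z => D (mix c s x z)) by exact: bmf_mix_l.
rewrite -ExD; [|exact/bmf_integrable/bmf_cst|exact: bmf_integrable].
have b4 := bmf_dist_r c s x bH.
have b5 := bmfD (@bmf_cst _ V R (D x)) b3.
rewrite -ExD; [|exact: bmf_integrable|exact: bmf_integrable].
apply: le_Ex; [exact/bmf_integrable/bmf_dist_r|exact/bmf_integrable/bmfD|].
move=> z; rewrite -/c -/s /D.
set y := mix c s x z.
have -> : F x - F y = (H x - H y) + ((F x - H x) - (F y - H y)) by ring.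
by apply: (le_trans (ler_normD _ _)); rewrite lerD2l ler_normB.
Qed.

(** For values in [{0, 1}] one has [|a - b| = a + b - 2 a b], and both marginals have the law of
    [x]. *)
Lemma rotdist_noise F (th : R) : bmf F -> (forall x, F x ^+ 2 = F x) ->
  0 <= th <= pi / 2 ->
  rotdist F (fun=> th) =
  2 * (Ex G F - Ex G (fun x => F x * noise (fun=> cos th) F x)).
Proof.
move=> bF F01 /andP[th0 th1].
have ccos : corr (fun _ : 'I_n => cos th).
  move=> i; rewrite cos_le1 cos_ge0_pihalf// th1 andbT.
  by rewrite (le_trans _ th0)// oppr_le0 divr_ge0// pi_ge0.
have hs : compl (fun _ : 'I_n => cos th) = fun=> sin th.
  apply/funext => i; rewrite /compl.
  have -> : 1 - cos th ^+ 2 = sin th ^+ 2 by rewrite sin2cos2.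
  rewrite sqrtr_sqr ger0_norm// sin_ge0_pi// th0/=.
  by apply: (le_trans th1); have := pi_ge0 R; lra.
rewrite Ex_noise_joint//.
pose c := fun _ : 'I_n => cos th.
have b0 : bmf (fun p : V * V => F p.1 * F (mix c (compl c) p.1 p.2)).
  by apply: bmfM; [exact: bmf_fst|exact: bmf_mix].
have b1 := bmf_Ex1 G G b0; have b2 x := bmf_pair1 x b0.
have n1 := Ex_noise ccos bF.
have n2 := bmf_noise c bF.
have -> : 2 * (Ex G F - Ex G (fun x => Ex G (fun z => F x * F (mix c (compl c) x z)))) =
  (Ex G F + Ex G (noise c F)) - 2 * Ex G (fun x => Ex G (fun z => F x * F (mix c (compl c) x z))).
  by rewrite n1; ring.
rewrite -ExD; [|exact: bmf_integrable|exact: bmf_integrable].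
rewrite -ExZ; last exact: bmf_integrable b1.
rewrite -ExB; last first.
- exact: bmf_integrable (bmfM (@bmf_cst _ _ R 2) b1).
- exact/bmf_integrable/bmfD.
apply: eq_Ex => x; rewrite -[X in X + _ - _](Ex_cst G (F x)).
have b3 : bmf (fun z => F (mix c (compl c) x z)) by exact: bmf_mix_l.
rewrite -ExD; [|exact/bmf_integrable/bmf_cst|exact: bmf_integrable].
rewrite -ExZ; last exact: bmf_integrable (b2 x).
rewrite -ExB; last first.
- exact: bmf_integrable (bmfM (@bmf_cst _ _ R 2) (b2 x)).
- exact/bmf_integrable/(bmfD (@bmf_cst _ V R (F x)) b3).
apply: eq_Ex => z; rewrite hs -/c; set y := mix _ _ _ _.
have i01 u : F u = 0 \/ F u = 1.
  have : F u * (F u - 1) = 0 by rewrite mulrBr -expr2 F01 mulr1 subrr.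
  by move/eqP; rewrite mulf_eq0 subr_eq0 => /orP[]/eqP; [left|right].
by case: (i01 x) => ->; case: (i01 y) => ->;
  rewrite ?subrr ?normr0 ?subr0 ?sub0r ?normrN ?normr1; ring.
Qed.

(** Jensen's inequality in [z]: erasing coordinate [k] averages over its resampled value. *)
Lemma erase_rotdist F k : bmf F ->
  Ex G (fun x => `|F x - noise (erase k) F x|) <=
  rotdist F (fun i => if i == k then pi / 2 else 0).
Proof.
move=> bF; apply: le_Ex.
- by apply/bmf_integrable/bmf_norm/bmfB => //; exact: bmf_noise.
- exact/bmf_integrable/bmf_Ex_dist.
move=> x; rewrite /noise -[X in `|X - _|](Ex_cst G (F x)).
have b1 : bmf (fun z => F (mix (erase k) (compl (erase k)) x z)) by exact: bmf_mix_l.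
rewrite -ExB; [|exact/bmf_integrable/bmf_cst|exact: bmf_integrable].
apply: (le_trans (Ex_norm _)); first exact/bmf_integrable/(bmfB (@bmf_cst _ V R (F x)) b1).
rewrite le_eqVlt; apply/orP; left; apply/eqP; apply: eq_Ex => z.
congr `|_ - F _|; apply: eq_from_tnth => i; rewrite !tnth_mix /compl /erase.
case: eqP => _ /=; first by rewrite cos_pihalf sin_pihalf expr0n subr0 sqrtr1.
by rewrite cos0 sin0 expr1n subrr sqrtr0.
Qed.

End rotation_distance.

(** * Hypercontractivity *)

Section tensorization.
Context {R : realType}.

(** Contraction from [L^2] to [L^4] of the averaging operator of [m], with both norms raised to the
    fourth power. *)
Definition hyper d d' (T : measurableType d) (U : measurableType d')
    (P : probability T R) (Q : probability U R) (m : T * U -> T) :=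
  forall F : T -> R, bmf F ->
  Ex P (fun x => Ex Q (fun z => F (m (x, z))) ^+ 4) <=
  Ex P (fun x => F x ^+ 2) ^+ 2.

Context d1 d2 d3 d4 (T1 : measurableType d1) (T2 : measurableType d2)
  (U1 : measurableType d3) (U2 : measurableType d4).
Variables (P1 : probability T1 R) (P2 : probability T2 R)
  (Q1 : probability U1 R) (Q2 : probability U2 R).
Variables (m1 : T1 * U1 -> T1) (m2 : T2 * U2 -> T2).
Hypotheses (mm1 : measurable_fun setT m1) (mm2 : measurable_fun setT m2).

(** Apply the two inequalities one variable at a time. Exchanging the mixed norms is Minkowski's
    integral inequality, obtained here by duality: with [w] the inner second moment of [B], one gets
    [W <= sqrt W * U]. *)
Lemma hyper_prod : hyper P1 Q1 m1 -> hyper P2 Q2 m2 ->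
  hyper (P1 \x P2)%E (Q1 \x Q2)%E
    (fun p => (m1 (p.1.1, p.2.1), m2 (p.1.2, p.2.2))).
Proof.
move=> h1 h2 F bF.
pose B (p : T1 * T2) := Ex Q2 (fun z => F (p.1, m2 (p.2, z))).
have mB : measurable_fun setT (fun q : (T1 * T2) * U2 => (q.1.1, m2 (q.1.2, q.2))).
  apply: measurable_fun_pair; first exact: measurableT_comp.
  by apply: (measurableT_comp mm2); apply: measurable_fun_pair => //; exact: measurableT_comp.
have bB : bmf B.
  exact: (@bmf_Ex1 _ _ _ _ _ (P1 \x P2)%E Q2 _ (bmf_comp bF mB)).
have mA : measurable_fun setT (fun q : (T1 * T2) * U1 => (m1 (q.1.1, q.2), q.1.2)).
  apply: measurable_fun_pair; last exact: measurableT_comp.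
  by apply: (measurableT_comp mm1); apply: measurable_fun_pair => //; exact: measurableT_comp.
pose A (p : T1 * T2) := Ex Q1 (fun z => B (m1 (p.1, z), p.2)).
have bA : bmf A.
  exact: (@bmf_Ex1 _ _ _ _ _ (P1 \x P2)%E Q1 _ (bmf_comp bB mA)).
have bB2 := bmfX 2 bB; have bA4 := bmfX 4 bA; have bF2 := bmfX 2 bF.
apply: (@le_trans _ _ (Ex (P1 \x P2)%E (fun p => A p ^+ 4))).
  apply: eq_ler; apply: eq_Ex => p; congr (_ ^+ 4).
  apply: (@Ex_prod1 _ _ _ _ _ Q1 Q2 (fun q => F (m1 (p.1, q.1), m2 (p.2, q.2)))).
  apply: (bmf_comp bF); apply: measurable_fun_pair.
    by apply: (measurableT_comp mm1); exact: measurable_fun_pair.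
  by apply: (measurableT_comp mm2); exact: measurable_fun_pair.
apply: (le_trans (eq_ler (Ex_prod2 _ _ bA4))).
pose w x2 := Ex P1 (fun x1 => B (x1, x2) ^+ 2).
have bw : bmf w := bmf_Ex2 P1 P2 bB2.
pose u x1 := Ex P2 (fun x2 => F (x1, x2) ^+ 2).
have bu : bmf u := bmf_Ex1 P1 P2 bF2.
have w0 x : 0 <= w x by apply: Ex_ge0 => y; exact: sqr_ge0.
have u0 x : 0 <= u x by apply: Ex_ge0 => y; exact: sqr_ge0.
apply: (@le_trans _ _ (Ex P2 (fun x2 => w x2 ^+ 2))).
  apply: le_Ex; [exact/bmf_integrable/(bmf_Ex2 P1 P2 bA4)|exact/bmf_integrable/bmfX|].
  by move=> x2; exact: (h1 (fun x1 => B (x1, x2)) (bmf_pair2 x2 bB)).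
have -> : Ex (P1 \x P2)%E (fun x => F x ^+ 2) = Ex P1 u by exact: Ex_prod1.
set W := Ex P2 _; set U := Ex P1 u.
have W0 : 0 <= W by apply: Ex_ge0 => x; exact: sqr_ge0.
have U0 : 0 <= U by exact: Ex_ge0.
pose sW := Num.sqrt W; have sW0 : 0 <= sW by exact: sqrtr_ge0.
have sW2 : sW ^+ 2 = W by rewrite sqr_sqrtr.
have bwB : bmf (fun p : T1 * T2 => w p.2 * B p ^+ 2).
  by apply: bmfM => //; exact: (bmf_comp bw).
have key x1 : Ex P2 (fun x2 => w x2 * B (x1, x2) ^+ 2) <= sW * u x1.
  have b1 : bmf (fun x2 => B (x1, x2)) by exact: (bmf_pair1 x1 bB).
  have b2 := bmfX 2 b1.
  have E0 : 0 <= Ex P2 (fun x2 => w x2 * B (x1, x2) ^+ 2).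
    by apply: Ex_ge0 => x2; rewrite mulr_ge0// sqr_ge0.
  rewrite -(@ler_pXn2r _ 2)// ?nnegrE ?mulr_ge0//.
  apply: (le_trans (Ex_cauchy_schwarzM P2 bw b2)).
  rewrite exprMn sW2; apply: ler_wpM2l => //.
  apply: le_trans (h2 (fun x2 => F (x1, x2)) (bmf_pair1 x1 bF)).
  by apply: eq_ler; apply: eq_Ex => x2; rewrite -exprM.
(* One factor of [w ^ 2] is expanded and the integrals exchanged, so that [key] applies for each
   [x1]. *)
have : W <= sW * U.
  apply: (@le_trans _ _ (Ex P1 (fun x1 => Ex P2 (fun x2 => w x2 * B (x1, x2) ^+ 2)))).
    apply: eq_ler; apply: esym; apply: (etrans (Ex_swap P1 P2 bwB)).
    apply: eq_Ex => x2; rewrite expr2.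
    exact: (ExZ (w x2) (bmf_integrable P1 (bmf_pair2 x2 bB2))).
  apply: (le_trans (le_Ex _ _ key)).
  - exact: bmf_integrable (bmf_Ex1 P1 P2 bwB).
  - exact: bmf_integrable (bmfM (@bmf_cst _ _ R sW) bu).
  - exact: eq_ler (ExZ _ (bmf_integrable _ bu)).
rewrite -{1}sW2 expr2 => h.
have [s0|s0] := eqVneq sW 0; first by rewrite -sW2 s0 expr0n /= sqr_ge0.
rewrite -sW2 ler_pXn2r// ?nnegrE//.
by rewrite ler_pM2l// lt_neqAle eq_sym s0 in h.
Qed.

End tensorization.

(** * Bounded functions under a change of density *)

Section density.
Context d (T : measurableType d) (R : realType) (P : probability T R).
Variables (phi : T -> T) (g : T -> R).
Hypotheses (mphi : measurable_fun setT phi) (mg : measurable_fun setT g)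
  (g0 : forall x, 0 <= g x).
Hypothesis phig : forall F : T -> \bar R, measurable_fun setT F ->
  (forall x, 0 <= F x)%E ->
  (\int[P]_x F (phi x) = \int[P]_x (F x * (g x)%:E))%E.

Lemma density_intg : intg P g.
Proof.
apply/integrableP; split; first exact/measurable_EFinP.
have := phig (F := cst 1%E).
rewrite (integral_cst P measurableT) mul1e => /(_ (measurable_cst _) (fun=> lee01)) h.
rewrite (eq_integral (fun x => 1%E * (g x)%:E)%E) => [|x _].
  rewrite -h; apply: (le_lt_trans (probability_le1 P measurableT)).
  exact: ltry.
by rewrite mul1e /= ger0_norm.
Qed.

Lemma density_Ex1 : Ex P g = 1.
Proof.
have := phig (F := cst 1%E).
rewrite (integral_cst P measurableT) mul1e => /(_ (measurable_cst _) (fun=> lee01)) h.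
rewrite -[RHS](_ : fine (P setT) = 1); last by rewrite (_ : P setT = 1%E)//; exact: probability_setT.
by congr fine; rewrite h; apply: eq_integral => x _; rewrite mul1e.
Qed.

Lemma density_intgM F : bmf F -> intg P (fun x => F x * g x).
Proof.
move=> bF; have mF := bmf_meas bF; have [M hM] := bmf_bound bF.
apply: (@intg_dom _ _ _ P _ (fun x => M * g x)).
- exact: measurable_funM.
- exact/intgZ/density_intg.
- by move=> x; rewrite normrM (ger0_norm (g0 x)) ler_wpM2r.
Qed.

(** The hypothesis only covers nonnegative functions; adding a bound [M] of [F] reduces to them,
    since the density has total mass 1. *)
Lemma density_Ex F : bmf F -> Ex P (fun x => F (phi x)) = Ex P (fun x => F x * g x).
Proof.
move=> bF; have mF := bmf_meas bF; have [M hM] := bmf_bound bF.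
have ig := density_intg.
have bFM : bmf (fun x => F x + M) := bmfD bF (@bmf_cst _ _ _ M).
have bFp : bmf (fun x => F (phi x)) := bmf_comp bF mphi.
have : Ex P (fun x => F (phi x) + M) = Ex P (fun x => (F x + M) * g x).
  congr fine.
  apply: (etrans (@phig (fun x => (F x + M)%:E) _ _)).
  - by apply/measurable_EFinP; exact: bmf_meas.
  - by move=> x; rewrite lee_fin -lerBlDr sub0r; have := hM x; rewrite ler_norml => /andP[].
  - by apply: eq_integral => x _; rewrite EFinM.
rewrite (ExD (bmf_integrable P bFp) (bmf_integrable P (@bmf_cst _ _ _ M))) Ex_cst.
have -> : Ex P (fun x => (F x + M) * g x) = Ex P (fun x => F x * g x + M * g x).
  by apply: eq_Ex => x; rewrite mulrDl.
rewrite (ExD (density_intgM bF) (intgZ M ig)) (ExZ M ig) density_Ex1 mulr1.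
exact: addIr.
Qed.

End density.

(** Here [A] is the squared mean of a function, [N] its variance, and [k2], [k4] are moments of its
    centered part after noise. *)
Lemma hc_arith (R : realFieldType) (A N k2 k4 : R) :
  0 <= A -> 0 <= N -> k2 <= N / 4 -> k4 <= N ^+ 2 / 16 ->
  A ^+ 2 + (8 * A * k2 + 3 * k4) <= (A + N) ^+ 2.
Proof.
move=> A0 N0 h2 h4; have h : A * k2 <= A * (N / 4) by exact: ler_wpM2l.
have N2 := sqr_ge0 N; nra.
Qed.

(** * Hypercontractivity on the line *)

Section hypercontractivity.
Context {R : realType}.
Local Notation T := (measurableTypeR R).
Local Notation mu := (@std_gauss R).

Lemma measurable_lin2 (a b : R) : measurable_fun setT (fun p : T * T => a * p.1 + b * p.2 : T).
Proof. by apply: measurable_funD; exact: measurable_funM. Qed.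

Lemma cm_intg (w : R) : intg mu (cm_dens w : T -> R).
Proof.
apply: (@density_intg _ T R mu (fun x => x + w)).
- exact: measurable_cm_dens.
- by move=> x; exact: expR_ge0.
- exact: std_gauss_shift.
Qed.

Lemma cm_Ex (w : R) : Ex mu (cm_dens w : T -> R) = 1.
Proof.
apply: (@density_Ex1 _ T R mu (fun x => x + w)).
exact: std_gauss_shift.
Qed.

Lemma cm_sqr (w x : R) : (cm_dens w x - 1) ^+ 2 =
  (expR (w ^+ 2) * cm_dens (2 * w) x - 2 * cm_dens w x) + 1.
Proof.
have <- : cm_dens w x ^+ 2 = expR (w ^+ 2) * cm_dens (2 * w) x.
  by rewrite /cm_dens -expRM_natl -expRD; congr expR; field.
by ring.
Qed.

Lemma cm_sqr_intg (w : R) : intg mu (fun x : T => (cm_dens w x - 1) ^+ 2).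
Proof.
have -> : (fun x : T => (cm_dens w x - 1) ^+ 2) =
    (fun x : T => (expR (w ^+ 2) * cm_dens (2 * w) x + (- 2) * cm_dens w x) + 1).
  by apply/funext => x; rewrite cm_sqr mulNr.
apply: intgD; last exact/bmf_integrable/bmf_cst.
by apply: intgD; apply: intgZ; exact: cm_intg.
Qed.

(** The chi-square divergence of the shifted Gaussian from the standard one. *)
Lemma cm_sqr_Ex (w : R) :
  Ex mu (fun x : T => (cm_dens w x - 1) ^+ 2) = expR (w ^+ 2) - 1.
Proof.
transitivity (Ex mu (fun x : T => (expR (w ^+ 2) * cm_dens (2 * w) x + (- 2) * cm_dens w x) + 1)).
  by apply: eq_Ex => x; rewrite cm_sqr mulNr.
have i1 := intgZ (expR (w ^+ 2)) (cm_intg (2 * w)).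
have i2 := intgZ (- 2) (cm_intg w).
rewrite (ExD (intgD i1 i2) (bmf_integrable _ (@bmf_cst _ T R 1))).
rewrite (ExD i1 i2) (ExZ _ (cm_intg _)) (ExZ _ (cm_intg _)) !cm_Ex Ex_cst.
by ring.
Qed.

Lemma exp_sqr_ge1 (c x : R) : 0 <= c -> 1 <= expR (c * x ^+ 2 / 2).
Proof.
move=> c0; rewrite -expR0 ler_expR; apply: divr_ge0 => //.
by apply: mulr_ge0 => //; exact: sqr_ge0.
Qed.

Lemma exp_sqr_Ex (b : R) : 0 <= b < 1 ->
  intg mu (fun x : T => expR (b * x ^+ 2 / 2)) /\
  Ex mu (fun x : T => expR (b * x ^+ 2 / 2)) <= (1 - b)^-1.
Proof.
move=> hb; have h := std_gauss_exp_sqr hb.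
have me : measurable_fun setT (fun x : T => expR (b * x ^+ 2 / 2)).
  by apply: measurableT_comp => //; apply: measurable_funM => //; apply: measurable_funM.
have ie : intg mu (fun x : T => expR (b * x ^+ 2 / 2)).
  apply/integrableP; split; first exact/measurable_EFinP.
  apply: le_lt_trans (ltry (1 - b)^-1).
  apply: le_trans h; rewrite le_eqVlt; apply/orP; left; apply/eqP.
  by apply: eq_integral => x _; rewrite /= ger0_norm// expR_ge0.
split=> //; rewrite -lee_fin fineK//.
exact: integrable_fin_num.
Qed.

(* The noise must dominate: the ratio 20 makes the fourth moment bound [q_sqr]
   small enough for [hc_arith]. *)
Definition hc_r : R := (Num.sqrt (20 ^+ 2 + 1))^-1.

Let r := hc_r.
Let s := 20 * r.

Lemma hc_r_gt0 : 0 < hc_r.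
Proof. by rewrite invr_gt0 sqrtr_gt0 ltr_wpDl// sqr_ge0. Qed.

Lemma hc_r_sqr : hc_r ^+ 2 + (20 * hc_r) ^+ 2 = 1.
Proof.
have h : 0 < 20 ^+ 2 + 1 :> R by rewrite ltr_wpDl// sqr_ge0.
have e : hc_r ^+ 2 = (20 ^+ 2 + 1)^-1 by rewrite exprVn sqr_sqrtr// ltW.
by rewrite exprMn -[X in X + _]mul1r -mulrDl e [1 + _]addrC mulfV// gt_eqF.
Qed.

Let rs : r ^+ 2 + s ^+ 2 = 1.
Proof. exact: hc_r_sqr. Qed.

Let K (g : T -> R) (x : T) := Ex mu (fun z : T => g (r * x + s * z)).

Let bmfK (g : T -> R) : bmf g -> bmf (K g).
Proof.
move=> bg.
exact: (@bmf_Ex1 _ _ _ _ _ mu mu _ (bmf_comp bg (measurable_lin2 r s))).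
Qed.

Let bmf_lin (g : T -> R) x : bmf g -> bmf (fun z : T => g (r * x + s * z)).
Proof.
by move=> bg; apply: (bmf_comp bg); apply: measurable_funD.
Qed.

Let ExK (g : T -> R) : bmf g -> Ex mu (K g) = Ex mu g.
Proof.
move=> bg.
have bg1 : bmf (fun p : T * T => g p.1) by exact: (bmf_comp bg).
have bgl : bmf (fun p : T * T => g (r * p.1 + s * p.2)).
  exact: (bmf_comp bg (measurable_lin2 r s)).
apply: (etrans (esym (Ex_prod1 mu mu bgl))).
apply: (etrans (mpres_Ex (std_gauss_refl rs) (bmf_meas bg1))).
apply: (etrans (Ex_prod1 mu mu bg1)).
by apply: eq_Ex => x; exact: (Ex_cst mu (g x)).
Qed.

(* Cameron-Martin: moving the base point from [y] to [x] amounts to inserting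
   the density of a shift by [(x - y) / 20]. *)
Let K_diff (g : T -> R) x y : bmf g ->
  (K g x - K g y) ^+ 2 <= K (fun u => g u ^+ 2) y * (expR (((x - y) / 20) ^+ 2) - 1).
Proof.
move=> bg; pose w := (x - y) / 20.
pose h (z : T) := g (r * y + s * z).
have bh : bmf h by exact: bmf_lin.
have E1 : K g x = Ex mu (fun z : T => h (z + w)).
  by apply: eq_Ex => z; rewrite /h; congr g; rewrite /w /s; field.
have ms : measurable_fun setT (fun z : T => z + w : T) by exact: measurable_funD.
have mc := @measurable_cm_dens R w.
have c0 x' : 0 <= cm_dens w x' by exact: expR_ge0.
have sh F := @std_gauss_shift R w F.
have E2 := density_Ex ms mc c0 sh bh.
have i1 := density_intgM mc c0 sh bh.
have i2 := bmf_integrable mu (bmfN bh).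
have E3 : K g x - K g y = Ex mu (fun z : T => h z * (cm_dens w z - 1)).
  rewrite E1 E2.
  transitivity (Ex mu (fun z : T => h z * cm_dens w z) - Ex mu h) => //.
  rewrite -(ExB i1 (bmf_integrable mu bh)).
  by apply: eq_Ex => z; rewrite mulrBr mulr1.
rewrite E3 -/w -cm_sqr_Ex; clear E1 E2 E3.
apply: Ex_cauchy_schwarz.
- have := intgD i1 i2; congr (_.-integrable _ _); apply/funext => z /=.
  by rewrite mulrBr mulr1.
- exact/bmf_integrable/bmfX.
- exact: cm_sqr_intg.
- by move=> z; exact: sqr_ge0.
- by move=> z; exact: sqr_ge0.
- by move=> z; rewrite exprMn.
Qed.

(** Since [(x - y) ^ 2 <= 2 x ^ 2 + 2 y ^ 2], the exponent in [K_diff] is at most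
    [(x ^ 2 + y ^ 2) / 200]; integrating the [y] part costs at most
    [(1 - 1 / 100)^-1 = 100 / 99]. *)
Let q (x : T) : R := 100 / 99 * expR (100^-1 * x ^+ 2 / 2) - 1.

Let q_ge0 x : 0 <= q x.
Proof.
have : 1 <= expR (100^-1 * (x : R) ^+ 2 / 2).
  by apply: exp_sqr_ge1.
by rewrite /q; lra.
Qed.

(** As [K g] has mean 0, [K g x] is the average over [y] of [K g x - K g y]; Cauchy-Schwarz in [y]
    then uses [K_diff]. *)
Let K_bound (g : T -> R) x : bmf g -> Ex mu g = 0 ->
  K g x ^+ 2 <= Ex mu (fun y => g y ^+ 2) * q x.
Proof.
move=> bg g0; have bK := bmfK bg; have bK2 := bmfK (bmfX 2 bg).
have b01 : 0 <= (100^-1 : R) < 1 by apply/andP; split; lra.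
have [ie he] := exp_sqr_Ex b01.
pose a := expR (100^-1 * (x : R) ^+ 2 / 2).
have a1 : 1 <= a by apply: exp_sqr_ge1.
pose p (y : T) := a * expR (100^-1 * y ^+ 2 / 2) - 1.
have ip : intg mu p.
  by apply: intgD; [exact: intgZ|exact/bmf_integrable/bmf_cst].
have -> : K g x = Ex mu (fun y => K g x - K g y).
  rewrite ExB; [|exact/bmf_integrable/bmf_cst|exact: bmf_integrable].
  by rewrite Ex_cst ExK// g0 subr0.
apply: (@le_trans _ _ (Ex mu (K (fun u => g u ^+ 2)) * Ex mu p)).
  apply: Ex_cauchy_schwarz => //.
  - by apply/bmf_integrable/bmfB => //; exact: bmf_cst.
  - exact: bmf_integrable.
  - by move=> y; apply: Ex_ge0 => z; exact: sqr_ge0.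
  - move=> y; rewrite /p; have : 1 <= expR (100^-1 * (y : R) ^+ 2 / 2).
      by apply: exp_sqr_ge1.
    by nra.
  move=> y; apply: (le_trans (K_diff x y bg)); apply: ler_wpM2l.
    by apply: Ex_ge0 => z; exact: sqr_ge0.
  rewrite /p /a lerD2r -expRD ler_expR -subr_ge0.
  have -> : 100^-1 * (x : R) ^+ 2 / 2 + 100^-1 * (y : R) ^+ 2 / 2 - ((x - y) / 20) ^+ 2
    = ((x + y) / 20) ^+ 2 by field.
  exact: sqr_ge0.
rewrite (ExK (bmfX 2 bg)); apply: ler_wpM2l.
  by apply: Ex_ge0 => z; exact: sqr_ge0.
rewrite ExB; [|exact: intgZ|exact/bmf_integrable/bmf_cst].
rewrite Ex_cst (ExZ _ ie) /q -/a lerD2r mulrC ler_wpM2r//; first by lra.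
by apply: (le_trans he); rewrite le_eqVlt; apply/orP; left; apply/eqP; field.
Qed.

Let q_sqr : Ex mu (fun x => q x ^+ 2) <= 16^-1 /\ intg mu (fun x => q x ^+ 2).
Proof.
have b01 : 0 <= (50^-1 : R) < 1 by apply/andP; split; lra.
have [ie he] := exp_sqr_Ex b01.
(* [(u - 1) ^ 2 <= u ^ 2 - 1] for [u >= 1], with [u = q x + 1]; the mean of [u ^ 2] is at most
   [(100 / 99) ^ 2 * 50 / 49], below [17 / 16]. *)
pose p (y : T) : R := (100 / 99) ^+ 2 * expR (50^-1 * y ^+ 2 / 2) - 1.
have ip : intg mu p.
  by apply: intgD; [exact: intgZ|exact/bmf_integrable/bmf_cst].
have qp x : q x ^+ 2 <= p x.
  rewrite /q /p; have -> : expR (50^-1 * (x : R) ^+ 2 / 2) =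
      expR (100^-1 * (x : R) ^+ 2 / 2) ^+ 2.
    by rewrite -expRM_natl; congr expR; field.
  have : 1 <= expR (100^-1 * (x : R) ^+ 2 / 2).
    by apply: exp_sqr_ge1.
  by rewrite -exprMn => ?; nra.
have mq : measurable_fun setT (fun x => q x ^+ 2).
  apply: measurable_funX; apply: measurable_funB => //; apply: measurable_funM => //.
  by apply: measurableT_comp => //; apply: measurable_funM => //; apply: measurable_funM.
have iq : intg mu (fun x => q x ^+ 2).
  apply: (intg_dom mq ip) => x; rewrite ger0_norm ?sqr_ge0//.
split=> //; apply: (le_trans (le_Ex iq ip qp)).
rewrite ExB; [|exact: intgZ|exact/bmf_integrable/bmf_cst].
rewrite Ex_cst (ExZ _ ie).
have e : (1 - 50^-1 : R)^-1 = 50 / 49 by field.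
rewrite e in he; nra.
Qed.

(** Write [F = a + g] with [g] centered. The strong noise shrinks [g] so much that crude constants
    in the expansion of the fourth power are affordable. *)
Lemma std_gauss_hyper :
  hyper mu mu (fun p : T * T => hc_r * p.1 + 20 * hc_r * p.2).
Proof.
move=> F bF; pose a := Ex mu F; pose g x := F x - a.
have bg : bmf g by apply: bmfB => //; exact: bmf_cst.
have g0 : Ex mu g = 0.
  rewrite ExB; [|exact: bmf_integrable|exact/bmf_integrable/bmf_cst].
  by rewrite Ex_cst subrr.
pose N := Ex mu (fun y => g y ^+ 2).
have N0 : 0 <= N by apply: Ex_ge0 => x; exact: sqr_ge0.
have bK := bmfK bg.
have EF x : Ex mu (fun z : T => F (r * x + s * z)) = a + K g x.
  rewrite /K /g ExB; [|exact/bmf_integrable/bmf_lin|exact/bmf_integrable/bmf_cst].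
  by rewrite Ex_cst subrKC.
have [hq iq] := q_sqr.
have K4 : Ex mu (fun x => K g x ^+ 4) <= N ^+ 2 / 16.
  apply: (@le_trans _ _ (Ex mu (fun x => N ^+ 2 * q x ^+ 2))).
    apply: le_Ex; [exact/bmf_integrable/bmfX|exact: intgZ|].
    move=> x; rewrite (exprM _ 2 2) -exprMn; apply: lerXn2r; last exact: K_bound.
      by rewrite nnegrE sqr_ge0.
    by rewrite nnegrE; apply: mulr_ge0.
  by rewrite (ExZ _ iq) ler_wpM2l// sqr_ge0.
have K2 : Ex mu (fun x => K g x ^+ 2) <= N / 4.
  rewrite -(@ler_pXn2r _ 2)// ?nnegrE; last 2 first.
  - by apply: Ex_ge0 => x; exact: sqr_ge0.
  - by rewrite divr_ge0.
  apply: (le_trans (Ex_sqr mu (bmfX 2 bK))).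
  have -> : (N / 4) ^+ 2 = N ^+ 2 / 16 by field.
  apply: le_trans K4; apply: eq_ler; apply: eq_Ex => x.
  by rewrite -exprM.
have EF2 : Ex mu (fun x => F x ^+ 2) = a ^+ 2 + N.
  have i1 : intg mu (fun x => 2 * a * g x) by apply: intgZ; exact: bmf_integrable.
  have i2 : intg mu (fun x => a ^+ 2 + 2 * a * g x).
    by apply: intgD => //; exact/bmf_integrable/bmf_cst.
  transitivity (Ex mu (fun x => (a ^+ 2 + 2 * a * g x) + g x ^+ 2)).
    by apply: eq_Ex => x; rewrite /g; ring.
  rewrite (ExD i2); last exact/bmf_integrable/bmfX.
  rewrite ExD//; last exact/bmf_integrable/bmf_cst.
  rewrite Ex_cst (ExZ _ (bmf_integrable _ bg)) g0 mulr0 addr0.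
  by [].
rewrite {}EF2.
(* The cubic term is absorbed by [4 a u ^ 3 <= 2 a ^ 2 u ^ 2 + 2 u ^ 4]; the linear one has mean
   0. *)
apply: (@le_trans _ _ (Ex mu (fun x => (a ^+ 4 + 4 * a ^+ 3 * K g x) +
    (8 * a ^+ 2 * K g x ^+ 2 + 3 * K g x ^+ 4)))).
  have bc c := @bmf_cst _ T R c.
  have bK2 := bmfX 2 bK; have bK4 := bmfX 4 bK.
  apply: le_Ex.
  - have := bmfX 4 (bmfD (bc a) bK); move/(bmf_integrable mu).
    by congr (_.-integrable _ _); apply/funext => x /=; rewrite -EF.
  - apply/bmf_integrable/bmfD; apply: bmfD => //; exact: bmfM.
  move=> x /=; rewrite -/r -/s EF -subr_ge0.
  set u := K g x.
  have -> : a ^+ 4 + 4 * a ^+ 3 * u + (8 * a ^+ 2 * u ^+ 2 + 3 * u ^+ 4) - (a + u) ^+ 4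
    = 2 * (u * (a - u)) ^+ 2 by ring.
  by rewrite mulr_ge0// sqr_ge0.
have i1 : intg mu (fun x => 4 * a ^+ 3 * K g x) by apply: intgZ; exact: bmf_integrable.
have i2 : intg mu (fun x => 8 * a ^+ 2 * K g x ^+ 2).
  by apply: intgZ; exact/bmf_integrable/bmfX.
have i3 : intg mu (fun x => 3 * K g x ^+ 4) by apply: intgZ; exact/bmf_integrable/bmfX.
have ic : intg mu (fun x : T => a ^+ 4) by exact/bmf_integrable/bmf_cst.
rewrite (ExD (intgD ic i1) (intgD i2 i3)) (ExD ic i1) (ExD i2 i3) Ex_cst.
rewrite (ExZ _ (bmf_integrable _ bK)) (ExZ _ (bmf_integrable _ (bmfX 2 bK))).
rewrite (ExZ _ (bmf_integrable _ (bmfX 4 bK))) (ExK bg) g0 mulr0 addr0.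
set k2 := Ex mu _ in K2 *; set k4 := Ex mu _ in K4 *.
have a2 : 0 <= a ^+ 2 by exact: sqr_ge0.
have e4 : a ^+ 4 = (a ^+ 2) ^+ 2 by rewrite -exprM.
rewrite e4; exact: hc_arith.
Qed.

End hypercontractivity.

Lemma hyper_conj (R : realType) d1 d2 d3 d4 (T1 : measurableType d1)
    (T2 : measurableType d2) (U1 : measurableType d3) (U2 : measurableType d4)
    (P1 : probability T1 R) (P2 : probability T2 R)
    (Q1 : probability U1 R) (Q2 : probability U2 R)
    (h : T1 -> T2) (k : U1 -> U2) (m1 : T1 * U1 -> T1) (m2 : T2 * U2 -> T2) :
  mpres P1 P2 h -> mpres Q1 Q2 k -> measurable_fun setT m2 ->
  (forall x z, m2 (h x, k z) = h (m1 (x, z))) ->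
  hyper P1 Q1 m1 -> hyper P2 Q2 m2.
Proof.
move=> ph pk mm2 hm H F bF.
have [mh _] := ph; have [mk _] := pk.
have bG : bmf (fun x => Ex Q2 (fun z => F (m2 (x, z)))).
  exact: (@bmf_Ex1 _ _ _ _ _ P2 Q2 _ (bmf_comp bF mm2)).
apply: (le_trans (eq_ler (esym (mpres_Ex ph (bmf_meas (bmfX 4 bG)))))).
have -> : Ex P2 (fun x => F x ^+ 2) = Ex P1 (fun x => F (h x) ^+ 2).
  exact: (esym (mpres_Ex ph (bmf_meas (bmfX 2 bF)))).
apply: le_trans (H (fun x => F (h x)) (bmf_comp bF mh)).
apply: eq_ler; apply: eq_Ex => x; congr (_ ^+ 4).
have bz : bmf (fun z => F (m2 (h x, z))).
  by apply: (bmf_comp bF); apply: (measurableT_comp mm2); exact: measurable_fun_pair.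
apply: (etrans (esym (mpres_Ex pk (bmf_meas bz)))).
by apply: eq_Ex => z; rewrite hm.
Qed.

(** * Hypercontractivity in dimension [n] and its consequence for influences *)

Section gauss_hypercontractivity.
Context {R : realType}.
Local Notation T := (measurableTypeR R).
Local Notation mu := (@std_gauss R).
Local Notation V n := (n.-tuple (measurableTypeR R)).
Local Notation r := (@hc_r R).
Local Notation s := (20 * @hc_r R).

Lemma gauss_hyper n :
  hyper (gauss n) (gauss n) (fun p : V n * V n => mix (fun=> r) (fun=> s) p.1 p.2).
Proof.
elim: n => [|n IH].
  move=> F bF; pose c := F [tuple].
  have F1 x : F x = c by rewrite /c; congr F; exact: tuple0.
  have -> : Ex (gauss 0) (fun x => F x ^+ 2) = c ^+ 2.
    by apply: etrans (Ex_cst (gauss 0) (c ^+ 2)); apply: eq_Ex => x; rewrite F1.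
  apply: eq_ler; rewrite -exprM; apply: etrans (Ex_cst (gauss 0) (c ^+ 4)).
  apply: eq_Ex => x; congr (_ ^+ 4); apply: etrans (Ex_cst (gauss 0) c).
  by apply: eq_Ex => z; exact: F1.
have H := hyper_prod (measurable_lin2 r s)
  (measurable_mix (fun=> r) (fun=> s) measurable_fst measurable_snd)
  (@std_gauss_hyper R) IH.
apply: (hyper_conj (mpres_cons n) (mpres_cons n) _ _ H).
  by apply: measurable_mix.
by move=> x z; rewrite /= mix_cons.
Qed.

Lemma corr_hc n : corr (fun _ : 'I_n => r).
Proof.
move=> i; rewrite ltW ?hc_r_gt0//= -(@expr_le1 _ 2)// ?ltW ?hc_r_gt0//.
have := @hc_r_sqr R; have := sqr_ge0 s; lra.
Qed.

Lemma compl_hc n : compl (fun _ : 'I_n => r) = fun=> s.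
Proof.
apply/funext => i; rewrite /compl.
have -> : 1 - r ^+ 2 = s ^+ 2 by have := @hc_r_sqr R; lra.
rewrite sqrtr_sqr ger0_norm//; apply: mulr_ge0; first exact: ler0n.
exact/ltW/hc_r_gt0.
Qed.

Lemma noise_hyper n (F : V n -> R) : bmf F ->
  Ex (gauss n) (fun x => noise (fun=> r) F x ^+ 4) <=
  Ex (gauss n) (fun x => F x ^+ 2) ^+ 2.
Proof. by move=> bF; rewrite /noise compl_hc; exact: gauss_hyper. Qed.

(* For [H = noise (noise g)], Cauchy-Schwarz applied twice to [<g, H>] gives
   [<g, H>^4 <= |g|_1^3 |H|_4^4], and [|H|_4^2 <= |noise g|_2^2 = <g, H>]. *)
Lemma noise_L1 n (g : V n -> R) : bmf g -> (forall x, `|g x| <= 1) ->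
  Ex (gauss n) (fun x => noise (fun=> r) g x ^+ 2) ^+ 2 <=
  Ex (gauss n) (fun x => `|g x|) ^+ 3.
Proof.
move=> bg g1; set G := gauss n.
pose c := fun _ : 'I_n => r; have cc : corr c by exact: corr_hc.
pose h := noise c g; have bh : bmf h by exact: bmf_noise.
pose H := noise c h; have bH : bmf H by exact: bmf_noise.
rewrite -/c -/h; set W := Ex G _; set A := Ex G _.
have ba := bmf_norm bg.
have W0 : 0 <= W by apply: Ex_ge0 => x; exact: sqr_ge0.
have A0 : 0 <= A by exact: Ex_ge0.
have H4 : Ex G (fun x => H x ^+ 4) <= W ^+ 2 by exact: noise_hyper.
pose B := Ex G (fun x => `|g x| * H x ^+ 2).
have B0 : 0 <= B by apply: Ex_ge0 => x; rewrite mulr_ge0// sqr_ge0.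
have WB : W ^+ 2 <= A * B.
  have -> : W = Ex G (fun x => g x * H x) by exact: (esym (noise_sym cc bg bh)).
  apply: Ex_cauchy_schwarz => //.
  - exact/bmf_integrable/bmfM.
  - exact: bmf_integrable.
  - by apply/bmf_integrable/bmfM => //; exact: bmfX.
  - by move=> x; rewrite mulr_ge0// sqr_ge0.
  - by move=> x; rewrite exprMn [leRHS]mulrA -expr2 real_normK// num_real.
have BA : B ^+ 2 <= A * W ^+ 2.
  apply: (le_trans (Ex_cauchy_schwarzM G ba (bmfX 2 bH))).
  apply: ler_pM; [by apply: Ex_ge0 => x; exact: sqr_ge0| | |].
  - by apply: Ex_ge0 => x; exact: sqr_ge0.
  - apply: le_Ex; [exact/bmf_integrable/bmfX|exact: bmf_integrable|].
    by move=> x; rewrite expr2 ler_piMr.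
  - by apply: le_trans H4; apply: eq_ler; apply: eq_Ex => x; rewrite -exprM.
clear H4; clearbody W A B.
have [->|Wn0] := eqVneq W 0; first by rewrite expr0n exprn_ge0.
have Wp : 0 < W ^+ 2 by rewrite exprn_gt0// lt_neqAle eq_sym Wn0.
rewrite -(ler_pM2r Wp) -expr2.
apply: (@le_trans _ _ ((A * B) ^+ 2)).
  by apply: lerXn2r => //; rewrite nnegrE; [exact: sqr_ge0|exact: mulr_ge0].
rewrite exprMn (_ : A ^+ 3 * W ^+ 2 = A ^+ 2 * (A * W ^+ 2)); last by ring.
by apply: ler_wpM2l => //; exact: exprn_ge0.
Qed.

(** Each difference [D] is bounded by 1 with [L^1] norm at most [del], so [noise_L1] bounds its
    Efron-Stein term by [del ^ (3 / 2)]. *)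
Lemma noise_kkl n (F : V n -> R) (del : R) : bmf F -> (forall x, 0 <= F x <= 1) ->
  0 <= del ->
  (forall k : 'I_n, rotdist F (fun i => if i == k then pi / 2 else 0) <= del) ->
  Ex (gauss n) (fun x => F x * noise (fun=> r ^+ 2) F x) - Ex (gauss n) F ^+ 2 <=
  n%:R * (del * Num.sqrt del).
Proof.
move=> bF F01 del0 hdel.
have r01 : 0 <= r <= 1 by exact: (corr_hc (n := 1) ord0).
apply: (le_trans (noise_efron_stein r01 bF)).
apply: (@le_trans _ _ (\sum_(k < n) (del * Num.sqrt del))); last first.
  by rewrite sumr_const card_ord -[leLHS]mulr_natl.
apply: ler_sum => k _.
pose D y := F y - noise (erase k) F y; rewrite -/D.
have bD : bmf D by apply: bmfB => //; exact: bmf_noise.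
have D1 x : `|D x| <= 1.
  have /andP[f0 f1] := F01 x.
  have e0 : 0 <= noise (erase k) F x.
    by apply: Ex_ge0 => z; have /andP[] := F01 (mix (erase k) (compl (erase k)) x z).
  have e1 : noise (erase k) F x <= 1.
    apply: Ex_le_cst; first exact: bmf_mix_l.
    by move=> z; have /andP[] := F01 (mix (erase k) (compl (erase k)) x z).
  by rewrite /D ler_norml; apply/andP; split; lra.
have h1 := noise_L1 bD D1.
have h2 : Ex (gauss n) (fun x => `|D x|) <= del by apply: le_trans (hdel k); exact: erase_rotdist.
have h0 : 0 <= Ex (gauss n) (fun x => `|D x|) by exact: Ex_ge0.
have w0 : 0 <= Ex (gauss n) (fun x => noise (fun=> r) D x ^+ 2).
  by apply: Ex_ge0 => x; exact: sqr_ge0.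
move: h1 h2 h0 w0; move: (Ex _ _) => W; move: (Ex _ _) => A h1 h2 h0 w0.
rewrite -(@ler_pXn2r _ 2)// ?nnegrE//; last by rewrite mulr_ge0// sqrtr_ge0.
apply: (le_trans h1); rewrite exprMn sqr_sqrtr// -exprSr.
by rewrite lerXn2r// nnegrE.
Qed.

End gauss_hypercontractivity.

(** * Smoothing and the boundary *)

Section taylor.
Context {R : realType} {n : nat}.
Local Notation T := (measurableTypeR R).
Local Notation mu := (@std_gauss R).
Local Notation V := (n.-tuple (measurableTypeR R)).
Local Notation G := (@gauss R n).
Implicit Types (F : V -> R) (v w : 'I_n -> R).

Lemma edom_ge1 (z : V) : 1 <= edom z.
Proof.
rewrite -expR0 ler_expR sumr_ge0// => i _; apply: divr_ge0 => //.
exact: sqr_ge0.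
Qed.

Lemma sqr_le_edom (z : V) i : tnth z i ^+ 2 <= 4 * edom z.
Proof.
have h : tnth z i ^+ 2 / 4 <= \sum_(j < n) tnth z j ^+ 2 / 4.
  rewrite (bigD1 i)//= lerDl sumr_ge0// => j _; apply: divr_ge0 => //.
  exact: sqr_ge0.
have := expR_ge1Dx (\sum_(j < n) tnth z j ^+ 2 / 4); rewrite -/(edom z) => h2.
by lra.
Qed.

Lemma norm_le_edom (z : V) i : `|tnth z i| <= 2 * edom z.
Proof.
have := sqr_le_edom z i; have := edom_ge1 z.
rewrite -[tnth z i ^+ 2]real_normK ?num_real//; have := normr_ge0 (tnth z i).
by set a := `|_|; nra.
Qed.

Lemma edom_intg : intg G (@edom R n).
Proof.
apply/integrableP; split; first by apply/measurable_EFinP; exact: measurable_edom.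
apply: le_lt_trans (ltry (2 ^+ n)).
apply: le_trans (@gauss_edom R n); rewrite le_eqVlt; apply/orP; left; apply/eqP.
by apply: eq_integral => x _; rewrite /= ger0_norm// expR_ge0.
Qed.

Lemma edom_Ex : Ex G (@edom R n) <= 2 ^+ n.
Proof.
rewrite -lee_fin fineK; first exact: gauss_edom.
by apply: integrable_fin_num => //; exact: edom_intg.
Qed.

Lemma mpres_snd : mpres (G \x G)%E G snd.
Proof.
split=> // B mB; rewrite (_ : snd @^-1` B = setT `*` B).
  apply: (etrans (product_measure1E G G measurableT mB)).
  rewrite -[RHS]mul1e; congr (_ * _)%E; exact: probability_setT.
by apply/seteqP; split=> -[x y] //= [].
Qed.

Lemma mpres_tnth i : mpres G mu (fun z : V => tnth z i).
Proof.
split; first exact: measurable_tnth.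
move=> B mB; pose C j : set T := if j == i then B else setT.
rewrite (_ : (fun z : V => tnth z i) @^-1` B = [set x | forall j, C j (tnth x j)]).
  apply: (etrans (gauss_box _)); first by move=> j; rewrite /C; case: ifP.
  rewrite (bigD1 i)//= /C eqxx big1 ?mule1// => j /negbTE ->.
  exact: probability_setT.
apply/seteqP; split=> z /=; last by move=> /(_ i); rewrite /C eqxx.
by move=> Bz j; rewrite /C; case: eqP => // ->.
Qed.

(** From [|z| <= 1 + z ^ 2 / 4 <= expR (z ^ 2 / 4)], whose mean is at most 2. *)
Lemma Ex_norm_tnth i : Ex G (fun z : V => `|tnth z i|) <= 2.
Proof.
have mabs : measurable_fun setT (fun z : T => `|z| : R) by exact: measurableT_comp.
apply: (le_trans (eq_ler (mpres_Ex (mpres_tnth i) mabs))).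
have b01 : 0 <= (2^-1 : R) < 1 by apply/andP; split; lra.
have [ie he] := exp_sqr_Ex b01.
have e2 : (1 - 2^-1 : R)^-1 = 2 by field.
rewrite e2 in he; apply: le_trans he.
have zb (z : R) : `|z| <= expR (2^-1 * z ^+ 2 / 2).
  apply: le_trans (expR_ge1Dx _); rewrite -[z ^+ 2]real_normK ?num_real//.
  have := sqr_ge0 (`|z| - 2); set a := `|z|; have -> : (a - 2) ^+ 2 = a ^+ 2 - 4 * a + 4 by ring.
  by lra.
apply: le_Ex => //; apply: (intg_dom mabs ie) => z.
by rewrite normr_id.
Qed.

Lemma exp_taylor (t : R) : `|expR t - 1 - t| <= t ^+ 2 * expR `|t|.
Proof.
have key (u : R) : expR u * (1 - u) <= 1.
  have := expR_ge1Dx (- u); rewrite expRN => h.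
  have e0 := expR_gt0 u.
  by rewrite -ler_pdivlMl// mulr1; lra.
have l1 := expR_ge1Dx t.
have p0 : 0 <= expR t - 1 - t by lra.
rewrite (ger0_norm p0).
have [t0|t0] := leP 0 t.
  rewrite (ger0_norm t0); have := key t.
  by move: (expR t) (expR_gt0 t) l1 => e ? ? ?; nra.
have := expR_ge1Dx (- t); rewrite (ltr0_norm t0) expRN.
have e0 := expR_gt0 t; move: (expR t) e0 => e e0 h1.
have en0 : e != 0 by rewrite gt_eqF.
have ev : e * e^-1 = 1 by rewrite mulfV.
have h2 : e * (1 - t) <= e * e^-1 by rewrite ler_pM2l.
rewrite ev in h2.
have h3 : e <= 1 + t + t ^+ 2.
  rewrite -(@ler_pM2r _ (1 - t)); last lra.
  have ht : (1 + t + t ^+ 2) * (1 - t) = 1 + (- t) ^+ 3 by ring.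
  have tn : 0 <= - t by lra.
  by have := exprn_ge0 3 tn; lra.
have h4 : 1 <= e^-1 by lra.
have := sqr_ge0 t; nra.
Qed.

End taylor.

(** * Smoothings and their second-order expansion *)

Section gradient.
Context {R : realType} {n : nat}.
Local Notation T := (measurableTypeR R).
Local Notation mu := (@std_gauss R).
Local Notation V := (n.-tuple (measurableTypeR R)).
Local Notation G := (@gauss R n).
Implicit Types (F : V -> R) (v w : 'I_n -> R).

Lemma intgM_tnth F i : bmf F -> intg G (fun z => F z * tnth z i).
Proof.
move=> bF; have mF := bmf_meas bF; have [M hM] := bmf_bound bF.
apply: (@intg_dom _ _ _ G _ (fun z => M * (2 * edom z))).
- by apply: measurable_funM => //; exact: measurable_tnth.
- exact/intgZ/intgZ/edom_intg.
- by move=> z; rewrite normrM; apply: ler_pM => //; exact: norm_le_edom.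
Qed.

(* Second order expansion in [w] of the Cameron-Martin density. *)
Lemma cmv_taylor w (z : V) : \sum_(i < n) w i ^+ 2 <= 1 ->
  `|cmv w z - 1 - \sum_(i < n) w i * tnth z i| <=
  3 * expR (6 * n%:R) * (\sum_(i < n) w i ^+ 2) * edom z.
Proof.
set S := \sum_(i < n) w i ^+ 2 => S1.
have S0 : 0 <= S by apply: sumr_ge0 => i _; exact: sqr_ge0.
pose rr := Num.sqrt S; have rr0 : 0 <= rr by exact: sqrtr_ge0.
have rr2 : rr ^+ 2 = S by rewrite sqr_sqrtr.
have rr1 : rr <= 1 by rewrite -sqrtr1; exact: ler_wsqrtr.
have wr i : `|w i| <= rr.
  rewrite -sqrtr_sqr; apply: ler_wsqrtr.
  by rewrite /S (bigD1 i)//= lerDl sumr_ge0// => j _; exact: sqr_ge0.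
pose Y := \sum_(i < n) (`|tnth z i| + 1).
have Y0 : 0 <= Y by apply: sumr_ge0 => i _; apply: addr_ge0.
pose t := \sum_(i < n) (w i * tnth z i - w i ^+ 2 / 2).
have tE : t = \sum_(i < n) w i * tnth z i - S / 2.
  by rewrite /t sumrB -mulr_suml.
have tY : `|t| <= rr * Y.
  rewrite mulr_sumr; apply: (le_trans (ler_norm_sum _ _ _)); apply: ler_sum => i _.
  apply: (le_trans (ler_normB _ _)); rewrite mulrDr mulr1 normrM; apply: lerD.
    exact: ler_wpM2r.
  rewrite ger0_norm ?divr_ge0 ?sqr_ge0// -real_normK ?num_real//.
  by have := wr i; have := normr_ge0 (w i); nra.
(* Termwise [2 (a + 1) <= 6 + a ^ 2 / 4], which is [(a - 4) ^ 2 >= 0]; this is the source of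
   [6 * n]. *)
have e1 : expR Y ^+ 2 <= expR (6 * n%:R) * edom z.
  rewrite -expRM_natl /edom -expRD ler_expR.
  have -> : (6 * n%:R : R) = \sum_(i < n) 6 by rewrite sumr_const card_ord -[RHS]mulr_natr.
  rewrite -big_split /= mulr_sumr; apply: ler_sum => i _.
  rewrite -[tnth z i ^+ 2]real_normK ?num_real//; set a := `|_|.
  by have := sqr_ge0 (a - 4); nra.
have h1 : `|expR t - 1 - t| <= S * (2 * expR Y ^+ 2).
  apply: (le_trans (exp_taylor t)).
  have eY : expR `|t| <= expR Y.
    by rewrite ler_expR; apply: (le_trans tY); rewrite ler_piMl.
  have t2 : t ^+ 2 <= S * Y ^+ 2.
    rewrite -real_normK ?num_real// -rr2 -exprMn.
    by apply: lerXn2r => //; rewrite nnegrE ?mulr_ge0.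
  have Y2 : Y ^+ 2 <= 2 * expR Y.
    have := expR_ge1Dxn 1 Y0; rewrite (_ : (2`!)%N = 2%N) // => h.
    by have := expR_gt0 Y; lra.
  apply: (@le_trans _ _ (S * Y ^+ 2 * expR Y)).
    by apply: ler_pM => //; exact: sqr_ge0.
  rewrite -mulrA; apply: ler_wpM2l => //; rewrite expr2 mulrA.
  by apply: ler_wpM2r => //; exact: expR_ge0.
have -> : cmv w z - 1 - \sum_(i < n) w i * tnth z i = (expR t - 1 - t) - S / 2.
  by rewrite {2}tE /cmv -/t; ring.
apply: (le_trans (ler_normB _ _)); rewrite (ger0_norm (divr_ge0 S0 _))//.
have eY1 : 1 <= expR Y ^+ 2 by rewrite exprn_ege1// -expR0 ler_expR.
apply: (@le_trans _ _ (S * (3 * expR Y ^+ 2))); first by nra.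
have -> : 3 * expR (6 * n%:R) * S * edom z = S * (3 * (expR (6 * n%:R) * edom z)) by ring.
by apply: ler_wpM2l => //; apply: ler_wpM2l.
Qed.

Section smoothing.
Variables (c s : R) (F : V -> R).
Hypotheses (c0 : 0 < c) (s0 : 0 < s) (cs : c ^+ 2 + s ^+ 2 = 1).
Hypotheses (bF : bmf F) (F01 : forall x, 0 <= F x <= 1).

Definition smooth (x : V) := Ex G (fun z => F (mix (fun=> c) (fun=> s) x z)).

(* [grad i] is [s / c] times the [i]-th partial derivative of [smooth]. *)
Definition grad (i : 'I_n) (x : V) :=
  Ex G (fun z => F (mix (fun=> c) (fun=> s) x z) * tnth z i).

Lemma bmf_smooth : bmf smooth.
Proof. exact: (@bmf_Ex1 _ _ _ _ _ G G _ (bmf_mix (fun=> c) (fun=> s) bF)). Qed.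

Lemma smooth01 x : 0 <= smooth x <= 1.
Proof.
apply/andP; split.
  by apply: Ex_ge0 => z; have /andP[] := F01 (mix (fun=> c) (fun=> s) x z).
apply: Ex_le_cst; first exact: bmf_mix_l.
by move=> z; have /andP[] := F01 (mix (fun=> c) (fun=> s) x z).
Qed.

Lemma norm_grad i x : `|grad i x| <= 2.
Proof.
have i1 := intgM_tnth i (bmf_mix_l (fun=> c) (fun=> s) x bF).
have i2 : intg G (fun z : V => `|tnth z i|).
  have := intgM_tnth i (@bmf_cst _ V R 1) => /integrable_abse.
  by congr (_.-integrable _ _); apply/funext => z /=; rewrite mul1r.
apply: (le_trans (Ex_norm i1)); apply: le_trans (Ex_norm_tnth i).
apply: le_Ex => //.
  by have := integrable_abse i1; congr (_.-integrable _ _); apply/funext.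
move=> z; rewrite normrM ler_piMl//.
by have /andP[h1 h2] := F01 (mix (fun=> c) (fun=> s) x z); rewrite ger0_norm.
Qed.

Lemma bmf_grad i : bmf (grad i).
Proof.
apply: (@bmfI _ _ _ _ 2); last by move=> x; exact: norm_grad.
pose H (p : V * V) := F (mix (fun=> c) (fun=> s) p.1 p.2) * tnth p.2 i.
have [M hM] := bmf_bound bF.
have iH : intg (G \x G)%E H.
  apply: (@intg_dom _ _ _ (G \x G)%E _ (fun p => M * (2 * edom p.2))).
  - apply: measurable_funM; first exact: bmf_meas (bmf_mix (fun=> c) (fun=> s) bF).
    exact: measurable_tnth_comp.
  - apply/intgZ/intgZ; exact: (mpres_intg mpres_snd edom_intg).
  - by move=> p; rewrite normrM; apply: ler_pM => //; exact: norm_le_edom.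
apply/measurable_EFinP.
have -> : EFin \o grad i = fubini_F G (EFin \o H).
  apply/funext => x; rewrite /= fineK//; apply: integrable_fin_num => //.
  exact: (intgM_tnth i (bmf_mix_l (fun=> c) (fun=> s) x bF)).
exact: (measurable_fubini_F iH).
Qed.

(** This is where the derivative is moved from [F] to the Gaussian density: a shift of [x] becomes a
    shift of the noise. *)
Lemma smooth_shift v x : smooth (shiftv v x) =
  Ex G (fun z => F (mix (fun=> c) (fun=> s) x (shiftv (fun i => c / s * v i) z))).
Proof.
apply: eq_Ex => z; congr F; apply: eq_from_tnth => i.
by rewrite !tnth_mix !tnth_mktuple; field; rewrite gt_eqF.
Qed.

(** The terms [1 + 2 n] serve large shifts; the last one is the Cameron-Martin remainder times the
    bound [2 ^ n] on the mean of [edom]. *)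
Definition taylor_cst : R := 1 + 2 * n%:R + 3 * expR (6 * n%:R) * 2 ^+ n.

Lemma taylor_cst_ge0 : 0 <= taylor_cst.
Proof.
rewrite /taylor_cst; apply: addr_ge0; first by apply: addr_ge0 => //; exact: mulr_ge0.
by apply: mulr_ge0; [apply: mulr_ge0 => //; exact: expR_ge0|exact: exprn_ge0].
Qed.

Lemma smooth_taylor v x :
  `|smooth (shiftv v x) - smooth x - c / s * \sum_(i < n) v i * grad i x| <=
  taylor_cst * ((c / s) ^+ 2 * \sum_(i < n) v i ^+ 2).
Proof.
pose w i := c / s * v i.
have -> : (c / s) ^+ 2 * \sum_(i < n) v i ^+ 2 = \sum_(i < n) w i ^+ 2.
  by rewrite mulr_sumr; apply: eq_bigr => i _; rewrite /w [RHS]exprMn.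
have -> : c / s * \sum_(i < n) v i * grad i x = \sum_(i < n) w i * grad i x.
  by rewrite mulr_sumr; apply: eq_bigr => i _; rewrite mulrA.
rewrite smooth_shift -/w; set S := \sum_(i < n) w i ^+ 2.
have S0 : 0 <= S by apply: sumr_ge0 => i _; exact: sqr_ge0.
pose H z := F (mix (fun=> c) (fun=> s) x z).
have bH : bmf H by exact: bmf_mix_l.
have H01 z : 0 <= H z <= 1 by exact: F01.
have ig i : intg G (fun z => w i * (H z * tnth z i)) by exact/intgZ/intgM_tnth.
have ms := measurable_shiftv w.
have bHs := bmf_comp bH ms.
have n2 : 0 <= 2 * n%:R :> R by exact: mulr_ge0.
have e2 : 0 <= 3 * expR (6 * n%:R) * 2 ^+ n :> R.
  by apply: mulr_ge0; [apply: mulr_ge0 => //; exact: expR_ge0|exact: exprn_ge0].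
have [S1|S1] := leP S 1; last first.
  have h1 : `|Ex G (fun z => H (shiftv w z)) - smooth x| <= 1.
    have /andP[a0 a1] := smooth01 x.
    have b0 : 0 <= Ex G (fun z => H (shiftv w z)).
      by apply: Ex_ge0 => z; have /andP[] := H01 (shiftv w z).
    have b1 : Ex G (fun z => H (shiftv w z)) <= 1.
      by apply: Ex_le_cst => // z; have /andP[] := H01 (shiftv w z).
    by rewrite ler_norml; apply/andP; split; lra.
  have h2 : `|\sum_(i < n) w i * grad i x| <= 2 * n%:R * S.
    apply: (le_trans (ler_norm_sum _ _ _)).
    apply: (@le_trans _ _ (\sum_(i < n) 2 * S)); last first.
      by rewrite sumr_const card_ord -mulrA [n%:R * S]mulr_natl mulrnAr.
    apply: ler_sum => i _; rewrite normrM mulrC; apply: ler_pM => //.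
      exact: norm_grad.
    have wS : w i ^+ 2 <= S.
      by rewrite /S (bigD1 i)//= lerDl sumr_ge0// => j _; exact: sqr_ge0.
    rewrite -real_normK ?num_real// in wS.
    have [a1|a1] := leP `|w i| 1; first exact: (le_trans a1 (ltW S1)).
    by apply: le_trans wS; rewrite expr2 ler_peMl// ltW.
  apply: (le_trans (ler_normB _ _)); apply: (le_trans (lerD h1 h2)).
  by rewrite /taylor_cst; nra.
have mc := measurable_cmv w.
have c00 (z : V) : 0 <= cmv w z by exact: expR_ge0.
have sh P := @gauss_shift R n w P.
have E1 := density_Ex ms mc c00 sh bH.
have i1 := density_intgM mc c00 sh bH.
rewrite {}E1.
have i3 : intg G (fun z => \sum_(i < n) w i * (H z * tnth z i)) by exact: intg_sum.
have i2 : intg G (fun z => (- 1) * H z) by apply: intgZ; exact: bmf_integrable.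
have i4 : intg G (fun z => (- 1) * \sum_(i < n) w i * (H z * tnth z i)) by exact: intgZ.
have i12 := intgD i1 i2; have i124 := intgD i12 i4.
pose D z := cmv w z - 1 - \sum_(i < n) w i * tnth z i.
have DE z : (H z * cmv w z + (- 1) * H z) + (- 1) * \sum_(i < n) w i * (H z * tnth z i) = H z * D z.
  have -> : \sum_(i < n) w i * (H z * tnth z i) = H z * \sum_(i < n) w i * tnth z i.
    by rewrite mulr_sumr; apply: eq_bigr => i _; rewrite mulrCA.
  by rewrite /D; ring.
have -> : Ex G (fun z => H z * cmv w z) - smooth x - \sum_(i < n) w i * grad i x =
    Ex G (fun z => H z * D z).
  transitivity (Ex G (fun z => (H z * cmv w z + (- 1) * H z) +
      (- 1) * \sum_(i < n) w i * (H z * tnth z i))); last by apply: eq_Ex.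
  rewrite (ExD i12 i4) (ExD i1 i2) (ExZ _ (bmf_integrable _ bH)) (ExZ _ i3) (Ex_sum _ ig).
  rewrite !mulN1r; congr (_ - _); apply: eq_bigr => i _.
  by rewrite ExZ//; exact: intgM_tnth.
have iHD : intg G (fun z => H z * D z).
  by have := i124; congr (_.-integrable _ _); apply/funext => z /=; rewrite DE.
apply: (le_trans (Ex_norm iHD)).
pose C := 3 * expR (6 * n%:R) * S.
apply: (@le_trans _ _ (Ex G (fun z : V => C * edom z))).
  apply: le_Ex.
  - by have := integrable_abse iHD; congr (_.-integrable _ _); apply/funext.
  - exact/intgZ/edom_intg.
  - move=> z; rewrite normrM; apply: (@le_trans _ _ `|D z|); last exact: cmv_taylor.
    by have /andP[h1 h2] := H01 z; rewrite ler_piMl// ger0_norm.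
rewrite (ExZ _ edom_intg).
have C0 : 0 <= C by apply: mulr_ge0 => //; apply: mulr_ge0 => //; exact: expR_ge0.
apply: (le_trans (ler_wpM2l C0 edom_Ex)); rewrite /C /taylor_cst.
rewrite mulrAC; apply: ler_wpM2r => //.
by rewrite lerDr; apply: addr_ge0.
Qed.

End smoothing.

End gradient.

(** * Elementary trigonometric bounds *)

Section trigonometric_bounds.
Context {R : realType}.
Implicit Types x : R.

Lemma sin_MVT x : 0 <= x -> exists2 y, 0 <= y <= x & sin x = cos y * x.
Proof.
move=> x0.
have h1 y : y \in `]0, x[%R -> is_derive y 1 (@sin R) (cos y).
  by move=> _; exact: is_derive_sin.
have h2 : {within `[0, x], continuous (@sin R)}.
  by apply: continuous_subspaceT; exact: continuous_sin.
have [y] := MVT_segment x0 h1 h2.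
by rewrite in_itv/= sin0 !subr0 => hy e; exists y.
Qed.

Lemma norm_sin_le x : `|sin x| <= `|x|.
Proof.
wlog x0 : x / 0 <= x.
  move=> h; have [x0|x0] := leP 0 x; first exact: h.
  by rewrite -normrN -sinN -[leRHS]normrN h// oppr_ge0 ltW.
have [y _ ->] := sin_MVT x0.
by rewrite normrM ler_piMl// cos_max.
Qed.

Lemma one_minus_cos x : 1 - cos x = 2 * sin (x / 2) ^+ 2.
Proof.
have -> : cos x = cos (x / 2 + x / 2) by congr cos; field.
by rewrite cosD -[X in X - _](cos2Dsin2 (x / 2)); ring.
Qed.

Lemma norm_cos_sub1 x : `|cos x - 1| <= x ^+ 2.
Proof.
have p0 : 0 <= 2 * sin (x / 2) ^+ 2 by apply: mulr_ge0 => //; exact: sqr_ge0.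
rewrite -normrN opprB one_minus_cos (ger0_norm p0).
have h : sin (x / 2) ^+ 2 <= (x / 2) ^+ 2.
  rewrite -[leLHS]real_normK ?num_real// -[leRHS]real_normK ?num_real//.
  by apply: lerXn2r; rewrite ?nnegrE// norm_sin_le.
have := sqr_ge0 x; have e : (x / 2) ^+ 2 = x ^+ 2 / 4 by field.
by rewrite e in h; lra.
Qed.

(** The mean value point for [x / 2] lies below [pi / 4], where [cos ^ 2 >= 1 / 2]. *)
Lemma sqr_le_cos x : 0 <= x <= pi / 2 -> x ^+ 2 <= 8 * (1 - cos x).
Proof.
move=> /andP[x0 x1]; rewrite one_minus_cos.
have x20 : 0 <= x / 2 by rewrite divr_ge0.
have [y /andP[y0 y1] ->] := sin_MVT x20.
have c2 : 0 <= cos (y + y).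
  apply: cos_ge0_pihalf; apply/andP; split; last lra.
  by have := pi_ge0 R; lra.
rewrite cosD -!expr2 sin2cos2 in c2.
rewrite exprMn; have : 0 <= x ^+ 2 by exact: sqr_ge0.
have e : (x / 2) ^+ 2 = x ^+ 2 / 4 by field.
rewrite e; nra.
Qed.

End trigonometric_bounds.

Lemma le_of_halves (R : archiRealFieldType) (x y z : R) :
  (forall k, x <= y + z / 2 ^+ k) -> x <= y.
Proof.
move=> h; rewrite leNgt; apply/negP => yx.
have d0 : 0 < x - y by rewrite subr_gt0.
have z0 : 0 < z by have := h 0%N; rewrite expr0 divr1; lra.
have /ltW := archi_boundP (divr_ge0 (ltW z0) (ltW d0)).
set k := Num.bound _ => hk.
have k2 : k%:R < 2 ^+ k :> R by rewrite -natrX ltr_nat ltn_expl.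
have p0 : 0 < 2 ^+ k :> R by exact: exprn_gt0.
have := h k; rewrite leNgt => /negP; apply.
rewrite -ltrBrDl ltr_pdivrMr//; rewrite ler_pdivrMr// mulrC in hk.
by apply: (le_lt_trans hk); rewrite ltr_pM2l.
Qed.

Section displacement.
Context {R : realType} {n : nat}.
Local Notation V := (n.-tuple (measurableTypeR R)).
Local Notation G := (@gauss R n).

Definition disp (th : 'I_n -> R) (x z : V) i :=
  (cos (th i) - 1) * tnth x i + sin (th i) * tnth z i.

Lemma shiftv_disp th x z :
  mix (fun i => cos (th i)) (fun i => sin (th i)) x z = shiftv (disp th x z) x.
Proof.
by apply: eq_from_tnth => i; rewrite tnth_mix tnth_mktuple /disp; ring.
Qed.

Lemma norm_disp th x z i :
  `|disp th x z i| <= th i ^+ 2 * `|tnth x i| + `|th i| * `|tnth z i|.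
Proof.
apply: (le_trans (ler_normD _ _)); rewrite !normrM; apply: lerD; apply: ler_wpM2r => //.
  exact: norm_cos_sub1.
exact: norm_sin_le.
Qed.

Lemma sqr_disp th x z i :
  disp th x z i ^+ 2 <= 8 * th i ^+ 4 * edom x + 8 * th i ^+ 2 * edom z.
Proof.
have h := norm_disp th x z i.
have hx := sqr_le_edom x i; have hz := sqr_le_edom z i.
rewrite -[tnth x i ^+ 2]real_normK ?num_real// in hx.
rewrite -[tnth z i ^+ 2]real_normK ?num_real// in hz.
rewrite -real_normK ?num_real//.
have t2 : th i ^+ 2 = `|th i| ^+ 2 by rewrite real_normK ?num_real.
have -> : th i ^+ 4 = (`|th i| ^+ 2) ^+ 2 by rewrite -t2 -exprM.
rewrite t2 in h *.
have d0 := normr_ge0 (disp th x z i); have a0 := normr_ge0 (th i).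
have x0 := normr_ge0 (tnth x i); have z0 := normr_ge0 (tnth z i).
move: (`|disp th x z i|) (`|th i|) (`|tnth x i|) (`|tnth z i|) h hx hz d0 a0 x0 z0
  => D a X Z h hx hz d0 a0 x0 z0.
apply: (@le_trans _ _ ((a ^+ 2 * X + a * Z) ^+ 2)).
  by apply: lerXn2r; rewrite ?nnegrE// addr_ge0// mulr_ge0// sqr_ge0.
apply: (@le_trans _ _ (2 * (a ^+ 2) ^+ 2 * X ^+ 2 + 2 * a ^+ 2 * Z ^+ 2)).
  rewrite -subr_ge0.
  have -> : 2 * (a ^+ 2) ^+ 2 * X ^+ 2 + 2 * a ^+ 2 * Z ^+ 2 - (a ^+ 2 * X + a * Z) ^+ 2
    = (a ^+ 2 * X - a * Z) ^+ 2 by ring.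
  exact: sqr_ge0.
have a20 := sqr_ge0 a; have a40 := sqr_ge0 (a ^+ 2).
have := ler_wpM2l a40 hx; have := ler_wpM2l a20 hz; lra.
Qed.

End displacement.

(** * Rotation distance of a smoothing *)

Section rotdist_bounds.
Context {R : realType} {n : nat}.
Local Notation V := (n.-tuple (measurableTypeR R)).
Local Notation G := (@gauss R n).

Lemma intg_norm_tnth i : intg G (fun z : V => `|tnth z i|).
Proof.
have := intgM_tnth i (@bmf_cst _ V R 1) => /integrable_abse.
by congr (_.-integrable _ _); apply/funext => z /=; rewrite mul1r.
Qed.

Section smooth.
Variables (c s : R) (F : V -> R).
Hypotheses (c0 : 0 < c) (s0 : 0 < s) (cs : c ^+ 2 + s ^+ 2 = 1).
Hypotheses (bF : bmf F) (F01 : forall x, 0 <= F x <= 1).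
Local Notation h := (smooth c s F).
Local Notation g := (grad c s F).

(** After [k] halvings only the first-order term survives as [k] grows. In it [z] is independent of
    the gradient at [x], and the mean of [|z_i|] is at most 2, whence the factor 2. *)
Lemma rotdist_smooth (al : 'I_n -> R) :
  rotdist h al <= 2 * (c / s) * \sum_(i < n) `|al i| * Ex G (fun x => `|g i x|).
Proof.
pose lam := c / s; have lam0 : 0 < lam by exact: divr_gt0.
pose K1 := \sum_(i < n) al i ^+ 2; pose K2 := \sum_(i < n) al i ^+ 4.
have K10 : 0 <= K1 by apply: sumr_ge0 => i _; exact: sqr_ge0.
have K20 : 0 <= K2 by apply: sumr_ge0 => i _; exact: exprn_even_ge0.
pose C := @taylor_cst R n; have C0 : 0 <= C by exact: taylor_cst_ge0.
pose K := 4 * lam * K1 + 8 * C * lam ^+ 2 * (K1 + K2).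
have lam20 : 0 <= lam ^+ 2 by exact: sqr_ge0.
have K0 : 0 <= K.
  apply: addr_ge0; first by apply: mulr_ge0 => //; apply: mulr_ge0 => //; exact: ltW.
  by apply: mulr_ge0; [apply: mulr_ge0 => //; exact: mulr_ge0|exact: addr_ge0].
have bh : bmf h by exact: bmf_smooth.
have bg i : bmf (fun x => `|g i x|) by exact/bmf_norm/bmf_grad.
rewrite -/lam.
apply: (@le_of_halves _ _ _ (K * (2 * 2 ^+ n))) => k.
apply: (le_trans (rotdist_halves al k bh)).
have p0 : 0 < 2 ^+ k :> R by exact: exprn_gt0.
pose ep : R := (2 ^+ k)^-1; have ep0 : 0 < ep by rewrite invr_gt0.
have ep1 : ep <= 1 by rewrite invf_le1// exprn_ege1// ler1n.
pose th i := al i / 2 ^+ k; rewrite -/th.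
have thE i : th i = ep * al i by rewrite /th mulrC.
suff key : rotdist h th <= ep * (2 * lam * \sum_(i < n) `|al i| * Ex G (fun x => `|g i x|))
    + ep ^+ 2 * (K * (2 * 2 ^+ n)).
  apply: (le_trans (ler_wpM2l (ltW p0) key)).
  by rewrite le_eqVlt; apply/orP; left; apply/eqP; rewrite /ep; field; rewrite gt_eqF.
(* To first order in [ep] coordinate [i] moves by [ep * al i * z_i]; its drift along [x_i] and the
   Taylor remainder are both of order [ep ^ 2]. *)
have pt x z : `|h x - h (mix (fun i => cos (th i)) (fun i => sin (th i)) x z)| <=
    (ep * lam) * (\sum_(i < n) (`|al i| * `|g i x|) * `|tnth z i|) +
    (ep ^+ 2 * K) * (edom x + edom z).
  rewrite shiftv_disp distrC; set v := disp th x z.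
  have tay := smooth_taylor c s0 bF F01 v x.
  set D := h (shiftv v x) - h x in tay *.
  have t1 : `|D| <= lam * (\sum_(i < n) `|v i| * `|g i x|) +
      C * (lam ^+ 2 * \sum_(i < n) v i ^+ 2).
    rewrite -[D](subrK (lam * \sum_(i < n) v i * g i x)) addrC.
    apply: (le_trans (ler_normD _ _)); apply: lerD => //.
    rewrite normrM (gtr0_norm lam0); apply: ler_wpM2l; first exact: ltW.
    apply: (le_trans (ler_norm_sum _ _ _)); apply: ler_sum => i _.
    by rewrite normrM.
  apply: (le_trans t1).
  have x1 := edom_ge1 x; have z1 := edom_ge1 z.
  have s1 : \sum_(i < n) `|v i| * `|g i x| <=
      ep * (\sum_(i < n) (`|al i| * `|g i x|) * `|tnth z i|) + ep ^+ 2 * (4 * K1 * edom x).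
    have -> : ep ^+ 2 * (4 * K1 * edom x) = \sum_(i < n) ep ^+ 2 * (4 * al i ^+ 2 * edom x).
      by rewrite -mulr_sumr -mulr_suml -mulr_sumr.
    rewrite mulr_sumr -big_split /=; apply: ler_sum => i _.
    have h1 := norm_disp th x z i; have h2 := norm_grad c s bF F01 i x.
    have h3 := norm_le_edom x i.
    rewrite thE normrM (gtr0_norm ep0) exprMn in h1.
    apply: (le_trans (ler_wpM2r (normr_ge0 (g i x)) h1)).
    apply: (@le_trans _ _ (ep * (`|al i| * `|g i x| * `|tnth z i|) +
       ep ^+ 2 * (al i ^+ 2 * (`|tnth x i| * `|g i x|)))).
      by apply: eq_ler; ring.
    rewrite lerD2l; apply: ler_wpM2l; first exact: sqr_ge0.
    have -> : 4 * al i ^+ 2 * edom x = al i ^+ 2 * ((2 * edom x) * 2) by ring.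
    apply: ler_wpM2l; first exact: sqr_ge0.
    exact: ler_pM.
  have s2 : \sum_(i < n) v i ^+ 2 <= ep ^+ 2 * (8 * (K1 + K2) * (edom x + edom z)).
    apply: (@le_trans _ _ (\sum_(i < n) ep ^+ 2 * ((8 * al i ^+ 4 * edom x) + (8 * al i ^+ 2 * edom z)))).
      apply: ler_sum => i _; apply: (le_trans (sqr_disp th x z i)).
      rewrite thE !exprMn mulrDr; apply: lerD; last first.
        by rewrite le_eqVlt; apply/orP; left; apply/eqP; ring.
      have -> : 8 * (ep ^+ 4 * al i ^+ 4) * edom x = ep ^+ 4 * (8 * al i ^+ 4 * edom x) by ring.
      apply: ler_wpM2r.
        apply: mulr_ge0; last exact: expR_ge0.
        by apply: mulr_ge0 => //; exact: exprn_even_ge0.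
      rewrite (exprD ep 2 2) ler_piMr ?sqr_ge0//.
      by rewrite exprn_ile1// ltW.
    rewrite -mulr_sumr big_split /= -!mulr_suml -!mulr_sumr -/K1 -/K2.
    apply: ler_wpM2l; first exact: sqr_ge0.
    have := expR_ge0 (\sum_(i < n) (tnth x i ^+ 2 / 4)).
    rewrite -/(edom x) => ?; have : 0 <= K1 * edom x by exact: mulr_ge0 (expR_ge0 _).
    have : 0 <= K2 * edom z by exact: mulr_ge0 (expR_ge0 _).
    by lra.
  have l1 := ler_wpM2l (ltW lam0) s1.
  have l2 := ler_wpM2l C0 (ler_wpM2l lam20 s2).
  apply: (le_trans (lerD l1 l2)); rewrite -subr_ge0 /K.
  set X := \sum_(i < n) _.
  have -> : ep * lam * X +
    ep ^+ 2 * (4 * lam * K1 + 8 * C * lam ^+ 2 * (K1 + K2)) * (edom x + edom z) -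
    (lam * (ep * X + ep ^+ 2 * (4 * K1 * edom x)) +
      C * (lam ^+ 2 * (ep ^+ 2 * (8 * (K1 + K2) * (edom x + edom z))))) =
    ep ^+ 2 * (4 * lam * K1 * edom z) by ring.
  apply: mulr_ge0; first exact: sqr_ge0.
  apply: mulr_ge0; last exact: expR_ge0.
  by apply: mulr_ge0 => //; apply: mulr_ge0 => //; exact: ltW.
have bd := bmf_dist (fun i => cos (th i)) (fun i => sin (th i)) bh.
have eK0 : 0 <= ep ^+ 2 * K by apply: mulr_ge0 => //; exact: sqr_ge0.
have el0 : 0 <= ep * lam by apply: mulr_ge0; exact: ltW.
have inner x : Ex G (fun z => `|h x - h (mix (fun i => cos (th i)) (fun i => sin (th i)) x z)|) <=
   (ep * lam) * (\sum_(i < n) (2 * `|al i|) * `|g i x|) + (ep ^+ 2 * K) * (edom x + 2 ^+ n).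
  have i1 i : intg G (fun z : V => (`|al i| * `|g i x|) * `|tnth z i|).
    by apply: intgZ; exact: intg_norm_tnth.
  have i2 : intg G (fun z : V => edom x + edom z).
    by apply: intgD; [exact/bmf_integrable/bmf_cst|exact: edom_intg].
  have i3 := intg_sum (index_enum _) i1.
  apply: (le_trans (le_Ex _ _ (pt x))).
  - exact: bmf_integrable (bmf_pair1 x bd).
  - by apply: intgD; exact: intgZ.
  rewrite ExD; [|exact: intgZ|exact: intgZ].
  rewrite (ExZ _ i3) (ExZ _ i2) (Ex_sum _ i1) (ExD (bmf_integrable G (@bmf_cst _ V R (edom x))) edom_intg) Ex_cst.
  apply: lerD; apply: ler_wpM2l => //; last by rewrite lerD2l edom_Ex.
  apply: ler_sum => i _; rewrite ExZ; last exact: intg_norm_tnth.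
  rewrite [leRHS](_ : _ = `|al i| * `|g i x| * 2); last by ring.
  by apply: ler_wpM2l; [exact: mulr_ge0|exact: Ex_norm_tnth].
have j1 i : intg G (fun x => (2 * `|al i|) * `|g i x|).
  by apply: intgZ; exact: bmf_integrable.
have j2 : intg G (fun x : V => edom x + 2 ^+ n).
  by apply: intgD; [exact: edom_intg|exact/bmf_integrable/bmf_cst].
have j3 := intg_sum (index_enum _) j1.
apply: (le_trans (le_Ex _ _ inner)).
- exact: bmf_integrable (bmf_Ex1 G G bd).
- by apply: intgD; exact: intgZ.
rewrite ExD; [|exact: intgZ|exact: intgZ].
rewrite (ExZ _ j3) (ExZ _ j2) (Ex_sum _ j1) (ExD edom_intg (bmf_integrable G (@bmf_cst _ V R (2 ^+ n)))) Ex_cst.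
apply: lerD; last first.
  rewrite -mulrA; apply: ler_wpM2l; first exact: sqr_ge0.
  apply: ler_wpM2l => //; rewrite mulr_natl mulr2n lerD2r; exact: edom_Ex.
rewrite -mulrA; apply: ler_wpM2l; first exact: ltW.
rewrite -mulrA mulrCA; apply: ler_wpM2l; first exact: ltW.
rewrite mulr_sumr; apply: ler_sum => i _; rewrite ExZ; last exact: bmf_integrable.
by rewrite mulrA.
Qed.

End smooth.
End rotdist_bounds.

(** * Gradient bound and continuity from cube enlargements *)

Section surface.
Context {R : realType} {n : nat}.
Local Notation T := (measurableTypeR R).
Local Notation V := (n.-tuple (measurableTypeR R)).
Local Notation G := (@gauss R n).

(** Covering the enlargement by a measurable [B] of small excess keeps everything within measurable
    sets, although the Minkowski sum itself need not be Borel. *)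
Definition cube_cover (A : set V) (d : R) := forall del : R, 0 < del ->
  exists (r : R) (B : set V), [/\ 0 < r < del, measurable B,
    (forall x v, A x -> (forall i, `|v i| <= r) -> B (shiftv v x)) &
    Ex G (\1_B : V -> R) <= Ex G (\1_A : V -> R) + d * r].

Lemma indic01 (A : set V) x : 0 <= (\1_A x : R) <= 1.
Proof. by rewrite indicE ler0n lern1 leq_b1. Qed.

Lemma le_indic (A B : set V) x y : (A x -> B y) -> (\1_A x : R) <= \1_B y.
Proof.
move=> h; rewrite !indicE; have [xA|xA] := boolP (x \in A).
  by rewrite (_ : y \in B)//; move: xA; rewrite !inE; exact: h.
exact: ler0n.
Qed.

Lemma shiftvN v (x : V) : shiftv (fun i => - v i) (shiftv v x) = x.
Proof. by apply: eq_from_tnth => i; rewrite !tnth_mktuple addrK. Qed.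

Lemma Ex_smooth c s (F : V -> R) : c ^+ 2 + s ^+ 2 = 1 -> bmf F ->
  Ex G (smooth c s F) = Ex G F.
Proof.
move=> cs bF.
apply: (etrans (@Ex_reflect _ _ (fun=> c) (fun=> s) (fun p => F p.1) (fun=> cs) (bmf_fst bF))).
by apply: eq_Ex => x; exact: (Ex_cst G (F x)).
Qed.

Section cover.
Variables (A : set V) (d : R).
Hypotheses (mA : measurable A) (cov : cube_cover A d).
Local Notation F := (\1_A : V -> R).

Let bF : bmf F. Proof. exact: bmf_indic. Qed.

(* Moving [x] by [r] in every coordinate, in the direction of the sign of the
   gradient, turns the sup norm enlargement into the [L^1] norm of the gradient. *)
Lemma sum_grad_le c s : 0 < c -> 0 < s -> c ^+ 2 + s ^+ 2 = 1 ->
  \sum_(i < n) Ex G (fun x => `|grad c s F i x|) <= s * d.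
Proof.
move=> c0 s0 cs; set S := \sum_(i < n) _.
pose g i x := grad c s F i x.
pose C := @taylor_cst R n * n%:R; have C0 : 0 <= C by apply: mulr_ge0 => //; exact: taylor_cst_ge0.
have key del : 0 < del -> exists2 r, 0 < r < del & S <= s * d + C / s * r.
  move=> del0; have [r [B [/andP[r0 rdel] mB hB eB]]] := cov del0.
  exists r; first by rewrite r0.
  have bB : bmf (\1_B : V -> R) by exact: bmf_indic.
  have pt x : smooth c s F x + r / s * (\sum_(i < n) `|g i x|) <=
      smooth c s \1_B x + C * (r / s) ^+ 2.
    (* [mix] multiplies [x] by [c], so this shift of [x] moves the argument of [F] by exactly [r]
       wherever the gradient is nonzero. *)
    pose v i := r / c * Num.sg (g i x).
    have cv i : c * v i = r * Num.sg (g i x).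
      by rewrite /v mulrA mulrCA divff ?mulr1// gt_eqF.
    have h1 : smooth c s F (shiftv v x) <= smooth c s \1_B x.
      apply: le_Ex; [exact/bmf_integrable/bmf_mix_l|exact/bmf_integrable/bmf_mix_l|].
      move=> z; apply: le_indic => Ay.
      rewrite -(shiftvN (fun i => c * v i) (mix (fun=> c) (fun=> s) x z)).
      apply: hB => [|i].
        rewrite (_ : shiftv _ _ = mix (fun=> c) (fun=> s) (shiftv v x) z)//.
        by apply: eq_from_tnth => i; rewrite !tnth_mktuple; ring.
      rewrite normrN cv normrM (gtr0_norm r0) ler_piMr ?(ltW r0)// normr_sg.
      by rewrite lern1 leq_b1.
    have := smooth_taylor c s0 bF (indic01 A) v x.
    rewrite ler_norml => /andP[h2 _].
    have e1 : c / s * \sum_(i < n) v i * g i x = r / s * \sum_(i < n) `|g i x|.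
      rewrite [RHS](_ : _ = c / s * (r / c * \sum_(i < n) `|g i x|)); last first.
        by field; rewrite !gt_eqF.
      congr (_ * _); rewrite mulr_sumr; apply: eq_bigr => i _.
      by rewrite /v -mulrA; congr (_ * _); rewrite normrEsg.
    have e2 : (c / s) ^+ 2 * \sum_(i < n) v i ^+ 2 <= n%:R * (r / s) ^+ 2.
      rewrite mulr_sumr; apply: (@le_trans _ _ (\sum_(i < n) (r / s) ^+ 2)); last first.
        by rewrite sumr_const card_ord -[leLHS]mulr_natl.
      apply: ler_sum => i _; rewrite -exprMn.
      have -> : c / s * v i = r / s * Num.sg (g i x).
        by rewrite mulrAC cv mulrAC.
      rewrite exprMn ler_piMr ?sqr_ge0// -real_normK ?num_real// normr_sg.
      by case: (g i x != 0); rewrite ?expr1n ?expr0n.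
    have e3 := ler_wpM2l (@taylor_cst_ge0 R n) e2.
    rewrite [leRHS]mulrA -/C in e3; rewrite e1 in h2.
    by lra.
  have bg i : bmf (fun x => `|g i x|) by apply: bmf_norm; exact: (bmf_grad c s bF (indic01 A)).
  have ig i : intg G (fun x => `|g i x|) by exact: bmf_integrable.
  have bS := bmf_smooth c s bF; have bSB := bmf_smooth c s bB.
  have iS : intg G (fun x => \sum_(i < n) `|g i x|) by exact: intg_sum.
  have := le_Ex (intgD (bmf_integrable G bS) (intgZ (r / s) iS))
    (intgD (bmf_integrable G bSB) (bmf_integrable G (@bmf_cst _ V R (C * (r / s) ^+ 2)))) pt.
  rewrite (ExD (bmf_integrable G bS) (intgZ (r / s) iS)).
  rewrite (ExD (bmf_integrable G bSB) (bmf_integrable G (@bmf_cst _ V R (C * (r / s) ^+ 2)))).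
  rewrite (Ex_smooth cs bF) (Ex_smooth cs bB) Ex_cst (ExZ _ iS) (Ex_sum _ ig) -/S => h.
  have h' : r / s * S <= d * r + C * (r / s) ^+ 2 by lra.
  have rs0 : 0 < r / s by exact: divr_gt0.
  rewrite -(ler_pM2l rs0).
  have -> // : r / s * (s * d + C / s * r) = d * r + C * (r / s) ^+ 2.
  by field; rewrite gt_eqF.
rewrite leNgt; apply/negP => h.
have X0 : 0 <= C / s by rewrite divr_ge0// ltW.
have p1 : 0 < C / s + 1 by rewrite ltr_wpDl.
have p0 : 0 < (S - s * d) / (C / s + 1) by rewrite divr_gt0// subr_gt0.
have [r /andP[r0 r1] hr] := key _ p0.
rewrite ltr_pdivlMr// in r1; nra.
Qed.

(** Continuity of rotations at angle 0, read off from the cover: if no coordinate moves by more than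
    [r], then [F] changes by at most the sum of the excesses [D] at the two points. The remaining
    event is handled by a Chebyshev bound. *)
Lemma rotdist_small (eta : R) : 0 < eta -> exists2 phi, 0 < phi < 1 &
  forall th, 0 <= th <= phi -> rotdist F (fun=> th) <= eta.
Proof.
move=> eta0.
have del0 : 0 < eta / 4 / (`|d| + 1) by rewrite !divr_gt0// ltr_wpDl.
have [r [B [/andP[r0 rdel] mB hB eB]]] := cov del0.
have bB : bmf (\1_B : V -> R) by exact: bmf_indic.
pose K := n%:R * (16 * 2 ^+ n) / r ^+ 2.
have n2 : 0 <= n%:R * (16 * 2 ^+ n) :> R.
  by apply: mulr_ge0 => //; apply: mulr_ge0 => //; exact: exprn_ge0.
have K0 : 0 <= K by rewrite divr_ge0// sqr_ge0.
have dr : d * r <= eta / 4.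
  apply: (@le_trans _ _ ((`|d| + 1) * r)).
    by apply: ler_wpM2r; [exact: ltW|have := ler_norm d; lra].
  by rewrite mulrC -ler_pdivlMr ?ltr_wpDl// ltW.
pose phi := Num.min 2^-1 (eta / 2 / (K + 1)).
have K1 : 0 < K + 1 by rewrite ltr_wpDl.
have phi0 : 0 < phi by rewrite lt_min invr_gt0 ltr0n/= !divr_gt0.
exists phi; first by rewrite phi0/= gt_min invf_lt1//= ltr1n.
move=> th /andP[th0 thphi].
have th1 : th <= 2^-1 by apply: (le_trans thphi); rewrite ge_min lexx.
have thK : K * th ^+ 2 <= eta / 2.
  have : th <= eta / 2 / (K + 1) by apply: (le_trans thphi); rewrite ge_min lexx orbT.
  by rewrite ler_pdivlMr// => h; nra.
pose c := fun _ : 'I_n => cos th; pose s := fun _ : 'I_n => sin th.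
have cs i : c i ^+ 2 + s i ^+ 2 = 1 by exact: cos2Dsin2.
pose D x : R := \1_B x - F x; have bD : bmf D by exact: bmfB.
have AB x : A x -> B x.
  move=> Ax; have := hB x (fun=> 0) Ax.
  rewrite (_ : shiftv _ x = x); last by apply: eq_from_tnth => i; rewrite tnth_mktuple addr0.
  by apply=> i; rewrite normr0 ltW.
have D0 x : 0 <= D x by rewrite subr_ge0; apply: le_indic; exact: AB.
have ED : Ex G D <= eta / 4.
  rewrite ExB; [|exact: bmf_integrable|exact: bmf_integrable].
  by have := dr; have := eB; lra.
(* The Chebyshev factor: [q * (edom x + edom z) >= 1] as soon as one coordinate moves by more than
   [r]. *)
pose q := (r ^+ 2)^-1 * (n%:R * (8 * th ^+ 2)).
have q0 : 0 <= q.
  apply: mulr_ge0; first by rewrite invr_ge0 sqr_ge0.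
  by apply: mulr_ge0 => //; apply: mulr_ge0 => //; exact: sqr_ge0.
have pt x z : `|F x - F (mix c s x z)| <= (D x + D (mix c s x z)) + q * (edom x + edom z).
  pose w := disp (fun=> th) x z.
  have yE : mix c s x z = shiftv w x by exact: shiftv_disp.
  set y := mix c s x z in yE *.
  have [hw|hw] := pselect (forall i, `|w i| <= r).
    have qe : 0 <= q * (edom x + edom z).
      by apply: mulr_ge0 => //; apply: addr_ge0; exact: expR_ge0.
    have h1 : F x <= \1_B y by apply: le_indic => Ax; rewrite yE; exact: hB.
    have h2 : F y <= \1_B x.
      apply: le_indic => Ay; rewrite -(shiftvN w x) -yE; apply: hB => // i.
      by rewrite normrN.
    by have := D0 x; have := D0 y; rewrite /D ler_norml => ? ?; apply/andP; split; lra.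
  have [i hi] : exists i, r < `|w i|.
    apply: contrapT => h; apply: hw => i; rewrite leNgt; apply/negP => h2; apply: h.
    by exists i.
  have h1 : `|F x - F y| <= 1.
    have /andP[? ?] := indic01 A x; have /andP[? ?] := indic01 A y.
    by rewrite ler_norml; apply/andP; split; lra.
  have h2 : 1 <= q * (edom x + edom z).
    rewrite /q -mulrA -ler_pdivrMl ?invr_gt0 ?exprn_gt0// invrK mulr1.
    apply: (@le_trans _ _ (w i ^+ 2)).
      rewrite -[leRHS]real_normK ?num_real//; apply: lerXn2r; last exact: ltW.
        by rewrite nnegrE ltW.
      by rewrite nnegrE.
    apply: (le_trans (sqr_disp (fun=> th) x z i)).
    have n1 : 1 <= n%:R :> R by rewrite ler1n; exact: leq_ltn_trans (leq0n i) (ltn_ord i).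
    have t2 : 0 <= th ^+ 2 by exact: sqr_ge0.
    have t4 : th ^+ 4 <= th ^+ 2.
      by rewrite (exprD th 2 2) ler_piMr//; rewrite exprn_ile1//; lra.
    have x1 := edom_ge1 x; have z1 := edom_ge1 z.
    apply: (@le_trans _ _ (8 * th ^+ 2 * (edom x + edom z))).
      rewrite mulrDr lerD2r; apply: ler_wpM2r; first exact: expR_ge0.
      by rewrite ler_pM2l.
    rewrite -[leRHS]mulrA; apply: ler_peMl => //.
    by apply: mulr_ge0; [apply: mulr_ge0|apply: addr_ge0; lra].
  by have := D0 x; have := D0 y; lra.
have bDm : bmf (fun p : V * V => D (mix c s p.1 p.2)) by exact: bmf_mix.
have bd := bmf_dist c s bF.
have ic (a : R) : intg G (fun _ : V => a) by exact/bmf_integrable/bmf_cst.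
have inner x : Ex G (fun z => `|F x - F (mix c s x z)|) <=
    (D x + Ex G (fun z => D (mix c s x z))) + q * (edom x + 2 ^+ n).
  have i1 : intg G (fun z => D (mix c s x z)) by exact: bmf_integrable (bmf_pair1 x bDm).
  have i2 := intgD (ic (D x)) i1.
  have i3 : intg G (fun z : V => edom x + edom z) := intgD (ic _) (@edom_intg R n).
  apply: (le_trans (le_Ex _ _ (pt x))).
  - exact: bmf_integrable (bmf_pair1 x bd).
  - exact: intgD i2 (intgZ q i3).
  rewrite (ExD i2 (intgZ q i3)) (ExD (ic _) i1) (ExZ _ i3) (ExD (ic _) (@edom_intg R n)) !Ex_cst.
  by apply: lerD => //; apply: ler_wpM2l => //; rewrite lerD2l edom_Ex.
have j1 := bmf_integrable G bD; have j2 := bmf_integrable G (bmf_Ex1 G G bDm).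
have j3 := intgD (@edom_intg R n) (ic (2 ^+ n)).
apply: (le_trans (le_Ex _ _ inner)).
- exact: bmf_integrable (bmf_Ex1 G G bd).
- exact: intgD (intgD j1 j2) (intgZ q j3).
rewrite (ExD (intgD j1 j2) (intgZ q j3)) (ExD j1 j2) (ExZ _ j3) (ExD (@edom_intg R n) (ic _)) Ex_cst.
have e : Ex G (fun x => Ex G (fun z => D (mix c s x z))) <= eta / 4.
  apply: le_trans ED; apply: eq_ler.
  apply: (etrans (@Ex_reflect _ _ c s (fun p => D p.1) cs (bmf_fst bD))).
  by apply: eq_Ex => x; exact: (Ex_cst G (D x)).
have h3 : q * (Ex G (@edom R n) + 2 ^+ n) <= eta / 2.
  apply: le_trans thK; apply: (@le_trans _ _ (q * (2 ^+ n + 2 ^+ n))).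
    by apply: ler_wpM2l => //; rewrite lerD2r edom_Ex.
  by apply: eq_ler; rewrite /q /K; field; rewrite gt_eqF.
by apply: (le_trans (lerD (lerD ED e) h3)); lra.
Qed.

End cover.
End surface.

(** * Equal partial derivatives from transitivity *)

Section symmetry.
Context {R : realType} {n : nat}.
Local Notation T := (measurableTypeR R).
Local Notation V := (n.-tuple (measurableTypeR R)).
Local Notation G := (@gauss R n).

(** Permute the coordinates of [z] along with those of [x], which preserves the Gaussian measure. *)
Lemma grad_permute c s (F : V -> R) (p : 'S_n) i x : bmf F ->
  (forall y, F (permute_coord p y) = F y) ->
  grad c s F i (permute_coord p x) = grad c s F (p i) x.
Proof.
move=> bF Fp.
have mH : measurable_fun setT
    (fun z => F (mix (fun=> c) (fun=> s) (permute_coord p x) z) * tnth z i).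
  apply: measurable_funM; first exact: bmf_meas (bmf_mix_l _ _ _ bF).
  exact: measurable_tnth.
apply: (etrans (esym (mpres_Ex (@gauss_permute R n p) mH))).
apply: eq_Ex => z; rewrite tnth_mktuple; congr (_ * _); rewrite -[RHS]Fp; congr F.
by apply: eq_from_tnth => j; rewrite !tnth_mktuple.
Qed.

(** Transitivity makes the [L^1] norms of the partial derivatives equal, so each is at most
    [s * d / n]. The resulting bound for the smoothing is uniform in its angle [phi], which is taken
    small enough to approximate the indicator. *)
Lemma influence_bound (A : set V) (d : R) : measurable A -> transitive_set A ->
  cube_cover A d -> (0 < n)%N ->
  forall al : 'I_n -> R,
    rotdist (\1_A : V -> R) al <= 2 * (d / n%:R) * \sum_(i < n) `|al i|.
Proof.
move=> mA [H trH invH] cov n0 al; set F := (\1_A : V -> R).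
have bF : bmf F by exact: bmf_indic.
have F01 := indic01 A.
pose L := \sum_(i < n) `|al i|; rewrite -/L.
have L0 : 0 <= L by exact: sumr_ge0.
have d0 : 0 <= d.
  have [r [B [/andP[r0 _] mB hB eB]]] := cov 1 ltr01.
  have : Ex G F <= Ex G (\1_B : V -> R).
    apply: le_Ex; [exact: bmf_integrable|exact/bmf_integrable/bmf_indic|].
    move=> x; apply: le_indic => Ax; have := hB x (fun=> 0) Ax.
    rewrite (_ : shiftv _ x = x); last by apply: eq_from_tnth => i; rewrite tnth_mktuple addr0.
    by apply=> i; rewrite normr0 ltW.
  by rewrite -(pmulr_lge0 _ r0); lra.
have nR : 0 < n%:R :> R by rewrite ltr0n.
apply/ler_addgt0Pr => eta eta0.
have eta2 : 0 < eta / 2 by rewrite divr_gt0.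
have [phi /andP[phi0 phi1] hphi] := rotdist_small mA cov eta2.
have pi2 : 1 <= pi / 2 :> R := pihalf_ge1 R.
pose c := cos phi; pose s := sin phi.
have c0 : 0 < c by apply: cos_gt0_pihalf; apply/andP; split; lra.
have s0 : 0 < s by apply: sin_gt0_pihalf; apply/andP; split; lra.
have cs : c ^+ 2 + s ^+ 2 = 1 by exact: cos2Dsin2.
pose g i := Ex G (fun x => `|grad c s F i x|).
have geq i j : g i = g j.
  have [p pH ->] := atransP2 trH (finset.in_setT j) (finset.in_setT i).
  have mg : measurable_fun setT (fun x => `|grad c s F j x|).
    exact/bmf_meas/bmf_norm/(bmf_grad c s bF F01).
  apply: etrans (mpres_Ex (@gauss_permute R n p) mg).
  apply: eq_Ex => x; congr `|_|; apply: esym.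
  by apply: grad_permute => // y; exact: invH.
have gb i : g i <= s * d / n%:R.
  rewrite ler_pdivlMr// mulr_natr; apply: le_trans (sum_grad_le mA cov c0 s0 cs).
  rewrite (eq_bigr (fun=> g i)) => [|j _]; last exact: geq.
  by rewrite sumr_const card_ord.
apply: (le_trans (rotdist_approx al bF (bmf_smooth c s bF))).
have h1 : rotdist (smooth c s F) al <= 2 * (d / n%:R) * L.
  apply: (le_trans (rotdist_smooth c0 s0 bF F01 al)).
  apply: (@le_trans _ _ (2 * (c / s) * \sum_(i < n) `|al i| * (s * d / n%:R))).
    apply: ler_wpM2l; first by apply: mulr_ge0 => //; rewrite divr_ge0 ?ltW.
    by apply: ler_sum => i _; apply: ler_wpM2l => //; exact: gb.
  rewrite -mulr_suml -/L.
  have -> : 2 * (c / s) * (L * (s * d / n%:R)) = c * (2 * (d / n%:R) * L).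
    by field; rewrite !gt_eqF.
  apply: ler_piMl; last exact: cos_le1.
  by apply: mulr_ge0 => //; apply: mulr_ge0 => //; apply: divr_ge0 => //; exact: ltW.
apply: lerD => //.
(* Jensen again: [smooth c s F x] is the average over [z] of the rotated values. *)
have h2 : Ex G (fun x => `|F x - smooth c s F x|) <= eta / 2.
  apply: le_trans (hphi phi _); last by rewrite lexx andbT ltW.
  apply: le_Ex.
  - by apply/bmf_integrable/bmf_norm/bmfB => //; exact: bmf_smooth.
  - exact/bmf_integrable/bmf_Ex_dist.
  move=> x; rewrite -[X in `|X - _|](Ex_cst G (F x)).
  have b1 : bmf (fun z => F (mix (fun=> c) (fun=> s) x z)) by exact: bmf_mix_l.
  rewrite -ExB; [|exact/bmf_integrable/bmf_cst|exact: bmf_integrable].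
  exact: (Ex_norm (bmf_integrable _ (bmfB (@bmf_cst _ V R (F x)) b1))).
by lra.
Qed.

End symmetry.

(** * The lower bound *)

Section autocorrelation.
Context {R : realType} {n : nat}.
Local Notation V := (n.-tuple (measurableTypeR R)).
Local Notation G := (@gauss R n).

Definition autocorr (D : V -> R) (sg : R) :=
  Ex G (fun x => D x * noise (fun=> sg) D x).

Lemma autocorr_sqr D sg : bmf D -> 0 <= sg <= 1 ->
  autocorr D (sg ^+ 2) = Ex G (fun x => noise (fun=> sg) D x ^+ 2).
Proof. by move=> bD h; exact: (@Ex_noise_sqr _ _ (fun=> sg) D (fun=> h) bD). Qed.

Lemma autocorr_ge0 D sg : bmf D -> 0 <= sg <= 1 -> 0 <= autocorr D (sg ^+ 2).
Proof.
move=> bD h; rewrite (autocorr_sqr bD h).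
by apply: Ex_ge0 => x; exact: sqr_ge0.
Qed.

(** Cauchy-Schwarz between [D] and [noise sg D]: in the variable [ln sg], midpoint log-convexity
    between correlations 1 and [sg ^ 2]. *)
Lemma autocorr_log_convex D sg : bmf D -> 0 <= sg <= 1 ->
  autocorr D sg ^+ 2 <= Ex G (fun x => D x ^+ 2) * autocorr D (sg ^+ 2).
Proof.
move=> bD h; rewrite (autocorr_sqr bD h).
exact: (Ex_cauchy_schwarzM G bD (bmf_noise _ bD)).
Qed.

Lemma autocorr_centered F sg : bmf F -> 0 <= sg <= 1 ->
  autocorr (fun x => F x - Ex G F) sg =
  Ex G (fun x => F x * noise (fun=> sg) F x) - Ex G F ^+ 2.
Proof.
move=> bF h; pose c : 'I_n -> R := fun=> sg.
have hc : corr c by [].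
have bt : bmf (fun _ : V => Ex G F) by exact: bmf_cst.
have bN := bmf_noise c bF.
have i0 : intg G (noise c F) by exact: bmf_integrable.
have i1 : intg G (fun x => F x * noise c F x) by exact/bmf_integrable/bmfM.
have i2 : intg G (fun x => (- Ex G F) * F x) by apply: intgZ; exact: bmf_integrable.
have i3 : intg G (fun x => (- Ex G F) * noise c F x) by apply: intgZ; exact: bmf_integrable.
have i4 : intg G (fun _ : V => Ex G F ^+ 2) by exact/bmf_integrable/bmf_cst.
transitivity (Ex G (fun x => (F x * noise c F x + (- Ex G F) * F x) +
    ((- Ex G F) * noise c F x + Ex G F ^+ 2))).
  apply: eq_Ex => x; rewrite (noiseB c bF bt) noise_cst; ring.
rewrite (ExD (intgD i1 i2) (intgD i3 i4)) (ExD i1 i2) (ExD i3 i4) Ex_cst.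
rewrite (ExZ _ (bmf_integrable G bF)) (ExZ _ i0) (Ex_noise hc bF).
by ring.
Qed.

End autocorrelation.

(** * The universal constant and dyadic scales *)

Section constants.
Context {R : realType}.

(** Writes the correlation [hc_r ^ 2] of the influence bound as [expR (- hc_l)], so that repeated
    square roots halve the exponent. *)
Definition hc_l : R := - ln (@hc_r R ^+ 2).

Lemma hc_r2_lt1 : @hc_r R ^+ 2 < 1.
Proof.
have := @hc_r_sqr R; have : 0 < (20 * @hc_r R) ^+ 2; last by lra.
by apply: exprn_gt0; apply: mulr_gt0 => //; exact: hc_r_gt0.
Qed.

Lemma hc_l_gt0 : 0 < hc_l.
Proof.
rewrite /hc_l oppr_gt0 -ln1 ltr_ln ?posrE//; first exact: hc_r2_lt1.
by apply: exprn_gt0; exact: hc_r_gt0.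
Qed.

Definition hc_k : R := 8 * 9 ^+ 2 * hc_l + 1.

Lemma hc_k_gt0 : 0 < hc_k.
Proof.
apply: ltr_wpDl; last exact: ltr01.
apply: mulr_ge0; last exact/ltW/hc_l_gt0.
by apply: mulr_ge0; [exact: ler0n|exact/exprn_ge0/ler0n].
Qed.

Lemma hc_k_ge1 : 1 <= hc_k.
Proof.
rewrite /hc_k lerDr; apply: mulr_ge0; last exact/ltW/hc_l_gt0.
by apply: mulr_ge0; [exact: ler0n|exact/exprn_ge0/ler0n].
Qed.

(** The factor [1 / (2 pi)] controls the influences [d * pi / n]. Dividing by [hc_k] makes
    [8 * 9 ^ 2 * hc_l * c ^ 2 < 1]: the 9 comes from a correlation gap of [v / 9], the 8 from
    [sqr_le_cos]. *)
Definition boundary_cst : R := (2 * pi)^-1 / hc_k.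

Lemma double_pi_gt0 : 0 < 2 * pi :> R.
Proof. by apply: mulr_gt0; [exact: ltr0n|exact: pi_gt0]. Qed.

Lemma boundary_cst_gt0 : 0 < boundary_cst.
Proof.
apply: divr_gt0; last exact: hc_k_gt0.
by rewrite invr_gt0; exact: double_pi_gt0.
Qed.

Lemma boundary_cst_pi : boundary_cst * pi <= 2^-1.
Proof.
have p0 := pi_gt0 R; have k0 := hc_k_gt0; have k1 := hc_k_ge1.
rewrite /boundary_cst; move: (hc_k) k0 k1 => k k0 k1.
move: (pi : R) p0 => p p0.
have -> : (2 * p)^-1 / k * p = 2^-1 / k by field; rewrite !gt_eqF.
by rewrite ler_pdivrMr// ler_peMr// invr_ge0.
Qed.

Lemma boundary_cst_l : 8 * 9 ^+ 2 * hc_l * boundary_cst ^+ 2 < 1.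
Proof.
have c0 := boundary_cst_gt0; have k1 := hc_k_ge1; have k0 := hc_k_gt0.
have c1 : boundary_cst <= hc_k^-1.
  rewrite /boundary_cst; apply: ler_piMl; first by rewrite invr_ge0 ltW.
  rewrite invf_le1; last exact: double_pi_gt0.
  by have := pi_ge2 R; move: (pi : R) => p; lra.
have -> : 8 * 9 ^+ 2 * hc_l = hc_k - 1 by rewrite /hc_k addrK.
have e : hc_k^-1 * hc_k = 1 by rewrite mulVf// gt_eqF.
have i0 : 0 < hc_k^-1 by rewrite invr_gt0.
have i1 : hc_k^-1 <= 1 by rewrite invf_le1.
move: (hc_k) (hc_k^-1) (boundary_cst) c0 k1 k0 c1 e i0 i1 => k j c c0 k1 k0 c1 e i0 i1.
have h1 : c ^+ 2 <= j.
  rewrite expr2; apply: (@le_trans _ _ (j * 1)); last by rewrite mulr1.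
  by apply: ler_pM => //; [exact: ltW|exact: ltW|exact: le_trans i1].
have h2 : (k - 1) * c ^+ 2 <= (k - 1) * j by apply: ler_wpM2l => //; lra.
by apply: (le_lt_trans h2); rewrite mulrBl mul1r mulrC e; lra.
Qed.

Lemma ln_nat_ge (n : nat) : (1 < n)%N -> 2^-1 <= ln (n%:R : R).
Proof.
move=> n1; have n0 : 0 < n%:R :> R by rewrite ltr0n ltnW.
rewrite -ler_expR lnK ?posrE//.
apply: (@le_trans _ _ 2); last by rewrite ler_nat.
have := expR_ge1Dx (- 2^-1 : R); rewrite expRN => h.
have e0 := expR_gt0 (2^-1 : R); move: (expR _) e0 h => e e0 h.
have ev : e * e^-1 = 1 by rewrite mulfV// gt_eqF.
have := ler_wpM2l (ltW e0) h; rewrite ev; lra.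
Qed.

Lemma dyadic_scale (y : R) : 1 <= y -> exists k, 2 ^+ k <= y < 2 ^+ k.+1.
Proof.
move=> y1; have y0 : 0 <= y by lra.
have exk : exists k, y < 2 ^+ k.
  exists (Num.bound y); apply: (lt_trans (archi_boundP y0)).
  by rewrite -natrX ltr_nat ltn_expl.
case: (@ex_minnP (fun k => y < 2 ^+ k) exk) => -[|k] yk kmin.
  by rewrite expr0 in yk; lra.
exists k; rewrite yk andbT leNgt; apply/negP => /kmin.
by rewrite ltnn.
Qed.

End constants.

Section main_bound.
Context {R : realType}.

Lemma expr3_le_expR (L : R) : 0 <= L -> L ^+ 3 <= 6 * expR L.
Proof.
move=> L0; have := expR_ge1Dxn 2 L0; rewrite (_ : (3`!)%N = 6%N)// => h.
by have := expR_gt0 L; lra.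
Qed.

(* [x = y_k] satisfies [x ^ (2 ^ k) <= y_0], and [y_0 ^ 4 <= 1 / n]. *)
Lemma small_of_powers (x L y : R) k : 0 <= x -> 0 <= y -> 2 ^+ k <= 2 * L ->
  x ^+ (2 ^ k) <= y -> y ^+ 4 <= expR (- L) -> x <= 8 / 9.
Proof.
move=> x0 y0 kL xy yL; rewrite leNgt; apply/negP => x89.
(* [8 / 9] comes from [expR (1 / 8) >= 1 + 1 / 8]; the exponent [1 / 8] times the power [4 * 2 ^ k]
   is at most [L]. *)
have e1 : expR (- 8^-1) < x.
  apply: le_lt_trans x89; have := expR_ge1Dx (8^-1 : R); rewrite expRN => h.
  have e0 := expR_gt0 (8^-1 : R); move: (expR _) e0 h => e e0 h.
  by rewrite invf_ple ?posrE ?divr_gt0// invf_div; lra.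
have h1 : expR (- L) <= expR (- 8^-1) ^+ (2 ^ k * 4).
  rewrite -expRM_natl ler_expR natrM natrX.
  by move: (2 ^+ k) kL => p kL; lra.
have h2 : expR (- 8^-1) ^+ (2 ^ k * 4) < x ^+ (2 ^ k * 4).
  rewrite ltrXn2r// ?expR_ge0//.
  by rewrite muln_eq0 expn_eq0.
have h3 : x ^+ (2 ^ k * 4) <= y ^+ 4.
  by rewrite exprM; apply: lerXn2r; rewrite // nnegrE// exprn_ge0.
have := le_lt_trans h1 (lt_le_trans h2 (le_trans h3 yL)).
by rewrite ltxx.
Qed.

(** The fourth power clears the roots and leaves [D ^ 6 / (N ^ 2 * v ^ 4)] with [D = d * pi]. The
    cubed logarithm in the bound on [D ^ 6] is at most [6 * N], and [q <= 1 / 2] absorbs the 6. *)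
Lemma kkl_start_bound (N d v q : R) : 1 <= N -> 0 <= d -> 0 < v -> v <= 1 ->
  q ^+ 2 * 2 ^+ 2 <= 1 -> 0 <= q ->
  d * pi <= q * v * Num.sqrt (ln N) ->
  (N * ((d * pi / N) * Num.sqrt (d * pi / N)) / v) ^+ 4 <= N^-1.
Proof.
move=> N1 d0 v0 v1 q2 q0 hd.
have N0 : 0 < N by lra.
have pi0 := pi_gt0 R; have dp0 : 0 <= d * pi by apply: mulr_ge0 => //; exact: ltW.
move: (d * pi) dp0 hd => D D0 hd.
have L0 : 0 <= ln N by rewrite ln_ge0.
set del := D / N; have del0 : 0 <= del by rewrite divr_ge0// ltW.
have -> : (N * (del * Num.sqrt del) / v) ^+ 4 = N ^+ 4 * del ^+ 6 / v ^+ 4.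
  have s4 : Num.sqrt del ^+ 4 = del ^+ 2.
    by rewrite (_ : 4 = 2 * 2)%N// exprM sqr_sqrtr.
  rewrite [LHS](_ : _ = N ^+ 4 * del ^+ 4 * Num.sqrt del ^+ 4 / v ^+ 4).
    by rewrite s4; field; rewrite gt_eqF.
  by field; rewrite gt_eqF.
have D2 : D ^+ 2 <= (q * v) ^+ 2 * ln N.
  rewrite -[X in _ * X](sqr_sqrtr L0) -exprMn.
  apply: lerXn2r => //; rewrite nnegrE// mulr_ge0 ?sqrtr_ge0// mulr_ge0//.
  exact: ltW.
have D6 : D ^+ 6 <= (q ^+ 2) ^+ 3 * v ^+ 6 * (6 * N).
  have -> : D ^+ 6 = (D ^+ 2) ^+ 3 by ring.
  apply: (@le_trans _ _ (((q * v) ^+ 2 * ln N) ^+ 3)).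
    by apply: lerXn2r; rewrite // nnegrE ?sqr_ge0// mulr_ge0// sqr_ge0.
  have -> : ((q * v) ^+ 2 * ln N) ^+ 3 = (q ^+ 2) ^+ 3 * v ^+ 6 * ln N ^+ 3.
    by ring.
  apply: ler_wpM2l.
    by apply: mulr_ge0; apply: exprn_ge0; [exact: sqr_ge0|exact: ltW].
  by have := expr3_le_expR L0; rewrite lnK ?posrE.
have q6 : (q ^+ 2) ^+ 3 * 6 <= 1.
  have a0 := sqr_ge0 q; have a1 : q ^+ 2 <= 4^-1 by lra.
  have : (q ^+ 2) ^+ 3 <= 4^-1 ^+ 3 by apply: lerXn2r; rewrite ?nnegrE.
  by rewrite (_ : 4^-1 ^+ 3 = 64^-1); [lra|field].
have v46 : v ^+ 6 <= v ^+ 4.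
  by rewrite (exprD v 4 2) ler_piMr ?exprn_ge0 ?exprn_ile1// ltW.
have v4 : 0 < v ^+ 4 by exact: exprn_gt0.
rewrite ler_pdivrMr// /del exprMn exprVn.
have -> : N ^+ 4 * (D ^+ 6 / N ^+ 6) = N^-1 * (D ^+ 6 / N).
  by field; rewrite gt_eqF.
apply: ler_wpM2l; first by rewrite invr_ge0 ltW.
rewrite ler_pdivrMr//; apply: (le_trans D6).
have -> : (q ^+ 2) ^+ 3 * v ^+ 6 * (6 * N) = ((q ^+ 2) ^+ 3 * 6) * v ^+ 6 * N by ring.
apply: ler_wpM2r; first exact: ltW.
apply: le_trans v46; apply: ler_piMl => //.
by apply: exprn_ge0; exact: ltW.
Qed.

(* [b sg] stands for the noise correlation at [sg] of a centered indicator of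
   variance [v]. Log-convexity along [sg_k = expR (- l / 2 ^ k)] turns the
   smallness of [b sg_0] into [b sg_k <= 8 / 9 * v] with [2 ^ k ~ ln N], whereas
   [v - b (cos th) <= d * th]. *)
Lemma autocorr_contra (b : R -> R) (v d l c N : R) : 2^-1 <= ln N -> 1 <= N ->
  0 < v -> v <= 1 -> 0 <= d -> 0 < l -> 0 < c -> c * pi <= 2^-1 ->
  8 * 9 ^+ 2 * l * c ^+ 2 < 1 ->
  (forall sg, 0 <= sg <= 1 -> 0 <= b (sg ^+ 2)) ->
  (forall sg, 0 <= sg <= 1 -> b sg ^+ 2 <= v * b (sg ^+ 2)) ->
  b (expR (- l)) <= N * (d * pi / N * Num.sqrt (d * pi / N)) ->
  (forall th, 0 <= th <= pi / 2 -> v - b (cos th) <= d * th) ->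
  ~ (d <= c * v * Num.sqrt (ln N)).
Proof.
move=> LN N1 v0 v1 d0 l0 c0 cpi cl bpos blog bkkl bgap hd.
have N0 : 0 < N by lra.
pose sg k : R := expR (- (l / 2 ^+ k)).
have sg01 k : 0 <= sg k <= 1.
  by rewrite expR_ge0/= -expR0 ler_expR oppr_le0 divr_ge0 ?exprn_ge0// ltW.
have sgS k : sg k.+1 ^+ 2 = sg k.
  rewrite -expRM_natl; congr expR; rewrite exprS; field.
  by rewrite expf_neq0.
have sg0 : sg 0%N = expR (- l) by rewrite /sg expr0 divr1.
pose y k := b (sg k) / v.
have b0 k : 0 <= b (sg k) by rewrite -sgS; exact: bpos.
have y0 k : 0 <= y k by apply: divr_ge0; [exact: b0|exact: ltW].
have yS k : y k.+1 ^+ 2 <= y k.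
  have h := blog _ (sg01 k.+1); rewrite sgS in h.
  rewrite /y expr_div_n ler_pdivrMr ?exprn_gt0//.
  rewrite (_ : _ / v * v ^+ 2 = v * b (sg k)); last by field; rewrite gt_eqF.
  exact: h.
have yk k : y k ^+ (2 ^ k) <= y 0%N.
  elim: k => [|k IH]; first by rewrite expn0 expr1.
  apply: le_trans IH; rewrite expnS exprM.
  apply: lerXn2r (yS k); first by rewrite nnegrE exprn_ge0.
  by rewrite nnegrE.
have y0le : y 0%N <= N * (d * pi / N * Num.sqrt (d * pi / N)) / v.
  by rewrite ler_pM2r ?invr_gt0// sg0.
have y04 : y 0%N ^+ 4 <= expR (- ln N).
  rewrite expRN lnK ?posrE//.
  apply: (le_trans (lerXn2r 4 _ _ y0le)); rewrite ?nnegrE//.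
    exact: le_trans (y0 0%N) y0le.
  have pi0 := pi_gt0 R.
  have q0 : 0 <= c * pi by apply: mulr_ge0; exact: ltW.
  apply: (@kkl_start_bound _ d v (c * pi)) => //.
    by move: (c * pi) cpi q0 => q cp q0; nra.
  have -> : c * pi * v * Num.sqrt (ln N) = (c * v * Num.sqrt (ln N)) * pi by ring.
  by apply: ler_wpM2r => //; exact: ltW.
have L2 : 1 <= 2 * ln N by lra.
(* Doubling gives [ln N <= 2 ^ k <= 2 * ln N]: the upper bound serves the [2 ^ k]-th root, the lower
   one the final comparison. *)
have [k /andP[kL Lk]] := dyadic_scale L2.
have y89 := small_of_powers (y0 k) (y0 0%N) kL (yk k) y04.
have sgk1 : -1 <= sg k <= 1 by have /andP[a1 a2] := sg01 k; apply/andP; split; lra.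
have [th th0 th_cos] : exists2 th, 0 <= th <= pi / 2 & cos th = sg k.
  exists (acos (sg k)); last exact: acosK.
  rewrite acos_ge0//= leNgt; apply/negP => h.
  have h2 := acos_lepi sgk1.
  have : 0 < cos (pi - acos (sg k)) by apply: cos_gt0_pihalf; apply/andP; split; lra.
  rewrite cosB cospi sinpi mul0r addr0 mulN1r acosK// oppr_gt0 ltNge.
  by have /andP[->] := sg01 k.
have gap2 : v / 9 <= d * th.
  have : b (sg k) <= 8 / 9 * v by rewrite -ler_pdivrMr.
  by have := bgap _ th0; rewrite th_cos; lra.
(* The angle is small because [1 - expR (- u) <= u] with [u = l / 2 ^ k]. *)
have th2 : th ^+ 2 <= 8 * (l / 2 ^+ k).
  apply: (le_trans (sqr_le_cos th0)); rewrite th_cos; apply: ler_wpM2l => //.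
  by have := expR_ge1Dx (- (l / 2 ^+ k)); rewrite -/(sg k); lra.
have L0 : 0 <= ln N by lra.
have p0 : 0 < 2 ^+ k :> R by exact: exprn_gt0.
have Lk' : ln N <= 2 ^+ k by rewrite exprS in Lk; lra.
have cv0 : 0 <= c * v by rewrite mulr_ge0// ltW.
have d2 : d ^+ 2 <= (c * v) ^+ 2 * 2 ^+ k.
  apply: (@le_trans _ _ ((c * v) ^+ 2 * ln N)); last first.
    by apply: ler_wpM2l => //; exact: sqr_ge0.
  rewrite -[X in _ * X](sqr_sqrtr L0) -exprMn.
  by apply: lerXn2r hd; rewrite nnegrE// mulr_ge0 ?sqrtr_ge0.
have v2 : (v / 9) ^+ 2 <= d ^+ 2 * th ^+ 2.
  have /andP[tha _] := th0.
  by rewrite -exprMn; apply: lerXn2r gap2; rewrite nnegrE ?divr_ge0 ?(ltW v0) ?mulr_ge0.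
have v3 : (v / 9) ^+ 2 <= ((c * v) ^+ 2 * 2 ^+ k) * (8 * (l / 2 ^+ k)).
  by apply: (le_trans v2); apply: ler_pM => //; exact: sqr_ge0.
have v4 : 0 < (v / 9) ^+ 2 by rewrite exprn_gt0// divr_gt0.
move: cl; rewrite ltNge => /negP; apply.
rewrite -(ler_pM2l v4) mulr1; apply: (le_trans v3); apply: eq_ler.
by field; rewrite gt_eqF.
Qed.

Variable n : nat.
Local Notation V := (n.-tuple (measurableTypeR R)).
Local Notation G := (@gauss R n).

Lemma Ex_sqr_center (F : V -> R) : bmf F -> (forall x, F x ^+ 2 = F x) ->
  Ex G (fun x => (F x - Ex G F) ^+ 2) = Ex G F * (1 - Ex G F).
Proof.
move=> bF F2; have i1 := bmf_integrable G bF.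
have [t tE] : exists t, Ex G F = t by exists (Ex G F).
rewrite tE.
have i2 := intgZ (1 - 2 * t) i1.
have i3 : intg G (fun _ : V => t ^+ 2) by exact/bmf_integrable/bmf_cst.
transitivity (Ex G (fun x => (1 - 2 * t) * F x + t ^+ 2)).
  by apply: eq_Ex => x; rewrite mulrBl mul1r -{2}[F x]F2; ring.
by rewrite (ExD i2 i3) (ExZ _ i1) Ex_cst tE; ring.
Qed.

Lemma cube_cover_contra (A : set V) (d : R) : (1 < n)%N -> measurable A ->
  transitive_set A -> cube_cover A d ->
  let t := Ex G (\1_A : V -> R) in
  0 < t * (1 - t) -> ~ (d <= @boundary_cst R * (t * (1 - t)) * Num.sqrt (ln n%:R)).
Proof.
move=> n1 mA trA cov.
have nn0 : (0 < n)%N by exact: ltnW.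
have nR : n%:R != 0 :> R by rewrite pnatr_eq0 -lt0n.
have infl := influence_bound mA trA cov nn0.
have F01 := indic01 A.
have F2 x : (\1_A : V -> R) x ^+ 2 = (\1_A : V -> R) x.
  by rewrite indicE; case: (x \in A); rewrite ?expr1n ?expr0n.
have bF : bmf (\1_A : V -> R) by exact: bmf_indic.
move: (\1_A : V -> R) bF F2 F01 infl => F bF F2 F01 infl t v0 hd.
have ainfl (th : R) : 0 <= th -> rotdist F (fun=> th) <= 2 * d * th.
  move=> th0; apply: (le_trans (infl _)); rewrite sumr_const card_ord ger0_norm//.
  by rewrite -[th *+ n]mulr_natr; apply: eq_ler; field.
have t0 : 0 <= t by apply: Ex_ge0 => x; have /andP[] := F01 x.
have t1 : t <= 1 by apply: Ex_le_cst => // x; have /andP[] := F01 x.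
have d0 : 0 <= d.
  by have := le_trans (rotdist_ge0 F (fun=> 1)) (ainfl 1 ler01); lra.
pose D x := F x - t; have bD : bmf D by apply: bmfB => //; exact: bmf_cst.
have bE sg (h : 0 <= sg <= 1) := autocorr_centered bF h.
have l0 := hc_l_gt0; have r0 := @hc_r_gt0 R.
apply: (@autocorr_contra (autocorr D) (t * (1 - t)) d (@hc_l R)
    (@boundary_cst R) n%:R) hd.
- exact: ln_nat_ge.
- by rewrite ler1n.
- exact: v0.
- have tE : t * (1 - t) <= 1 * 1 by apply: ler_pM; [exact: t0|lra|exact: t1|lra].
  by rewrite mulr1 in tE.
- exact: d0.
- exact: l0.
- exact: boundary_cst_gt0.
- exact: boundary_cst_pi.
- exact: boundary_cst_l.
- by move=> sg h; exact: autocorr_ge0.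
- move=> sg h; apply: (le_trans (autocorr_log_convex bD h)).
  apply: ler_wpM2r; first exact: autocorr_ge0.
  by apply: eq_ler; exact: Ex_sqr_center.
- rewrite /hc_l opprK lnK ?posrE ?exprn_gt0//.
  have h : 0 <= @hc_r R ^+ 2 <= 1 by rewrite sqr_ge0 ltW// hc_r2_lt1.
  have pi0 := pi_gt0 R.
  rewrite (bE _ h); apply: (noise_kkl bF F01) => [|k].
    by apply: divr_ge0; [apply: mulr_ge0 => //; exact: ltW|exact: ler0n].
  apply: (le_trans (infl _)).
  rewrite (bigD1 k)//= eqxx big1 => [|j /negbTE ->]; last exact: normr0.
  rewrite addr0 ger0_norm ?divr_ge0 ?(ltW pi0)//.
  by apply: eq_ler; field.
- move=> th th0; have /andP[tha thb] := th0.
  have c01 : 0 <= cos th <= 1.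
    by rewrite cos_le1 andbT cos_ge0_pihalf//; apply/andP; split; lra.
  rewrite (bE _ c01) -/t.
  (* The squared mean cancels in [v - b (cos th)], which is thus half the rotation distance. *)
  have := ainfl th tha; rewrite (rotdist_noise bF F2 th0) -/t; lra.
Qed.

End main_bound.

(** * From the lower limit to measurable covers *)

Section boundary_content.
Context {R : realType} (n : nat).
Local Notation V := (n.-tuple (measurableTypeR R)).
Local Notation G := (@gauss R n).

(** The outer measure is an infimum over countable measurable covers; the union of a near-optimal
    one serves. *)
Lemma gauss_completed_cover (B : set V) (y : \bar R) : (gauss_completed B < y)%E ->
  exists C : set V, [/\ measurable C, B `<=` C & (G C < y)%E].
Proof.
move=> /ereal_inf_lt[_ [C [mC BC] <-] Cy].
exists (\bigcup_k C k); split => //; first exact: bigcupT_measurable.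
apply: le_lt_trans Cy.
apply: measure_sigma_subadditive => //.
exact: bigcupT_measurable.
Qed.

Lemma sub_minkowski_cube (A : set V) (r : R) : 0 <= r -> A `<=` minkowski_sum A (cube n r).
Proof.
move=> r0 x Ax; exists x => //; exists [tuple 0 | i < n] => /=.
  by move=> i; rewrite tnth_mktuple oppr_le0 r0.
by apply: eq_from_tnth => i; rewrite !tnth_mktuple addr0.
Qed.

Lemma Ex_indic (A : set V) : measurable A -> Ex G (\1_A : V -> R) = fine (G A).
Proof.
Transparent Rintegral.
by move=> mA; rewrite /Rintegral integral_indic// setIT.
Qed.
Opaque Rintegral.

Lemma gauss_fineK (A : set V) : measurable A -> (fine (G A))%:E = G A.
Proof. by move=> mA; rewrite fineK// fin_num_measure. Qed.

Lemma nbhs_right_itv (del : R) : 0 < del -> (0^'+) [set r : R | 0 < r < del].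
Proof.
move=> del0; near=> r; apply/andP; split; near: r.
- exact: nbhs_right_gt.
- exact: nbhs_right_lt.
Unshelve. all: by end_near. Qed.

(** The lower limit is a supremum of infima over neighbourhoods. If it is below [X], so is the
    infimum over each interval [(0, del)], and some [r] there has quotient below [X]. *)
Lemma cube_cover_of_limf (A : set V) (X : R) : measurable A ->
  (limf_einf (fun r : R => (gauss_completed (minkowski_sum A (cube n r)) - gauss n A)
           * (r^-1)%:E) 0^'+ < X%:E)%E -> cube_cover A X.
Proof.
move=> mA; rewrite limf_einfE => h del del0.
have {h} : (ereal_inf ((fun r : R => (gauss_completed (minkowski_sum A (cube n r)) - gauss n A)
           * (r^-1)%:E) @` [set r | (0 < r < del)%R]) < X%:E)%E.
  apply: le_lt_trans h; apply: ereal_sup_ubound; exists [set r | 0 < r < del]%R => //.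
  exact: nbhs_right_itv.
move=> /ereal_inf_lt[_ [r /= + <-]]; move=> /andP[r0 rd].
rewrite lte_pdivrMr// -EFinM => h.
have {h} /gauss_completed_cover[B [mB AB GB]] : (gauss_completed (minkowski_sum A (cube n r)) <
   (fine (G A) + X * r)%:E)%E.
  by rewrite EFinD gauss_fineK// -lteBlDl// fin_num_measure.
exists r, B; split => //; first by rewrite r0.
  move=> x v Ax vr; apply: AB; exists x => //; exists [tuple v i | i < n] => /=.
    by move=> i; rewrite tnth_mktuple -ler_norml.
  by apply: eq_from_tnth => i; rewrite !tnth_mktuple.
by rewrite !Ex_indic//; move: GB; rewrite -(gauss_fineK mB) lte_fin => /ltW.
Qed.

(** Settles the cases where the claimed lower bound is 0: dimension 1, and sets of measure 0 or
    1. *)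
Lemma limf_einf_ge0 (A : set V) : measurable A ->
  (0 <= limf_einf (fun r : R => (gauss_completed (minkowski_sum A (cube n r)) - gauss n A)
           * (r^-1)%:E) 0^'+)%E.
Proof.
move=> mA; rewrite limf_einfE; apply: le_ereal_sup_tmp.
exists (ereal_inf ((fun r : R => (gauss_completed (minkowski_sum A (cube n r)) - gauss n A)
           * (r^-1)%:E) @` [set r | (0 < r < 1)%R])%E).
  exists [set r | 0 < r < 1]%R => //; exact: nbhs_right_itv.
apply: le_ereal_inf_tmp => _ [r /= + <-]; move=> /andP[r0 _].
apply: mule_ge0; last by rewrite lee_fin invr_ge0 ltW.
rewrite sube_ge0 ?fin_num_measure//.
rewrite -(measurable_mu_extE G mA); apply: le_mu_ext.
exact/sub_minkowski_cube/ltW.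
Qed.

End boundary_content.

Theorem theorem1p8 (R : realType) :
  exists c : R, 0 < c /\
    forall (n : nat) (A : set (n.-tuple (measurableTypeR R))),
      (1 <= n)%N -> measurable A -> transitive_set A ->
      let t := fine (gauss n A) in
      ((c * t * (1 - t) * Num.sqrt (ln n%:R))%:E <=
       limf_einf (fun r : R =>
         (gauss_completed (minkowski_sum A (cube n r)) - gauss n A)
           * (r^-1)%:E) 0^'+)%E.
Proof.
exists boundary_cst; split; first exact: boundary_cst_gt0.
move=> n A n1 mA trA; lazy zeta; rewrite -(Ex_indic mA).
set t := Ex (gauss n) _.
have F01 := indic01 A; have bF : bmf (\1_A : _ -> R) by exact: bmf_indic.
have t0 : 0 <= t by apply: Ex_ge0 => x; have /andP[] := F01 x.
have t1 : t <= 1 by apply: Ex_le_cst => // x; have /andP[] := F01 x.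
have X0 := limf_einf_ge0 mA.
have [n2|] := ltnP 1 n; last first.
  move=> n2; have e : n = 1%N by apply/eqP; rewrite eqn_leq n2.
  by rewrite [X in ln X%:R]e ln1 sqrtr0 mulr0.
have [v0|v0] := ltP 0 (t * (1 - t)); last first.
  apply: le_trans X0; rewrite lee_fin -[_ * t * _]mulrA.
  apply: mulr_le0_ge0; last exact: sqrtr_ge0.
  by apply: mulr_ge0_le0 => //; exact/ltW/boundary_cst_gt0.
(* The claimed bound itself serves as the slope [d] of the cover, the equality case of
   [cube_cover_contra]. *)
rewrite leNgt; apply/negP => /(cube_cover_of_limf mA) cov.
apply: (cube_cover_contra n2 mA trA cov v0).
by rewrite -[boundary_cst * t * _]mulrA.
Qed.
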